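(* Let $G$ be a locally compact, compactly generated group with property $(T)$ but without property $FL^p$ for some $2 < p < \infty$, and let $\mu$ be a cohomologically adapted probability measure on $G$. Then for every continuous isometric representation $\pi : G \to \mathcal{O}(E)$ of $G$ on any separable $L^p$-space $E$ such that $H^1_{\mathrm{ct}}(G,\pi) \ne 0$ and for every 1-cocycle $b \in Z^1(G,\pi) \setminus B^1(G,\pi)$, there exists a constant $C = C(b,p) > 0$ such that for all $n \ge 1$: $$\|b\|_{L^p(\mu^{*n})} \ge C^{-1} n^{1/p} \qquad\text{and}\qquad \|b\|_{L^2(\mu^{*n})} \le C\, n^{1/2}.$$
   Context: An $L^p$-space is a (real) space $L^p(\Omega,m)$ for some measure space. $\mathcal{O}(E)$ is the group of linear isometries of $E$; $\pi$ is continuous if $(g,x)\mapsto\pi(g)x$ is continuous. A 1-cocycle for $\pi$ is a continuous map $b:G\to E$ with $b(gh)=b(g)+\pi(g)b(h)$; $Z^1(G,\pi)$ is the space of 1-cocycles, $B^1(G,\pi)$ the subspace of coboundaries $g\mapsto v-\pi(g)v$ ($v\in E$), and $H^1_{\mathrm{ct}}(G,\pi)=Z^1(G,\pi)/B^1(G,\pi)$. $G$ has property $FL^p$ if every continuous affine isometric action of $G$ on any separable $L^p$-space has a fixed point. Property $(T)$ is Kazhdan's property. Let $S$ be a compact generating set of $G$, $|g|_S=\min\{n\in\mathbb{N}: g\in S^n\}$, and $m_G$ the Haar measure. A probability measure $\mu$ on $G$ is cohomologically adapted if: $\mu$ is symmetric; $\mu$ is absolutely continuous with respect to $m_G$; the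 support of $\mu$ contains $S$; $\inf_{x\in S}\frac{d\mu}{dm_G}(x)>0$; and $\int_G|g|_S^r\,d\mu(g)<\infty$ for every $1\le r<\infty$. $\mu^{*n}$ is the $n$-fold convolution power, and $\|b\|_{L^r(\nu)}=\big(\int_G\|b(g)\|_E^r\,d\nu(g)\big)^{1/r}$. *)

(* Defs.v *)
From HB Require Import structures.
From mathcomp Require Import all_boot all_order all_algebra.
From mathcomp Require Import complex.
From mathcomp Require Import all_classical all_reals all_analysis.
From mathcomp Require Import measurable_realfun.

Set Implicit Arguments.
Unset Strict Implicit.
Unset Printing Implicit Defensive.

Import Order.TTheory GRing.Theory Num.Theory.
Import numFieldNormedType.Exports.

Local Open Scope classical_set_scope.
Local Open Scope ring_scope.

HB.mixin Record isTopologicalGroup G & Topological G & Group G := {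
  mulg_continuous : continuous (fun x : G * G => (x.1 * x.2)%g);
  invg_continuous : continuous (fun x : G => (x^-1)%g)
}.

#[short(type="topologicalGroupType")]
HB.structure Definition TopologicalGroup :=
  {G of Topological G & Group G & isTopologicalGroup G}.

(* [borel G] is [G] with its Borel sigma-algebra. Measurable types are pointed
   in the library; the point chosen here is the neutral element. *)
Definition borel (G : topologicalGroupType) : Type := G.

Section borel_instances.
Variable G : topologicalGroupType.
HB.instance Definition _ := TopologicalGroup.on (borel G).
HB.instance Definition _ := isPointed.Build (borel G) (1%g : G).
HB.instance Definition _ := @isMeasurable.Build (sigma_display (@open G))
  (borel G) <<s @open G >> (@sigma_algebra0 _ setT (@open G))
  (@sigma_algebraC (borel G) (@open G))
  (@sigma_algebra_bigcup _ setT (@open G)).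
End borel_instances.

Section actions.
Variables (K : numFieldType) (G : topologicalGroupType) (E : normedModType K).

Definition continuous_action (a : G -> E -> E) : Prop :=
  [/\ forall v, a 1%g v = v,
      forall g h v, a (g * h)%g v = a g (a h v) &
      continuous (fun x : G * E => a x.1 x.2)].

(* Each [pi g] is onto, with inverse [pi g^-1], by the action axioms. *)
Definition isometric_rep (pi : G -> {linear E -> E}) : Prop :=
  continuous_action (fun g => pi g) /\ forall g v, `|pi g v| = `|v|.

Definition affine_isometric_action (a : G -> E -> E) : Prop :=
  [/\ continuous_action a,
      forall g t u v,
        a g (t *: u + (1 - t) *: v) = t *: a g u + (1 - t) *: a g v &
      forall g u v, `|a g u - a g v| = `|u - v|].

Definition Z1 (pi : G -> {linear E -> E}) : set (G -> E) :=
  [set b | continuous b /\ forall g h, b (g * h)%g = b g + pi g (b h)].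

Definition B1 (pi : G -> {linear E -> E}) : set (G -> E) :=
  [set b | exists v, forall g, b g = v - pi g v].

(* The quotient of [Z1 pi] by [B1 pi] is not the zero space. *)
Definition H1_neq0 (pi : G -> {linear E -> E}) : Prop :=
  Z1 pi `\` B1 pi !=set0.

End actions.

(* There are a compact set [Q] and [eps > 0] such that every continuous unitary
   representation on a complex Hilbert space with a (Q, eps)-invariant vector
   has a nonzero invariant vector. A Hilbert space is rendered as a complex
   Banach space whose norm comes from the inner product [dotp], which is linear
   in its first argument. *)
Definition propertyT (R : realType) (G : topologicalGroupType) : Prop :=
  exists (Q : set G) (eps : R), [/\ compact Q, 0 < eps &
    forall (H : completeNormedModType R[i]) (dotp : {dot H for Num.conj})
           (pi : G -> {linear H -> H}),
      (forall v : H, `|v| ^+ 2 = dotp v v) ->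
      continuous_action (fun g => pi g) ->
      (forall g u v, dotp (pi g u) (pi g v) = dotp u v) ->
      (exists2 v : H, v != 0 & forall g, Q g -> `|pi g v - v| < eps%:C%C * `|v|) ->
      exists2 v : H, v != 0 & forall g, pi g v = v].

Section Lp_spaces.
Variables (R : realType) (p : R).

(* [E] is, up to linear isometry, L^p(Omega, m). [LfunType m p1] consists of
   functions, not of almost-everywhere classes, and [J] is the quotient map:
   its kernel is the set of functions vanishing almost everywhere. *)
Definition Lp_space (E : normedModType R) : Prop :=
  exists (p1 : (1 <= p%:E)%E) (d : measure_display) (Omega : measurableType d)
    (m : {measure set Omega -> \bar R}) (J : {linear LfunType m p1 -> E}),
    (forall f : LfunType m p1, (`|J f|%:E = 'N[m]_p%:E[EFin \o f])%E) /\
    (forall v : E, exists f : LfunType m p1, J f = v).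

Definition separable_space (T : topologicalType) : Prop :=
  exists2 D : set T, countable D & dense D.

Definition property_FLp (G : topologicalGroupType) : Prop :=
  forall (E : completeNormedModType R) (a : G -> E -> E),
    Lp_space E -> separable_space E -> affine_isometric_action a ->
    exists v, forall g, a g v = v.

End Lp_spaces.

Section word_length.
Variables (G : topologicalGroupType) (S : set G).

Fixpoint set_exp (n : nat) : set G :=
  if n is k.+1 then [set (x * y)%g | x in S & y in set_exp k] else [set 1%g].

(* The powers of [S] exhaust [G], so that the word length is defined
   everywhere; [S] itself need not be symmetric. *)
Definition generating : Prop := forall g, exists n, set_exp n g.

(* The default value 0 of [xget] is not reached when [S] is generating. *)
Definition word_length (g : G) : nat :=
  xget 0%N [set n | set_exp n g /\ forall k, set_exp k g -> (n <= k)%N].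

End word_length.

Section measures.
Variables (R : realType) (G : topologicalGroupType).
Local Open Scope ereal_scope.
Implicit Types mG : {measure set (borel G) -> \bar R}.

(* A nonzero left-invariant Radon measure. *)
Definition is_haar mG : Prop :=
  [/\ mG setT != 0,
      forall (g : G) (A : set (borel G)), measurable A ->
        mG [set (g * x)%g | x in A] = mG A,
      forall K : set G, compact K -> mG K < +oo,
      forall A : set (borel G), measurable A ->
        mG A = ereal_inf [set mG U | U in [set U : set G | open U /\ A `<=` U]] &
      forall U : set G, open U ->
        mG U = ereal_sup [set mG K | K in [set K : set G | compact K /\ K `<=` U]]].

Definition msupport (mu : set (borel G) -> \bar R) : set G :=
  [set x | forall U : set G, open U -> U x -> 0 < mu U].

Definition is_density (mu : set (borel G) -> \bar R) mG
    (f : borel G -> \bar R) : Prop :=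
  [/\ measurable_fun setT f, forall x, 0 <= f x &
      forall A, measurable A -> mu A = \int[mG]_(x in A) f x].

(* The derivative d mu / d mG is only defined up to null sets: the lower bound
   on [S] is required of some version [f] of it. *)
Definition cohomologically_adapted (S : set G) mG
    (mu : probability (borel G) R) : Prop :=
  [/\ forall A : set (borel G), measurable A -> mu [set (x^-1)%g | x in A] = mu A,
      mu `<< mG,
      S `<=` msupport mu,
      exists2 f : borel G -> \bar R,
        is_density mu mG f & 0 < ereal_inf (f @` S) &
      forall r : R, (1 <= r)%R ->
        \int[mu]_g ((word_length S g)%:R `^ r)%:E < +oo].

(* Integrating the translates of [nu], rather than pushing the product measure
   forward, avoids the product sigma-algebra, for which multiplication need not
   be measurable when [G] is not second countable. *)
Definition convolution (mu nu : set (borel G) -> \bar R)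
    (A : set (borel G)) : \bar R :=
  \int[mu]_x nu [set y | A (x * y)%g].

Fixpoint conv_exp (mu : set (borel G) -> \bar R) (n : nat) :
    set (borel G) -> \bar R :=
  if n is k.+1 then convolution mu (conv_exp mu k) else \d_(1%g : borel G).

Definition Lr_norm (E : normedModType R) (r : R) (nu : set (borel G) -> \bar R)
    (b : G -> E) : \bar R :=
  (\int[nu]_g (`|b g| `^ r)%:E) `^ r^-1.

End measures.

(* Main.v *)
Require Import Defs.
From HB Require Import structures.
From mathcomp Require Import all_boot all_order all_algebra.
From mathcomp Require Import complex ring lra.
From mathcomp Require Import all_classical all_reals all_analysis.
From mathcomp Require Import measurable_realfun generic_quotient giry.
Set Implicit Arguments.
Unset Strict Implicit.
Unset Printing Implicit Defensive.
Import Order.TTheory GRing.Theory Num.Theory.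
Import numFieldNormedType.Exports.
Local Open Scope classical_set_scope.
Local Open Scope ring_scope.

(** Property (T) makes every cocycle b of an isometric representation pi on an
    L^p-space, p > 2, harmonic up to a coboundary. Along the random walk a
    harmonic cocycle behaves like a martingale in a space that is uniformly
    convex of power type p and uniformly smooth of power type 2, so its p-th
    moment grows at least linearly and at most like n^(p/2).

    Write D x for the derivative at x of the p-th power of the norm, divided by
    p. Integrating elementary inequalities between real numbers over the
    underlying measure space gives constants c, C > 0 such that
      |x|^p + p D x y + c |y|^p <= |x + y|^p
        <= |x|^p + p D x y + C (s^2 |x|^p + s^(2 - p) |y|^p)
    whenever 0 < s <= 1 ([duality_map], [Lp_space_duality]). For a cocycle b,
    |b(x y)| = |b(y) - b(x^-1)|. Apply the inequalities to b(y) and - b(x^-1) and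
    integrate, over y for the n-th convolution power and over x for mu. The
    middle term is the mu-mean of a bounded linear functional of b(x^-1), which
    vanishes when b is harmonic ([rI_profile]). The left inequality then adds a
    fixed positive amount to the p-th moment at each step ([moment_lower]); the
    right one, with s^2 of order 1/n, keeps it of order n^(p/2)
    ([moment_upper]), and truncating at height n^(1/2) yields the bound on the
    second moment ([second_moment_bound]).

    Harmonicity is reached by subtracting a coboundary v - pi(g) v for which
    v - A v = z, where A v and z are the mu-means of pi(x) v and of b(x)
    ([barycenter]). The orthogonal complement of the invariant vectors is
    replaced by the subspace of those u with D w u = 0 for every invariant w. It
    contains z, because D w turns b into a homomorphism to the real numbers and
    mu is symmetric, and (1 + A)/2 is a strict contraction on it
    ([half_average_contraction]). By uniform convexity the contraction follows
    from a lower bound on the mean displacement of unit vectors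
    ([displacement_gap]), which rests on two facts.
    - A displacement that is small in mean is small on any given compact set
      ([length_compact]): mu is absolutely continuous, so a set of almost full
      measure meets all its small translates, and the support of mu generates G.
    - A vector that is displaced little by the compact set of property (T) is
      close to an invariant one ([propertyT_almost_invariant]). The Mazur map
      a |-> sign(a) |a|^(p/2) from L^p to L^2 conjugates linear isometries to
      linear isometries, by Lamperti's argument ([Mazur_isometry]), so that
      property (T) applies in L^2; the map and its inverse are uniformly
      continuous on bounded sets ([Lp_space_mazur]).

    Finally b differs from its harmonic representative by a bounded function,
    which settles large n. For small n, the moments e(n) of b satisfy
    e(m + n) <= 2^p (e(m) + e(n)), so that a vanishing one would vanish along
    all multiples of n ([linear_lower_bound]). *)

(** * Inequalities for real powers *)

Section scalar_inequalities.
Context {R : realType}.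
Implicit Types x y a b h s t p r : R.

Lemma invS_small (e : R) : 0 < e -> exists N : nat, N.+1%:R^-1 < e.
Proof.
move=> e0; exists (Num.truncn (1 / e)).
by rewrite -[ltLHS]mul1r ltr_pdivrMr ?ltr0n// mulrC -ltr_pdivrMr// truncnS_gt.
Qed.

Lemma invS_le m n : (m <= n)%N -> n.+1%:R^-1 <= m.+1%:R^-1 :> R.
Proof. by move=> mn; rewrite lef_pV2 ?posrE ?ltr0n// ler_nat. Qed.

(** The tangent line inequality for the convex function t `^ p is Young's
    inequality for the exponents p and p / (p - 1). *)
Lemma powR_tangent p s t : 1 <= p -> 0 <= s -> 0 <= t ->
  s `^ p + p * s `^ (p - 1) * (t - s) <= t `^ p.
Proof.
move=> p1 s0 t0; have [->|pN1] := eqVneq p 1.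
  by rewrite subrr powRr0 !powRr1// mulr1 mul1r subrKC.
have {pN1}p1 : 1 < p by rewrite lt_neqAle eq_sym pN1.
have p0 : 0 < p by rewrite (lt_trans ltr01).
have pB : 0 < p - 1 by rewrite subr_gt0.
have q0 : 0 < p / (p - 1) by rewrite divr_gt0.
have pq : p^-1 + (p / (p - 1))^-1 = 1.
  by field; rewrite !gt_eqF// subr_gt0.
have := conjugate_powR t0 (powR_ge0 s (p - 1)) p0 q0 pq.
rewrite -powRrM (_ : (p - 1) * (p / (p - 1)) = p); last first.
  by field; rewrite gt_eqF.
rewrite -(ler_pM2l p0) => H.
have ss : s `^ (p - 1) * s = s `^ p by rewrite mulrC mulr_powRB1.
suff -> : s `^ p + p * s `^ (p - 1) * (t - s) =
    p * (t * s `^ (p - 1)) - (p - 1) * s `^ p.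
  rewrite lerBlDr (le_trans H)//.
  rewrite le_eqVlt; apply/orP; left; apply/eqP.
  by field; rewrite !gt_eqF.
by rewrite -ss; ring.
Qed.

(** The odd extension of the power function to the real line. *)
Definition spow r x : R := Num.sg x * `|x| `^ r.

Lemma spow0 r : spow r 0 = 0. Proof. by rewrite /spow sgr0 mul0r. Qed.

Lemma spow_ge0 r x : 0 <= x -> r != 0 -> spow r x = x `^ r.
Proof.
rewrite le_eqVlt => /predU1P[<- r0|x0 _].
  by rewrite spow0 powR0.
by rewrite /spow gtr0_sg// mul1r gtr0_norm.
Qed.

Lemma spowN r x : spow r (- x) = - spow r x.
Proof. by rewrite /spow sgrN normrN mulNr. Qed.

Lemma norm_spow r x : r != 0 -> `|spow r x| = `|x| `^ r.
Proof.
move=> r0; rewrite /spow normrM (ger0_norm (powR_ge0 _ _)).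
have [->|x0] := eqVneq x 0; first by rewrite sgr0 normr0 mul0r powR0.
by rewrite normr_sg x0 mul1r.
Qed.

Lemma spowM r x y : spow r (x * y) = spow r x * spow r y.
Proof. by rewrite /spow sgrM normrM powRM//; ring. Qed.

Lemma spowK r x : 0 < r -> spow r^-1 (spow r x) = x.
Proof.
move=> r0; rewrite {1}/spow norm_spow ?gt_eqF// -powRrM divff ?gt_eqF//.
rewrite powRr1// /spow sgrM sgr_id.
have [->|x0] := eqVneq x 0; first by rewrite sgr0 !mul0r.
by rewrite (gtr0_sg (powR_gt0 _ _)) ?normr_gt0// mulr1 -numEsg.
Qed.

Lemma mulr_spow r x : 0 < r -> spow (r - 1) x * x = `|x| `^ r.
Proof.
by move=> r0; rewrite /spow mulrAC -normrEsg mulr_powRB1.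
Qed.

Lemma powR_superadd r x y : 1 <= r -> 0 <= x -> 0 <= y ->
  x `^ r + y `^ r <= (x + y) `^ r.
Proof.
move=> r1 x0 y0; have r0 : 0 < r by rewrite (lt_le_trans ltr01).
have rB : 0 <= r - 1 by rewrite subr_ge0.
rewrite -!(@mulr_powRB1 _ _ r)//; last by rewrite addr_ge0.
rewrite mulrDl lerD// ler_wpM2l// ge0_ler_powR// ?nnegrE ?addr_ge0//.
  by rewrite lerDl.
by rewrite lerDr.
Qed.

Lemma powR_superadd_lt r x y : 1 < r -> 0 < x -> 0 < y ->
  x `^ r + y `^ r < (x + y) `^ r.
Proof.
move=> r1 x0 y0; have r0 : 0 < r by rewrite (lt_trans ltr01).
have rB : 0 < r - 1 by rewrite subr_gt0.
have xy0 : 0 < x + y by rewrite addr_gt0.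
rewrite -!(@mulr_powRB1 _ _ r) ?ltW//.
rewrite mulrDl ltrD// ltr_pM2l// gt0_ltr_powR// ?nnegrE ?ltW//.
  by rewrite ltrDl.
by rewrite ltrDr.
Qed.

Lemma powR_add_le r x y : 0 <= r -> 0 <= x -> 0 <= y ->
  (x + y) `^ r <= 2 `^ r * (x `^ r + y `^ r).
Proof.
move=> r0; wlog xy : x y / x <= y.
  move=> H x0 y0; have [xy|yx] := leP x y; first exact: H.
  by rewrite addrC [x `^ r + _]addrC H// ltW.
move=> x0 y0; apply: (@le_trans _ _ ((2 * y) `^ r)).
  by rewrite ge0_ler_powR// ?nnegrE ?addr_ge0 ?mulr_ge0// mulr_natl mulr2n lerD2r.
by rewrite powRM// ler_wpM2l ?powR_ge0// lerDr powR_ge0.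
Qed.

Lemma sqr_powR p x : (x ^+ 2) `^ (p / 2) = `|x| `^ p.
Proof.
rewrite -real_normK ?num_real// -powR_mulrn// -powRrM.
by congr (_ `^ _); field.
Qed.

Lemma sqr_spow p x : 0 < p -> spow (p / 2) x ^+ 2 = `|x| `^ p.
Proof.
move=> p0; rewrite -real_normK ?num_real// norm_spow ?gt_eqF ?divr_gt0//.
by rewrite -powR_mulrn ?powR_ge0// -powRrM; congr (_ `^ _); field.
Qed.

(** The parallelogram law puts the mean of the squares of x + y and x - y at
    x^2 + y^2; the power p/2 is convex and superadditive. *)
Lemma clarkson p x y : 2 <= p ->
  2 * ((x ^+ 2 + y ^+ 2) `^ (p / 2)) <= `|x + y| `^ p + `|x - y| `^ p.
Proof.
move=> p2; have r1 : 1 <= p / 2 by lra.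
have m0 : 0 <= x ^+ 2 + y ^+ 2 by rewrite addr_ge0 ?sqr_ge0.
have := powR_tangent r1 m0 (sqr_ge0 (x + y)).
have := powR_tangent r1 m0 (sqr_ge0 (x - y)).
rewrite 2!sqr_powR.
set m := x ^+ 2 + y ^+ 2; set k := _ * m `^ _.
have -> : (x - y) ^+ 2 - m = - 2 * x * y by rewrite /m; ring.
have -> : (x + y) ^+ 2 - m = 2 * x * y by rewrite /m; ring.
by set u := `|_| `^ p; set v := `|_| `^ p; lra.
Qed.

Lemma clarkson_le p x y : 2 <= p ->
  2 * (`|x| `^ p + `|y| `^ p) <= `|x + y| `^ p + `|x - y| `^ p.
Proof.
move=> p2; apply: le_trans (clarkson _ _ p2).
rewrite ler_pM2l// -!sqr_powR powR_superadd ?sqr_ge0//; lra.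
Qed.

Lemma clarkson_eq p x y : 2 < p ->
  `|x + y| `^ p + `|x - y| `^ p = 2 * (`|x| `^ p + `|y| `^ p) -> x * y = 0.
Proof.
move=> p2 H; apply/eqP/negPn/negP; rewrite mulf_eq0 negb_or => /andP[x0 y0].
have := clarkson x y (ltW p2); rewrite H ler_pM2l// -!sqr_powR leNgt.
move/negP; apply; rewrite powR_superadd_lt ?exprn_even_gt0//; lra.
Qed.

Lemma clarkson_prod0 p x y : p != 0 -> x * y = 0 ->
  `|x + y| `^ p + `|x - y| `^ p = 2 * (`|x| `^ p + `|y| `^ p).
Proof.
move=> p0 /eqP; rewrite mulf_eq0 => /orP[]/eqP ->.
  by rewrite add0r sub0r normrN normr0 powR0//; ring.
by rewrite addr0 subr0 normr0 powR0//; ring.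
Qed.

Lemma powR_tangent_norm p a h : 1 <= p ->
  `|a| `^ p + p * spow (p - 1) a * h <= `|a + h| `^ p.
Proof.
move=> p1; have p0 : 0 < p by rewrite (lt_le_trans ltr01).
apply: (le_trans _ (powR_tangent p1 (normr_ge0 a) (normr_ge0 (a + h)))).
rewrite lerD2l -!mulrA ler_pM2l// /spow mulrCA.
apply: ler_wpM2l; first exact: powR_ge0.
rewrite lerBrDr [`|a|]normrEsg -mulrDr addrC.
apply: le_trans (ler_norm _) _; rewrite normrM normr_sg.
by case: (a != 0); rewrite ?mul1r// mul0r.
Qed.

(** Uniform convexity as a strengthened tangent inequality: Clarkson's
    inequality bounds the midpoint value, and the tangent at a bounds the
    midpoint value from below. *)
Lemma powR_convex p a b : 2 <= p ->
  `|a| `^ p + p * spow (p - 1) a * b + 2 `^ (1 - p) * `|b| `^ p <= `|a + b| `^ p.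
Proof.
move=> p2; have p1 : 1 <= p by lra.
have T := powR_tangent_norm a (b / 2) p1.
have := clarkson_le (a + b / 2) (b / 2) p2.
have -> : a + b / 2 + b / 2 = a + b by field.
have -> : a + b / 2 - b / 2 = a by ring.
rewrite normrM (powRM _ (normr_ge0 _) (normr_ge0 _)) [`|2^-1|]gtr0_norm//.
have -> : 2^-1 `^ p = 2 `^ (1 - p) / 2 :> R.
  rewrite powRB; last by apply/implyP.
  have -> : 2^-1 `^ p = (2 `^ p)^-1 :> R.
    by rewrite -powR_inv1// -powRrM mulN1r powRN.
  by rewrite powRr1// mulrAC divff ?mul1r.
move: T; set A := `|a| `^ p; set K := `|a + b / 2| `^ p.
set J := spow _ _; set B := `|b| `^ p; set c := 2 `^ _.
set D := `|a + b| `^ p; nra.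
Qed.

(** On one side of zero this is the tangent inequality; for arguments of
    opposite signs, superadditivity. *)
Lemma spow_lip r x y : 1 <= r ->
  `|spow r x - spow r y| <= r * `|x - y| * (`|x| + `|y|) `^ (r - 1).
Proof.
move=> r1; have r0 : 0 < r by rewrite (lt_le_trans ltr01).
have rN0 : r != 0 by rewrite gt_eqF.
have rB : 0 <= r - 1 by rewrite subr_ge0.
wlog : x y / 0 <= x.
  move=> H; have [x0|x0] := leP 0 x; first exact: H.
  have := H (- x) (- y); rewrite oppr_ge0 ltW// => /(_ isT).
  by rewrite !spowN !normrN -!opprD !normrN.
have [y0|y0] := leP 0 y; last first.
  move=> x0; have ny0 : 0 <= - y by rewrite oppr_ge0 ltW.
  have := spowN r (- y); rewrite opprK => ->; rewrite opprK !spow_ge0//.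
  rewrite ger0_norm ?addr_ge0 ?powR_ge0//.
  rewrite (ger0_norm x0) (ltr0_norm y0) ger0_norm ?addr_ge0//.
  rewrite -mulrA mulr_powRB1 ?addr_ge0//.
  apply: le_trans (powR_superadd r1 x0 ny0) _.
  by rewrite ler_peMl ?powR_ge0.
move: x y y0; have H x y : 0 <= y -> 0 <= x -> y <= x ->
  `|spow r x - spow r y| <= r * `|x - y| * (`|x| + `|y|) `^ (r - 1).
  move=> y0 x0 yx; rewrite !spow_ge0// (ger0_norm x0) (ger0_norm y0).
  rewrite [`|x - y|]ger0_norm ?subr_ge0// ger0_norm; last first.
    by rewrite subr_ge0 ge0_ler_powR// ?nnegrE// ltW.
  have T := powR_tangent r1 x0 y0.
  apply: (@le_trans _ _ (r * (x - y) * x `^ (r - 1))); first lra.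
  apply: ler_wpM2l; first by rewrite mulr_ge0 ?subr_ge0// ltW.
  by rewrite ge0_ler_powR// ?nnegrE ?addr_ge0// lerDl.
move=> x y y0 x0; have [yx|xy] := leP y x; first exact: H.
by rewrite distrC [`|x - y|]distrC [`|x| + _]addrC H// ltW.
Qed.

(** An additive form of Hoelder's inequality: whichever of x and s y is larger
    absorbs the other. *)
Lemma powR_split p r s x y : 0 < r < p -> 0 < s -> 0 <= x -> 0 <= y ->
  x `^ r * y `^ (p - r) <= s `^ r * y `^ p + s `^ (r - p) * x `^ p.
Proof.
move=> /andP[r0 rp] s0 x0 y0; have p0 : p != 0 by rewrite gt_eqF// (lt_trans r0).
have pr : 0 < p - r by rewrite subr_gt0.
have HH z : z `^ r * z `^ (p - r) = z `^ p.
  by rewrite -powRD addrC subrK// (negbTE p0).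
have [xsy|syx] := leP x (s * y).
  apply: (@le_trans _ _ (s `^ r * y `^ p)); last first.
    by rewrite lerDl mulr_ge0 ?powR_ge0.
  rewrite -(HH y) mulrA -powRM//; last exact: ltW.
  rewrite ler_wpM2r ?powR_ge0// ge0_ler_powR// ?nnegrE ?mulr_ge0//; exact: ltW.
apply: (@le_trans _ _ (s `^ (r - p) * x `^ p)); last first.
  by rewrite lerDr mulr_ge0 ?powR_ge0.
rewrite -(HH x) mulrCA ler_wpM2l ?powR_ge0//.
have -> : s `^ (r - p) = (s `^ (p - r))^-1 by rewrite -powRN opprB.
rewrite ler_pdivlMl ?powR_gt0// -powRM//; last exact: ltW.
by rewrite ge0_ler_powR ?nnegrE// ?mulr_ge0// ltW.
Qed.

Lemma powR_split2 p s x y : 2 < p -> 0 < s -> 0 <= x -> 0 <= y ->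
  x ^+ 2 * y `^ (p - 2) <= s ^+ 2 * y `^ p + s `^ (2 - p) * x `^ p.
Proof.
move=> p2 s0 x0 y0; have r2 : (0 : R) < 2 < p by apply/andP; split; lra.
have := powR_split r2 s0 x0 y0.
by rewrite (powR_mulrn 2 x0) (powR_mulrn 2 (ltW s0)).
Qed.

(** The smoothness counterpart of [powR_convex]: the tangent at a + b bounds the
    error by the increment of the derivative, which [powR_split2] splits. The
    parameter s makes a small multiple of the p-th power of a pay for a term
    that is quadratic in b. *)
Lemma powR_smooth p : 2 < p -> exists2 C : R, 0 < C & forall s a b, 0 < s <= 1 ->
  `|a + b| `^ p <= `|a| `^ p + p * spow (p - 1) a * b
     + C * (s ^+ 2 * `|a| `^ p + s `^ (2 - p) * `|b| `^ p).
Proof.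
move=> p2; have p0 : 0 < p by lra.
have p1 : 1 <= p by lra.
have p11 : 1 <= p - 1 by lra.
pose A := p * (p - 1) * 2 `^ (p - 2); pose C := A * (2 `^ p + 1).
have A0 : 0 < A by rewrite !mulr_gt0// ?powR_gt0//; lra.
exists (A * (2 `^ p + 2 `^ p + 1)).
  by rewrite mulr_gt0// !addr_gt0// powR_gt0.
move=> s a b /andP[s0 s1].
have T := powR_tangent_norm (a + b) (- b) p1; rewrite addrK in T.
have L := spow_lip (a + b) a p11.
rewrite (_ : a + b - a = b) in L; last by ring.
rewrite (_ : p - 1 - 1 = p - 2) in L; last by ring.
set w := `|a| + `|b|.
have w0 : 0 <= w by rewrite addr_ge0.
have L2 : p * (spow (p - 1) (a + b) - spow (p - 1) a) * b <= A * (`|b| ^+ 2 * w `^ (p - 2)).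
  apply: le_trans (ler_norm _) _.
  rewrite !normrM (gtr0_norm p0).
  apply: (@le_trans _ _ (p * ((p - 1) * `|b| * (`|a + b| + `|a|) `^ (p - 2)) * `|b|)).
    by rewrite ler_wpM2r// ler_pM2l.
  apply: (@le_trans _ _ (p * ((p - 1) * `|b| * (2 * w) `^ (p - 2)) * `|b|)).
    rewrite ler_wpM2r// ler_pM2l//; apply: ler_wpM2l; first by rewrite mulr_ge0//; lra.
    apply: ge0_ler_powR; [lra|by rewrite nnegrE addr_ge0|by rewrite nnegrE mulr_ge0|].
    by rewrite mulr_natl mulr2n lerD ?lerDl// ler_normD.
  rewrite powRM// /A le_eqVlt; apply/orP; left; apply/eqP; ring.
have S := powR_split2 p2 s0 (normr_ge0 b) w0.
have W := powR_add_le (ltW p0) (normr_ge0 a) (normr_ge0 b).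
have s2 : s ^+ 2 <= s `^ (2 - p).
  apply: (@le_trans _ _ 1); first by rewrite expr_le1// ltW.
  have -> : s `^ (2 - p) = (s `^ (p - 2))^-1 by rewrite -powRN opprB.
  rewrite invf_ge1 ?powR_gt0// -[leRHS](powRr0 s); apply: ger_powR; last by rewrite subr_ge0 ltW.
  by rewrite s0.
have s20 : 0 <= s ^+ 2 by rewrite sqr_ge0.
move: S W s2 s20 T L2; rewrite -/w.
have := powR_ge0 `|a| p; have := powR_ge0 `|b| p.
set a' := `|a| `^ p; set b' := `|b| `^ p; set w' := w `^ p.
set u := _ * w `^ _; set P := 2 `^ p; set s' := s `^ _; set ss := s ^+ 2.
set D := `|a + b| `^ p; set J1 := spow _ _; set J2 := spow _ _.
move=> b0 a0 S W s2 s20 T L2.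
have Hu : u <= (P + P + 1) * (ss * a' + s' * b').
  have h1 : ss * w' <= P * (ss * a') + P * (s' * b').
    apply: (@le_trans _ _ (ss * (P * (a' + b')))); first by rewrite ler_wpM2l.
    have : ss * b' <= s' * b' by rewrite ler_wpM2r.
    have P0 : 0 <= P by rewrite powR_ge0.
    move=> /(ler_wpM2l P0); lra.
  have h2 : 0 <= ss * a' by rewrite mulr_ge0.
  have h3 : 0 <= s' * b' by rewrite mulr_ge0// powR_ge0.
  have h4 : 0 <= P * (ss * a') by rewrite mulr_ge0// powR_ge0.
  have h5 : 0 <= P * (s' * b') by rewrite mulr_ge0// powR_ge0.
  lra.
have := ler_wpM2l (ltW A0) Hu; rewrite mulrA => Hu'.
clearbody A u P s' ss D J1 J2 a' b' w'; nra.
Qed.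

(** Integrated, this lemma and the next are the uniform continuity on bounded
    sets of the Mazur map from L^p to L^2 and of its inverse. *)
Lemma mazur_upper p : 2 < p -> exists2 C : R, 0 < C & forall s a b, 0 < s ->
  (spow (p / 2) a - spow (p / 2) b) ^+ 2 <=
  C * (s ^+ 2 * (`|a| `^ p + `|b| `^ p) + s `^ (2 - p) * `|a - b| `^ p).
Proof.
move=> p2; have p0 : 0 < p by lra.
exists ((p / 2) ^+ 2 * (2 `^ p + 1)).
  by rewrite mulr_gt0 ?exprn_gt0 ?divr_gt0// addr_gt0.
move=> s a b s0; rewrite -real_normK ?num_real//.
set w := `|a| + `|b|; have w0 : 0 <= w by rewrite addr_ge0.
have L : `|spow (p / 2) a - spow (p / 2) b| <= p / 2 * `|a - b| * w `^ (p / 2 - 1).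
  by apply: spow_lip; lra.
have : `|spow (p / 2) a - spow (p / 2) b| ^+ 2 <=
    (p / 2 * `|a - b| * w `^ (p / 2 - 1)) ^+ 2.
  by rewrite ler_sqr ?nnegrE// !mulr_ge0 ?powR_ge0// ltW.
move=> /le_trans; apply.
rewrite 2!exprMn -(powR_mulrn _ (powR_ge0 _ _)) -powRrM.
rewrite (_ : (p / 2 - 1) * 2 = p - 2); last by field.
rewrite -2!mulrA ler_pM2l ?exprn_gt0 ?divr_gt0//.
apply: le_trans (powR_split2 p2 s0 (normr_ge0 _) w0) _.
rewrite mulrDl mul1r mulrDr.
have W := powR_add_le (ltW p0) (normr_ge0 a) (normr_ge0 b).
have s20 : 0 <= s ^+ 2 by rewrite sqr_ge0.
have h1 : s ^+ 2 * w `^ p <= 2 `^ p * (s ^+ 2 * (`|a| `^ p + `|b| `^ p)).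
  by rewrite mulrCA ler_wpM2l.
have h2 : 0 <= s ^+ 2 * (`|a| `^ p + `|b| `^ p).
  by rewrite mulr_ge0// addr_ge0 ?powR_ge0.
have h3 : 0 <= s `^ (2 - p) * `|a - b| `^ p by rewrite mulr_ge0 ?powR_ge0.
have h4 : 0 <= 2 `^ p * (s `^ (2 - p) * `|a - b| `^ p) by rewrite mulr_ge0 ?powR_ge0.
lra.
Qed.

Lemma mazur_lower p a b : 2 <= p ->
  `|a - b| `^ p <= 4 `^ p * (spow (p / 2) a - spow (p / 2) b) ^+ 2.
Proof.
move=> p2; have p0 : 0 < p by lra.
have r1 : 1 <= p / 2 by lra.
have rN0 : p / 2 != 0 by rewrite gt_eqF// divr_gt0.
wlog : a b / 0 <= a.
  move=> H; have [a0|a0] := leP 0 a; first exact: H.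
  have := H (- a) (- b); rewrite oppr_ge0 ltW// => /(_ isT).
  by rewrite !spowN -!opprD normrN sqrrN.
have pos x y : 0 <= x -> 0 <= y -> y <= x ->
  `|x - y| `^ p <= 4 `^ p * (spow (p / 2) x - spow (p / 2) y) ^+ 2.
  move=> x0 y0 yx; have xy : 0 <= x - y by rewrite subr_ge0.
  rewrite -sqr_spow// !spow_ge0 ?(ger0_norm xy)//.
  rewrite (@le_trans _ _ ((x `^ (p / 2) - y `^ (p / 2)) ^+ 2))//.
    have := powR_superadd r1 xy y0; rewrite subrK -lerBrDr => H.
    rewrite ler_sqr// ?nnegrE ?powR_ge0//.
    by rewrite (le_trans _ H)// powR_ge0.
  rewrite ler_peMl ?sqr_ge0//; apply: (@le_trans _ _ (4 `^ 0)); first by rewrite powRr0.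
  by rewrite ler_powR//; [lra|exact: ltW].
move=> a0; have [b0|b0] := leP 0 b.
  have [ba|ab] := leP b a; first exact: pos.
  by rewrite distrC -[X in _ <= _ * X]sqrrN opprB pos// ltW.
have nb0 : 0 <= - b by rewrite oppr_ge0 ltW.
have := spowN (p / 2) (- b); rewrite opprK => ->; rewrite opprK (ger0_norm (addr_ge0 a0 nb0)) !spow_ge0//.
apply: (le_trans (powR_add_le (ltW p0) a0 nb0)).
have -> : 4 = 2 * 2 :> R by ring.
have A0 := powR_ge0 a (p / 2); have B0 := powR_ge0 (- b) (p / 2).
have PP x : 0 <= x -> x `^ p = (x `^ (p / 2)) ^+ 2.
  by move=> x0; rewrite -(spow_ge0 x0 rN0) sqr_spow// ger0_norm.
rewrite powRM// -mulrA ler_pM2l ?powR_gt0// (PP _ a0) (PP _ nb0).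
apply: (@le_trans _ _ ((a `^ (p / 2) + (- b) `^ (p / 2)) ^+ 2)); first nra.
rewrite ler_peMl ?sqr_ge0//; apply: (@le_trans _ _ (2 `^ 0)); first by rewrite powRr0.
by rewrite ler_powR//; [lra|exact: ltW].
Qed.

End scalar_inequalities.

(** * Integrals of real functions *)

Section real_integral.
Context {d} {T : measurableType d} {R : realType} (m : {measure set T -> \bar R}).
Implicit Types f g : T -> R.

Notation rint f := (m.-integrable setT (EFin \o f)).
Notation rI f := (\int[m]_x f x).

Lemma rint_meas f : rint f -> measurable_fun setT f.
Proof. by move=> /measurable_int/measurable_EFinP. Qed.

Lemma rintD f g : rint f -> rint g -> rint (fun x => f x + g x).
Proof. by move=> fi gi; have := integrableD measurableT fi gi. Qed.

Lemma rintZ a f : rint f -> rint (fun x => a * f x).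
Proof. by move=> ?; exact: (@integrableZl _ _ _ m setT measurableT a (EFin \o f)). Qed.

Lemma rintB f g : rint f -> rint g -> rint (fun x => f x - g x).
Proof. by move=> fi gi; have := integrableB measurableT fi gi. Qed.

Lemma rint_dom f g : measurable_fun setT f -> rint g ->
  (forall x, `|f x| <= g x) -> rint f.
Proof.
move=> mf ig fg; apply: (le_integrable measurableT _ _ ig).
  exact/measurable_EFinP.
by move=> x _ /=; rewrite lee_fin (le_trans (fg x))// ler_norm.
Qed.

Lemma rID f g : rint f -> rint g -> rI (fun x => f x + g x) = rI f + rI g.
Proof. by move=> ? ?; exact: RintegralD. Qed.

Lemma rIB f g : rint f -> rint g -> rI (fun x => f x - g x) = rI f - rI g.
Proof. by move=> ? ?; exact: RintegralB. Qed.

Lemma rIZ a f : rint f -> rI (fun x => a * f x) = a * rI f.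
Proof. by move=> ?; exact: RintegralZl. Qed.

Lemma rI_le f g : rint f -> rint g -> (forall x, f x <= g x) -> rI f <= rI g.
Proof. by move=> ? ? fg; apply: le_Rintegral. Qed.

Lemma rI_ge0 f : (forall x, 0 <= f x) -> 0 <= rI f.
Proof. by move=> f0; exact: Rintegral_ge0. Qed.

Lemma rI_norm f : rint f -> `|rI f| <= rI (fun x => `|f x|).
Proof. by move=> ?; exact: le_normr_Rintegral. Qed.

Lemma rI_norm_le f g : rint f -> rint g -> (forall x, `|f x| <= g x) -> `|rI f| <= rI g.
Proof.
move=> fi gi fg; apply: (le_trans (rI_norm fi)); apply: rI_le => //.
exact: integrable_norm.
Qed.

Lemma rint_sum (I : Type) (s : seq I) (h : I -> T -> R) :
  (forall i, rint (h i)) -> rint (fun x => \sum_(i <- s) h i x).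
Proof.
move=> hi; elim: s => [|i s IH].
  by under eq_fun do rewrite big_nil; exact: integrable0.
by under eq_fun do rewrite big_cons; exact: rintD.
Qed.

Lemma rI_sum (I : Type) (s : seq I) (h : I -> T -> R) :
  (forall i, rint (h i)) -> rI (fun x => \sum_(i <- s) h i x) = \sum_(i <- s) rI (h i).
Proof.
move=> hi; elim: s => [|i s IH].
  rewrite big_nil; under eq_Rintegral do rewrite big_nil.
  by rewrite /Rintegral integral0.
rewrite big_cons; under eq_Rintegral do rewrite big_cons.
by rewrite rID// ?IH//; exact: rint_sum.
Qed.

Lemma rI_eq0 f : rint f -> (forall x, 0 <= f x) -> rI f = 0 ->
  {ae m, forall x, f x = 0}.
Proof.
move=> fi f0 If; have mf := measurable_int _ fi.
have /(ae_eq_integral_abs m measurableT mf) : (\int[m]_x `|(EFin \o f) x| = 0)%E.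
  transitivity (\int[m]_x (f x)%:E)%E.
    by apply: eq_integral => x _; rewrite gee0_abs// lee_fin.
  by rewrite -[LHS]fineK ?integrable_fin_num//; congr (_%:E).
by apply: filterS => x /= /(_ I) [].
Qed.

Lemma rI_ae f g : rint f -> measurable_fun setT g ->
  {ae m, forall x, f x = g x} -> rI f = rI g.
Proof.
move=> fi mg fg; congr fine; apply: ae_eq_integral => //.
- exact: measurable_int fi.
- exact/measurable_EFinP.
- by apply: filterS fg => x /= -> _.
Qed.

End real_integral.

Lemma measurable_spow {R : realType} (r : R) : 0 < r -> measurable_fun setT (@spow R r).
Proof.
move=> r0; have rN0 : r != 0 by rewrite gt_eqF.
have -> : spow r = (fun x => Num.max x 0 `^ r - Num.max (- x) 0 `^ r).
  apply/funext => x; have [x0|x0] := leP 0 x.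
    by rewrite spow_ge0// max_r ?oppr_le0// powR0// subr0.
  by rewrite -[x in LHS]opprK spowN spow_ge0// ?oppr_ge0 1?ltW// powR0// sub0r max_l// oppr_ge0 ltW.
apply: measurable_funB; apply: (measurableT_comp (measurable_powR _)).
  exact: measurable_maxr.
by apply: measurable_maxr => //; exact: measurable_funN.
Qed.

Lemma measurable_spow_comp {d} {T : measurableType d} {R : realType} (r : R) (f : T -> R) :
  0 < r -> measurable_fun setT f -> measurable_fun setT (fun x => spow r (f x)).
Proof. by move=> r0 mf; exact: (measurableT_comp (measurable_spow r0)). Qed.

Lemma measurable_powR_comp {d} {T : measurableType d} {R : realType} (r : R) (f : T -> R) :
  measurable_fun setT f -> measurable_fun setT (fun x => `|f x| `^ r).
Proof.
move=> mf; apply: (measurableT_comp (measurable_powR _)).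
exact: (measurableT_comp (@normr_measurable R setT)).
Qed.

Lemma measurable_norm_comp {d} {T : measurableType d} {R : realType} (f : T -> R) :
  measurable_fun setT f -> measurable_fun setT (fun x => `|f x|).
Proof. by move=> mf; exact: (measurableT_comp (@normr_measurable R setT)). Qed.

(** * Semi-inner products *)

(** Degenerate forms are allowed because the spaces in view consist of
    functions, not of almost-everywhere classes. *)
Section semi_inner_product.
Context {R : realType} {V : lmodType R}.
Implicit Types (B : V -> V -> R) (x y z : V).

Definition semi_inner B := [/\
  forall a x y z, B (a *: x + y) z = a * B x z + B y z,
  forall x y, B x y = B y x &
  forall x, 0 <= B x x].

Definition seminorm B x : R := Num.sqrt (B x x).

Definition semi_complete B := forall x : nat -> V,
  (forall e : R, 0 < e -> exists N, forall i j, (N <= i)%N -> (N <= j)%N ->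
     seminorm B (x i - x j) < e) ->
  exists y, forall e : R, 0 < e -> exists N, forall i, (N <= i)%N ->
     seminorm B (x i - y) < e.

Context {B : V -> V -> R} (HB : semi_inner B).
Notation q := (seminorm B).

Lemma sipC x y : B x y = B y x. Proof. by case: HB. Qed.

Lemma sip_ge0 x : 0 <= B x x. Proof. by case: HB. Qed.

Lemma sip0l y : B 0 y = 0.
Proof.
case: HB => /(_ 1 0 0 y) + _ _.
by rewrite scaler0 addr0 mul1r -{1}[B 0 y]addr0 => /addrI.
Qed.

Lemma sipZl a x y : B (a *: x) y = a * B x y.
Proof. by case: HB => /(_ a x 0 y) + _ _; rewrite addr0 sip0l addr0. Qed.

Lemma sipDl x y z : B (x + y) z = B x z + B y z.
Proof. by case: HB => /(_ 1 x y z) + _ _; rewrite scale1r mul1r. Qed.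

Lemma sipNl x y : B (- x) y = - B x y.
Proof. by rewrite -scaleN1r sipZl mulN1r. Qed.

Lemma sipBl x y z : B (x - y) z = B x z - B y z.
Proof. by rewrite sipDl sipNl. Qed.

Lemma sipDr x y z : B z (x + y) = B z x + B z y.
Proof. by rewrite sipC sipDl !(sipC z). Qed.

Lemma sipZr a x y : B y (a *: x) = a * B y x.
Proof. by rewrite sipC sipZl (sipC y). Qed.

Lemma sipNr x y : B y (- x) = - B y x.
Proof. by rewrite sipC sipNl (sipC y). Qed.

Lemma sipBr x y z : B z (x - y) = B z x - B z y.
Proof. by rewrite sipDr sipNr. Qed.

Lemma sqr_seminorm x : q x ^+ 2 = B x x.
Proof. by rewrite sqr_sqrtr// sip_ge0. Qed.

Lemma seminorm_ge0 x : 0 <= q x. Proof. exact: sqrtr_ge0. Qed.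

Lemma seminorm0 : q 0 = 0. Proof. by rewrite /seminorm sip0l sqrtr0. Qed.

Lemma seminormZ a x : q (a *: x) = `|a| * q x.
Proof.
by rewrite /seminorm sipZl sipZr mulrA -expr2 sqrtrM ?sqr_ge0// sqrtr_sqr.
Qed.

Lemma seminormN x : q (- x) = q x.
Proof. by rewrite -scaleN1r seminormZ normrN1 mul1r. Qed.

Lemma seminormB x y : q (x - y) = q (y - x).
Proof. by rewrite -seminormN opprB. Qed.

Lemma sip_cauchy_schwarz x y : `|B x y| <= q x * q y.
Proof.
have H a b : 0 <= a ^+ 2 * B x x - 2 * a * b * B x y + b ^+ 2 * B y y.
  have := sip_ge0 (a *: x - b *: y).
  rewrite !(sipBl, sipBr, sipZl, sipZr) (sipC y x); lra.
rewrite -ler_sqr ?nnegrE ?mulr_ge0 ?seminorm_ge0// exprMn !sqr_seminorm.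
rewrite real_normK ?num_real//.
have := H (B y y) (B x y); have := H (B x y) (B x x).
have := sip_ge0 x; have := sip_ge0 y.
set u := B x x; set v := B y y; set w := B x y => v0 u0 h1 h2.
have [uv|] := ltP 0 (u + v).
  rewrite -subr_ge0 -(pmulr_rge0 _ uv); nra.
move=> uv; have u1 : u = 0 by lra.
have v1 : v = 0 by lra.
have := H 1 w; have := H 1 (- w); rewrite -/u -/v -/w u1 v1; nra.
Qed.

Lemma seminormD x y : q (x + y) <= q x + q y.
Proof.
rewrite -ler_sqr ?nnegrE ?addr_ge0 ?seminorm_ge0// sqrrD !sqr_seminorm.
rewrite !(sipDl, sipDr) (sipC y x).
have := le_trans (ler_norm _) (sip_cauchy_schwarz x y).
rewrite mulr2n; lra.
Qed.

Lemma seminorm_trans z x y : q (x - y) <= q (x - z) + q (z - y).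
Proof. by apply: le_trans (seminormD _ _); rewrite addrA subrK. Qed.

Lemma seminorm_dist x y : `|q x - q y| <= q (x - y).
Proof.
rewrite ler_norml; apply/andP; split.
  by rewrite lerNl opprB lerBlDr seminormB -{1}[y](subrK x) seminormD.
by rewrite lerBlDr -{1}[x](subrK y) seminormD.
Qed.

Lemma seminorm_quad x y z t : `|q (x - y) - q (z - t)| <= q (x - z) + q (y - t).
Proof.
apply: (le_trans (seminorm_dist _ _)).
have -> : x - y - (z - t) = (x - z) - (y - t).
  by rewrite !opprB [LHS](AC (2*2) ((1*4)*(3*2))).
by rewrite (le_trans (seminormD _ _))// seminormN.
Qed.

Lemma seminorm_eq0 x : (q x == 0) = (B x x == 0).
Proof. by rewrite -sqr_seminorm expf_eq0. Qed.

Lemma sip_null x y : q x = 0 -> B x y = 0.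
Proof.
by move=> x0; apply/eqP; rewrite -normr_le0 -[leRHS](mul0r (q y)) -x0 sip_cauchy_schwarz.
Qed.

Lemma sip_null_congr x x' y y' : q (x - x') = 0 -> q (y - y') = 0 -> B x y = B x' y'.
Proof.
move=> xx yy; apply/eqP; rewrite -subr_eq0.
have -> : B x y - B x' y' = B (x - x') y + B (y - y') x'.
  by rewrite !sipBl (sipC y) (sipC y'); ring.
by rewrite !sip_null// addr0.
Qed.

Lemma sip_orth x y : (forall t, q x <= q (x - t *: y)) -> B x y = 0.
Proof.
move=> H; have {}H t : 2 * t * B x y <= t ^+ 2 * B y y.
  have := H t; rewrite -ler_sqr ?nnegrE ?seminorm_ge0// !sqr_seminorm.
  rewrite !(sipBl, sipBr, sipZl, sipZr) (sipC y x); lra.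
have [y0|yN0] := eqVneq (B y y) 0.
  by rewrite sipC sip_null//; apply/eqP; rewrite seminorm_eq0 y0.
have y0 : 0 < B y y by rewrite lt_neqAle eq_sym yN0 sip_ge0.
have := H (B x y / B y y); rewrite expr_div_n.
have -> : 2 * (B x y / B y y) * B x y = 2 * (B x y ^+ 2 / B y y) by ring.
have -> : B x y ^+ 2 / B y y ^+ 2 * B y y = B x y ^+ 2 / B y y by field.
move=> K; have {}K : B x y ^+ 2 / B y y <= 0 by lra.
apply/eqP; rewrite -sqrf_eq0 eq_le sqr_ge0 andbT.
by rewrite -(@pmulr_lle0 _ (B y y)^-1) ?invr_gt0.
Qed.

(** Minimising sequences for the distance are Cauchy by the parallelogram law. *)
Lemma sip_projection (L : set V) : semi_complete B ->
  L 0 -> (forall a x y, L x -> L y -> L (a *: x + y)) ->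
  (forall y, (forall e : R, 0 < e -> exists2 x, L x & q (x - y) < e) -> L y) ->
  forall x, exists2 x0, L x0 & forall w, L w -> B (x - x0) w = 0.
Proof.
move=> Bc L0 Llin Lcl x.
pose D := [set B (x - w) (x - w) | w in L].
have Dlb : lbound D 0 by move=> _ [w _ <-]; exact: sip_ge0.
have Dinf : has_inf D by split; [exists (B (x - 0) (x - 0)), 0|exists 0].
pose d := inf D.
have dle w : L w -> d <= B (x - w) (x - w).
  by move=> Lw; apply: ge_inf; [exists 0|exists w].
have ex n : exists w, L w /\ B (x - w) (x - w) < d + n.+1%:R^-1.
  have [|_ [w Lw <-] wd] := @inf_adherent _ D n.+1%:R^-1 _ Dinf.
    by rewrite invr_gt0 ltr0n.
  by exists w.
pose w n := projT1 (cid (ex n)).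
have [Lw wd] : (forall n, L (w n)) /\ (forall n, B (x - w n) (x - w n) < d + n.+1%:R^-1).
  by split=> n; rewrite /w; case: cid => ? [].
have wij i j : B (w i - w j) (w i - w j) < 2 * (i.+1%:R^-1 + j.+1%:R^-1).
  have Lm : L (2^-1 *: w i + 2^-1 *: w j).
    by apply: (Llin) => //; rewrite -[_ *: _]addr0; exact: Llin.
  have := dle _ Lm; have := wd i; have := wd j.
  rewrite !(sipBl, sipBr, sipDl, sipDr, sipZl, sipZr).
  rewrite (sipC (w i) x) (sipC (w j) x) (sipC (w j) (w i)); move: (d) (i.+1%:R^-1) (j.+1%:R^-1) => d0 a0 b0. lra.
have [e e0|x0 x0P] := Bc w.
  have [N N0] := invS_small (divr_gt0 (exprn_gt0 2 e0) (@ltr0Sn R 3)).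
  exists N => i j Ni Nj.
  rewrite -ltr_sqr ?nnegrE ?seminorm_ge0 ?(ltW e0)// sqr_seminorm.
  apply: lt_trans (wij i j) _; move: N0 (@invS_le R _ _ Ni) (@invS_le R _ _ Nj).
  by move: (i.+1%:R^-1) (j.+1%:R^-1) (N.+1%:R^-1) (e ^+ 2) => a b c z; lra.
have Lx0 : L x0.
  apply: Lcl => e /x0P[N /(_ _ (leqnn N)) ?]; by exists (w N).
exists x0 => // v Lv; apply: sip_orth => t.
apply/ler_addgt0Pr => e e0.
have [N1 HN1] := x0P _ (divr_gt0 e0 (@ltr0Sn R 1)).
have [N2 N20] := invS_small (exprn_gt0 2 (divr_gt0 e0 (@ltr0Sn R 1))).
pose N := maxn N1 N2.
pose c := q (x - x0 - t *: v); pose a := q (x - w N).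
have cd : d <= c ^+ 2.
  by rewrite sqr_seminorm -addrA -opprD dle// addrC; exact: Llin.
have ad : a ^+ 2 < d + N.+1%:R^-1 by rewrite sqr_seminorm.
have N2' : N.+1%:R^-1 <= N2.+1%:R^-1 :> R by apply: invS_le; exact: leq_maxr.
have b2 := HN1 N (leq_maxl _ _).
have tri : q (x - x0) <= a + q (w N - x0) := seminorm_trans (w N) x x0.
have c0 : 0 <= c by exact: seminorm_ge0.
have a0 : 0 <= a by exact: seminorm_ge0.
have ace : a < c + e / 2.
  have e20 : 0 <= e / 2 by rewrite divr_ge0// ltW.
  rewrite -ltr_sqr ?nnegrE ?addr_ge0// sqrrD.
  have : 0 <= c * (e / 2) by rewrite mulr_ge0.
  move: N20 N2' ad cd; rewrite mulr2n.
  by move: (N2.+1%:R^-1) (N.+1%:R^-1) (d) => n1 n2 d1; lra.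
rewrite -/c; move: b2 tri; move: (q (w N - x0)) => b; lra.
Qed.

End semi_inner_product.

(** * The Hilbert space attached to a semi-inner product *)

(** Property (T) quantifies over complex Hilbert spaces: null vectors are divided
    out here, and the scalars are extended in the next section. *)
Section hausdorff_quotient.
Local Open Scope quotient_scope.
Context {R : realType} {V : lmodType R} {B : V -> V -> R} (HB : semi_inner B).
Notation q := (seminorm B).

Definition null_equiv (x y : V) : bool := q (x - y) == 0.

Lemma null_equiv_refl : reflexive null_equiv.
Proof. by move=> x; rewrite /null_equiv subrr seminorm0. Qed.

Lemma null_equiv_sym : symmetric null_equiv.
Proof. by move=> x y; rewrite /null_equiv seminormB. Qed.

Lemma null_equiv_trans : transitive null_equiv.
Proof.
move=> y x z /eqP xy /eqP yz; rewrite /null_equiv -(addr0 0) -{1}xy -yz.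
by rewrite eq_le seminorm_trans// xy yz addr0 seminorm_ge0.
Qed.

Canonical null_equiv_equiv :=
  EquivRel null_equiv null_equiv_refl null_equiv_sym null_equiv_trans.

Definition hquot : Type := {eq_quot null_equiv}.
HB.instance Definition _ := Choice.on hquot.
HB.instance Definition _ := EqQuotient.on hquot.

Definition hclass (x : V) : hquot := \pi_hquot x.
Definition hrep (u : hquot) : V := repr u.

Lemma hrepK u : hclass (hrep u) = u.
Proof. by rewrite /hclass reprK. Qed.

Lemma hclassP x y : hclass x = hclass y <-> q (x - y) = 0.
Proof.
split; first by move=> /eqmodP /eqP.
by move=> /eqP xy; apply/eqmodP.
Qed.

Lemma hclassK x : q (hrep (hclass x) - x) = 0.
Proof. by apply/hclassP; rewrite hrepK. Qed.

Definition hadd u v := hclass (hrep u + hrep v).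
Definition hopp u := hclass (- hrep u).
Definition hscale (a : R) u := hclass (a *: hrep u).

Lemma haddE x y : hadd (hclass x) (hclass y) = hclass (x + y).
Proof.
apply/hclassP/eqP; rewrite eq_le seminorm_ge0// andbT opprD addrACA.
by rewrite (le_trans (seminormD HB _ _))// !hclassK addr0.
Qed.

Lemma hscaleE a x : hscale a (hclass x) = hclass (a *: x).
Proof. by apply/hclassP; rewrite -scalerBr seminormZ// hclassK mulr0. Qed.

Lemma hoppE x : hopp (hclass x) = hclass (- x).
Proof. by apply/hclassP; rewrite -opprD seminormN// hclassK. Qed.

Lemma haddA : associative hadd.
Proof.
by move=> u v w; rewrite -(hrepK u) -(hrepK v) -(hrepK w) !haddE addrA.
Qed.
Lemma haddC : commutative hadd.
Proof. by move=> u v; rewrite -(hrepK u) -(hrepK v) !haddE addrC. Qed.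
Lemma hadd0 : left_id (hclass 0) hadd.
Proof. by move=> u; rewrite -(hrepK u) haddE add0r. Qed.
Lemma haddN : left_inverse (hclass 0) hopp hadd.
Proof. by move=> u; rewrite -(hrepK u) hoppE haddE addNr. Qed.

HB.instance Definition _ := GRing.isZmodule.Build hquot haddA haddC hadd0 haddN.

Lemma hclassD x y : hclass (x + y) = hclass x + hclass y.
Proof. by rewrite -haddE. Qed.

Lemma hscaleA a b u : hscale a (hscale b u) = hscale (a * b) u.
Proof. by rewrite -(hrepK u) !hscaleE scalerA. Qed.
Lemma hscale1 : left_id 1 hscale.
Proof. by move=> u; rewrite -(hrepK u) hscaleE scale1r. Qed.
Lemma hscaleDr : right_distributive hscale +%R.
Proof.
move=> a u v; rewrite -(hrepK u) -(hrepK v).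
by rewrite -hclassD !hscaleE -hclassD scalerDr.
Qed.
Lemma hscaleDl u : {morph hscale^~ u : a b / a + b}.
Proof.
by move=> a b; rewrite -(hrepK u) !hscaleE -hclassD scalerDl.
Qed.

HB.instance Definition _ :=
  GRing.Zmodule_isLmodule.Build R hquot hscaleA hscale1 hscaleDr hscaleDl.

Definition hform (u v : hquot) : R := B (hrep u) (hrep v).

Lemma hclassN x : hclass (- x) = - hclass x.
Proof. by rewrite -hoppE. Qed.
Lemma hclassZ a x : hclass (a *: x) = a *: hclass x.
Proof. by rewrite -hscaleE. Qed.
Lemma hclassB x y : hclass (x - y) = hclass x - hclass y.
Proof. by rewrite hclassD hclassN. Qed.

Lemma hformE x y : hform (hclass x) (hclass y) = B x y.
Proof.
have h1 : B (hrep (hclass x) - x) (hrep (hclass y)) = 0.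
  by apply: sip_null => //; rewrite hclassK.
have h2 : B (hrep (hclass y) - y) x = 0 by apply: sip_null => //; rewrite hclassK.
move: h1 h2; rewrite /hform !(sipBl HB) (sipC HB _ x) (sipC HB _ x).
by move=> /eqP; rewrite subr_eq0 => /eqP -> /eqP; rewrite subr_eq0 => /eqP.
Qed.

Lemma semi_inner_hform : semi_inner hform.
Proof.
split=> [a u v w|u v|u].
- rewrite -(hrepK u) -(hrepK v) -(hrepK w) -hclassZ -hclassD !hformE.
  by rewrite sipDl// sipZl.
- by rewrite -(hrepK u) -(hrepK v) !hformE sipC.
- by rewrite -(hrepK u) hformE sip_ge0.
Qed.

Lemma hform_def u : hform u u = 0 -> u = 0.
Proof.
rewrite -(hrepK u) hformE => H; apply/hclassP; rewrite subr0.
by apply/eqP; rewrite seminorm_eq0// H.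
Qed.

Lemma seminorm_hform x : seminorm hform (hclass x) = q x.
Proof. by rewrite /seminorm hformE. Qed.

Lemma semi_complete_hform : semi_complete B -> semi_complete hform.
Proof.
move=> Bc u uc; have [|y yP] := Bc (hrep \o u).
  move=> e e0; have [N NP] := uc e e0; exists N => i j Ni Nj.
  by rewrite -seminorm_hform hclassB !hrepK NP.
exists (hclass y) => e e0; have [N NP] := yP e e0; exists N => i Ni.
by rewrite -(hrepK (u i)) -hclassB seminorm_hform NP.
Qed.

End hausdorff_quotient.

Section complexification.
Local Open Scope complex_scope.
Context {R : realType} {W : lmodType R} {b : W -> W -> R} (Hb : semi_inner b)
  (bdef : forall x, b x x = 0 -> x = 0) (bcomp : semi_complete b).

(** The space W + iW. The properties of b are arguments of the type so that the
    normed and complete structures can be attached to it. *)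
Definition cplx of semi_inner b & (forall x, b x x = 0 -> x = 0) &
  semi_complete b : Type := (W * W)%type.
Notation H := (cplx Hb bdef bcomp).
HB.instance Definition _ := GRing.Zmodule.on H.

Definition cplx_scale (a : R[i]) (u : H) : H :=
  (complex.Re a *: u.1 - complex.Im a *: u.2,
   complex.Re a *: u.2 + complex.Im a *: u.1).

Lemma cplx_scaleA a c u : cplx_scale a (cplx_scale c u) = cplx_scale (a * c) u.
Proof.
case: a c u => [a a'] [c c'] [x y]; rewrite /cplx_scale/=; congr pair.
  rewrite !scalerBr !scalerDr !scalerA !scalerBl scalerDl !opprD.
  by rewrite [LHS](AC (2*2) ((1*4)*(2*3))).
rewrite !scalerDr !scalerN !scalerA !scalerBl scalerDl.
by rewrite [LHS](AC (2*2) ((1*4)*(2*3))).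
Qed.
Lemma cplx_scale1 : left_id 1 cplx_scale.
Proof.
by move=> [x y]; rewrite /cplx_scale/= !scale1r !scale0r subr0 addr0.
Qed.
Lemma cplx_scaleDr : right_distributive cplx_scale +%R.
Proof.
move=> a [x y] [x' y']; rewrite /cplx_scale/=; congr pair => /=.
  by rewrite !scalerDr opprD addrACA.
by rewrite !scalerDr addrACA.
Qed.
Lemma cplx_scaleDl u : {morph cplx_scale^~ u : a b / a + b}.
Proof.
move=> [a a'] [c c']; case: u => x y; rewrite /cplx_scale/=; congr pair => /=.
  by rewrite !scalerDl opprD addrACA.
by rewrite !scalerDl addrACA.
Qed.

HB.instance Definition _ := GRing.Zmodule_isLmodule.Build R[i] H
  cplx_scaleA cplx_scale1 cplx_scaleDr cplx_scaleDl.

Definition cplx_re (u v : H) : R := b u.1 v.1 + b u.2 v.2.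
Definition cplx_norm (u : H) : R := Num.sqrt (cplx_re u u).
Definition cplx_dot (u v : H) : R[i] :=
  cplx_re u v +i* (b u.2 v.1 - b u.1 v.2).

Lemma cplx_re_semi : @semi_inner R (W * W)%type cplx_re.
Proof.
split=> [a u v w|u v|u]; rewrite /cplx_re/=.
- by rewrite !(sipDl Hb) !(sipZl Hb); ring.
- by rewrite !(sipC Hb v.1) !(sipC Hb v.2).
- by rewrite addr_ge0 ?sip_ge0.
Qed.

Lemma cplx_normD (u v : H) : (cplx_norm (u + v))%:C <= (cplx_norm u)%:C + (cplx_norm v)%:C.
Proof.
rewrite -rmorphD/= lecR; exact: (@seminormD _ _ _ cplx_re_semi u v).
Qed.

Lemma cplx_normZ (l : R[i]) (u : H) : (cplx_norm (l *: u))%:C = `|l| * (cplx_norm u)%:C.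
Proof.
rewrite normc_def -rmorphM/=; congr (_%:C).
rewrite /cplx_norm -sqrtrM ?addr_ge0 ?sqr_ge0//; congr Num.sqrt.
rewrite /cplx_re/= !(sipDl Hb, sipBl Hb, sipDr Hb, sipBr Hb, sipNl Hb, sipNr Hb, sipZl Hb, sipZr Hb).
by rewrite (sipC Hb u.2 u.1); ring.
Qed.

Lemma cplx_norm_eq0 (u : H) : (cplx_norm u)%:C = 0 -> u = 0.
Proof.
case: u => x y /complexI/eqP; rewrite sqrtr_eq0 /cplx_re/= => K.
have := sip_ge0 Hb x; have := sip_ge0 Hb y => y0 x0.
have /bdef -> : b x x = 0 by lra.
by have /bdef -> : b y y = 0 by lra.
Qed.

HB.instance Definition _ := Lmodule_isNormed.Build R[i] H
  cplx_normD cplx_normZ cplx_norm_eq0.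

Lemma cplx_normE (u : H) : `|u| = (cplx_norm u)%:C.
Proof. by []. Qed.

Lemma cplx_dot_bilinear : bilinear_for *%R (Num.conj \; *%R) cplx_dot.
Proof.
split=> [w [a a'] u v|w [a a'] u v]; apply/eqP; rewrite eq_complex /cplx_dot /cplx_re /=;
  rewrite !(sipDl Hb, sipBl Hb, sipDr Hb, sipBr Hb, sipNl Hb, sipNr Hb, sipZl Hb, sipZr Hb);
  apply/andP; split; apply/eqP; ring.
Qed.

HB.instance Definition _ :=
  bilinear_isBilinear.Build R[i] H H R[i] *%R (Num.conj \; *%R) cplx_dot cplx_dot_bilinear.

Lemma cplx_dot_hermitian (x y : H) : cplx_dot x y = (-1) ^+ false * Num.conj (cplx_dot y x).
Proof.
rewrite expr0 mul1r; apply/eqP; rewrite eq_complex /cplx_dot /cplx_re/=.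
by rewrite !(sipC Hb x.1) !(sipC Hb x.2) eqxx opprB eqxx.
Qed.

HB.instance Definition _ := @isHermitianSesquilinear.Build R[i] H false Num.conj
  cplx_dot cplx_dot_hermitian.

Lemma cplx_dot_norm (u : H) : `|u| ^+ 2 = cplx_dot u u.
Proof.
rewrite cplx_normE -rmorphXn/= sqr_sqrtr ?(sip_ge0 cplx_re_semi)//.
by apply/eqP; rewrite eq_complex /= (sipC Hb u.2) subrr !eqxx.
Qed.

Lemma cplx_dot_gt0 (u : H) : u != 0 -> 0 < cplx_dot u u.
Proof. by move=> u0; rewrite -cplx_dot_norm exprn_gt0// normr_gt0. Qed.

HB.instance Definition _ := isDotProduct.Build R[i] H cplx_dot cplx_dot_gt0.

Lemma cplx_norm_le (u : H) : cplx_norm u <= seminorm b u.1 + seminorm b u.2.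
Proof.
rewrite -ler_sqr ?nnegrE ?sqrtr_ge0 ?addr_ge0 ?sqrtr_ge0// sqrrD.
rewrite !(sqr_seminorm Hb) (sqr_seminorm cplx_re_semi) addrAC lerDl.
by rewrite mulrn_wge0// mulr_ge0 ?seminorm_ge0.
Qed.

Lemma cplx_norm_fst (u : H) : seminorm b u.1 <= cplx_norm u.
Proof. by rewrite ler_sqrt ?(sip_ge0 cplx_re_semi)// lerDl sip_ge0. Qed.

Lemma cplx_norm_snd (u : H) : seminorm b u.2 <= cplx_norm u.
Proof. by rewrite ler_sqrt ?(sip_ge0 cplx_re_semi)// lerDr sip_ge0. Qed.

Lemma complex_gt0 (e : R[i]) : 0 < e -> exists2 r : R, 0 < r & e = r%:C.
Proof.
case: e => r s; rewrite ltcE/= => /andP[/eqP -> r0].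
by exists r.
Qed.

Lemma cplx_cauchy_cvg (F : set_system H) : ProperFilter F -> cauchy F -> cvg F.
Proof.
move=> FF /cauchyP Fc.
have ex n : exists x : H, F (ball x ((n.+1%:R^-1 : R)%:C)).
  by apply: Fc; rewrite ltcR invr_gt0.
pose x n : H := projT1 (cid (ex n)).
have Fx n : F (ball (x n) ((n.+1%:R^-1 : R)%:C)) by rewrite /x; case: cid.
have xc i j : cplx_norm (x i - x j) < i.+1%:R^-1 + j.+1%:R^-1.
  have [z [iz jz]] := filter_ex (filterI (Fx i) (Fx j)).
  rewrite -ltcR -cplx_normE -(subrKA z) rmorphD/=.
  apply: (le_lt_trans (ler_normD _ _)); rewrite ltrD//.
  by rewrite distrC; move: jz; rewrite -ball_normE.
have xe (e : R) : 0 < e -> exists N, forall i j, (N <= i)%N -> (N <= j)%N ->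
    cplx_norm (x i - x j) < e.
  move=> e0; have [N NP] := invS_small (divr_gt0 e0 (@ltr0Sn R 1)).
  exists N => i j Ni Nj; apply: (lt_trans (xc i j)).
  move: NP (@invS_le R _ _ Ni) (@invS_le R _ _ Nj).
  by move: (i.+1%:R^-1) (j.+1%:R^-1) (N.+1%:R^-1) => a1 b1 c1; lra.
have [e e0|y1 y1P] := bcomp (x := fun n => (x n).1).
  have [N NP] := xe e e0; exists N => i j Ni Nj.
  by apply: le_lt_trans (cplx_norm_fst (x i - x j)) _; exact: NP.
have [e e0|y2 y2P] := bcomp (x := fun n => (x n).2).
  have [N NP] := xe e e0; exists N => i j Ni Nj.
  by apply: le_lt_trans (cplx_norm_snd (x i - x j)) _; exact: NP.
apply/cvg_ex; exists ((y1, y2) : H).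
apply/cvgrPdist_lt => _ /complex_gt0[r r0 ->].
have r40 : 0 < r / 4 by rewrite divr_gt0.
have [N1 NP1] := y1P _ r40; have [N2 NP2] := y2P _ r40.
have [N3 NP3] := invS_small r40.
pose N := maxn N1 (maxn N2 N3).
have NN1 : (N1 <= N)%N by rewrite leq_maxl.
have NN2 : (N2 <= N)%N by rewrite (leq_trans (leq_maxl N2 N3))// leq_maxr.
have NN3 : (N3 <= N)%N by rewrite (leq_trans (leq_maxr N2 N3))// leq_maxr.
apply: filterS (Fx N) => z; rewrite -ball_normE/= => zN.
rewrite -(subrKA (x N)); apply: (le_lt_trans (ler_normD _ _)).
have h1 : cplx_norm ((y1, y2) - x N : H) < r / 2.
  apply: le_lt_trans (cplx_norm_le _) _.
  have := NP1 _ NN1; have := NP2 _ NN2.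
  rewrite (seminormB Hb) (seminormB Hb (x N).1) /=; lra.
have -> : r%:C = (r / 2)%:C + (r / 2)%:C by rewrite -rmorphD/=; congr (_%:C); field.
apply: ltrD; first by rewrite cplx_normE ltcR.
apply: (lt_trans zN); rewrite ltcR; apply: (@le_lt_trans _ _ N3.+1%:R^-1).
  exact: invS_le.
by apply: (lt_trans NP3); lra.
Qed.

HB.instance Definition _ := Uniform_isComplete.Build H cplx_cauchy_cvg.

End complexification.

(** * Property (T) for orthogonal representations *)

Definition linear_pack (K : nzRingType) (U W : lmodType K) (f : U -> W)
  (fL : linear f) : {linear U -> W} :=
  HB.pack_for {linear U -> W} f (GRing.isLinear.Build K U W *:%R f fL).

Section orthogonal_representation.
Context {R : realType} {G : topologicalGroupType}.

(** An orthogonal representation on a space carrying only a semi-inner product: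
    the group laws hold up to null vectors, and linearity up to null vectors
    follows from invariance. *)
Definition semi_rep (V : lmodType R) (B : V -> V -> R) (rho : G -> V -> V) :=
  [/\ forall g x y, B (rho g x) (rho g y) = B x y,
      forall g h x, seminorm B (rho (g * h)%g x - rho g (rho h x)) = 0,
      forall x, seminorm B (rho 1%g x - x) = 0 &
      forall x g0 (e : R), 0 < e ->
        \forall g \near g0, seminorm B (rho g x - rho g0 x) < e].

Section unitary.
Context {V : lmodType R} {B : V -> V -> R} (HB : semi_inner B)
  (Bc : semi_complete B) {rho : G -> V -> V} (Hrho : semi_rep B rho).
Notation q := (seminorm B).

Lemma semi_rep_lin g a x y : q (rho g (a *: x + y) - (a *: rho g x + rho g y)) = 0.
Proof.
have [inv _ _ _] := Hrho; apply/eqP; rewrite (seminorm_eq0 HB); apply/eqP.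
rewrite !(sipDl HB, sipDr HB, sipBl HB, sipBr HB, sipNl HB, sipNr HB, sipZl HB, sipZr HB).
rewrite !inv !(sipDl HB, sipDr HB, sipZl HB, sipZr HB); ring.
Qed.

Lemma semi_rep_norm g x : q (rho g x) = q x.
Proof. by have [inv _ _ _] := Hrho; rewrite /seminorm inv. Qed.

Lemma semi_rep_sub g x y : q (rho g x - rho g y) = q (x - y).
Proof.
have [inv _ _ _] := Hrho; rewrite /seminorm; congr Num.sqrt.
by rewrite !(sipBl HB, sipBr HB) !inv.
Qed.

Notation W := (hquot HB).
Notation H := (cplx (semi_inner_hform HB) (@hform_def _ _ _ HB)
  (semi_complete_hform Bc)).

Definition quot_rep g (u : W) : W := hclass HB (rho g (hrep u)).

Lemma quot_repE g x : quot_rep g (hclass HB x) = hclass HB (rho g x).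
Proof. by apply/hclassP; rewrite semi_rep_sub hclassK. Qed.

Lemma quot_rep_lin g a u v :
  quot_rep g (a *: u + v) = a *: quot_rep g u + quot_rep g v.
Proof.
rewrite -(hrepK u) -(hrepK v) -hclassZ -hclassD !quot_repE -hclassZ -hclassD.
by apply/hclassP; exact: semi_rep_lin.
Qed.

Lemma quot_repD g u v : quot_rep g (u + v) = quot_rep g u + quot_rep g v.
Proof. by have := quot_rep_lin g 1 u v; rewrite !scale1r. Qed.

Lemma quot_rep0 g : quot_rep g 0 = 0.
Proof. by have /eqP := quot_repD g 0 0; rewrite addr0 eq_sym -subr_eq0 addrK => /eqP. Qed.

Lemma quot_repZ g a u : quot_rep g (a *: u) = a *: quot_rep g u.
Proof. by have := quot_rep_lin g a u 0; rewrite quot_rep0 !addr0. Qed.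

Lemma quot_repN g u : quot_rep g (- u) = - quot_rep g u.
Proof. by rewrite -scaleN1r quot_repZ scaleN1r. Qed.

Lemma quot_rep_form g u v :
  hform (quot_rep g u) (quot_rep g v) = hform u v.
Proof.
rewrite -(hrepK u) -(hrepK v) !quot_repE !hformE.
by have [inv _ _ _] := Hrho; rewrite inv.
Qed.

Definition unitary_fun g (u : H) : H := (quot_rep g u.1, quot_rep g u.2).

Lemma unitary_fun_lin g : linear (unitary_fun g).
Proof.
move=> a [x y] [x' y']; rewrite /unitary_fun/=; congr pair => /=.
  by rewrite quot_repD quot_repD quot_repN !quot_repZ.
by rewrite quot_repD quot_repD !quot_repZ.
Qed.

Definition unitary g : {linear H -> H} := linear_pack (unitary_fun_lin g).

Lemma unitaryE g u : unitary g u = unitary_fun g u. Proof. by []. Qed.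

Lemma unitary_dot g u v : cplx_dot (unitary g u) (unitary g v) = cplx_dot u v.
Proof. by rewrite /cplx_dot /cplx_re/= !quot_rep_form. Qed.

Lemma unitary_norm g u : `|unitary g u| = `|u|.
Proof. by rewrite !cplx_normE /cplx_norm /cplx_re /= !quot_rep_form. Qed.

Lemma unitary_continuous_action : continuous_action (fun g => unitary g).
Proof.
have [inv Rm R1 Rc] := Hrho.
split=> [u|g h u|].
- case: u => x y; rewrite unitaryE /unitary_fun/=; congr pair.
    by rewrite -(hrepK x) quot_repE; apply/hclassP; rewrite R1.
  by rewrite -(hrepK y) quot_repE; apply/hclassP; rewrite R1.
- case: u => x y; rewrite !unitaryE /unitary_fun/=; congr pair.
    by rewrite -(hrepK x) !quot_repE; apply/hclassP; rewrite Rm.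
  by rewrite -(hrepK y) !quot_repE; apply/hclassP; rewrite Rm.
- move=> [g0 u0]; apply/cvgrPdist_lt => _ /complex_gt0[r r0 ->].
  have r30 : 0 < r / 4 by rewrite divr_gt0.
  have n1 : \forall g \near g0, q (rho g (hrep u0.1) - rho g0 (hrep u0.1)) < r / 4.
    exact: Rc.
  have n2 : \forall g \near g0, q (rho g (hrep u0.2) - rho g0 (hrep u0.2)) < r / 4.
    exact: Rc.
  have n3 : \forall u \near u0, `|u0 - u| < (r / 4)%:C%C.
    have r4C : 0 < (r / 4)%:C%C by rewrite ltcR.
    by have := nbhsx_ballx u0 _ r4C; rewrite -ball_normE.
  have n12 : nbhs (g0, u0) ([set g | q (rho g (hrep u0.1) - rho g0 (hrep u0.1)) < r / 4
      /\ q (rho g (hrep u0.2) - rho g0 (hrep u0.2)) < r / 4]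
      `*` [set u | `|u0 - u| < (r / 4)%:C%C]).
    by exists (([set g | q (rho g (hrep u0.1) - rho g0 (hrep u0.1)) < r / 4
      /\ q (rho g (hrep u0.2) - rho g0 (hrep u0.2)) < r / 4]),
      ([set u | `|u0 - u| < (r / 4)%:C%C])) => //; split=> //; exact: filterI.
  apply: filterS n12 => -[g u] /= [[h1 h2] h3].
  rewrite -(subrKA (unitary g u0)); apply: (le_lt_trans (ler_normD _ _)).
  have -> : r%:C%C = (r / 2)%:C%C + (r / 2)%:C%C by rewrite -rmorphD/=; congr (_%:C%C); field.
  apply: ltrD.
    rewrite cplx_normE ltcR; apply: le_lt_trans (cplx_norm_le _) _ => /=.
    rewrite -!hclassN -!hclassD !seminorm_hform.
    rewrite (seminormB HB) (seminormB HB (rho g0 (hrep u0.2))); lra.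
  rewrite -linearB unitary_norm; apply: (lt_trans h3); rewrite ltcR; lra.
Qed.

End unitary.

(** Property (T) applied to the complexified quotient of V, when no vector but
    the null ones is invariant. *)
Lemma propertyT_displacement : propertyT R G -> exists (Q : set G) (e : R),
  [/\ compact Q, 0 < e & forall (V : lmodType R) (B : V -> V -> R) rho,
    semi_inner B -> semi_complete B -> semi_rep B rho ->
    (forall x, (forall g, seminorm B (rho g x - x) = 0) -> seminorm B x = 0) ->
    forall x, seminorm B x != 0 ->
      exists2 g, Q g & e * seminorm B x <= seminorm B (rho g x - x)].
Proof.
move=> [Q [e [cQ e0 TT]]]; exists Q, e; split=> // V B rho HB Bc Hrho noinv x x0.
apply: contrapT => Hn.
pose u : cplx (semi_inner_hform HB) (@hform_def _ _ _ HB) (semi_complete_hform Bc) :=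
  (hclass HB x, 0).
have nu : cplx_norm u = seminorm B x.
  have -> : cplx_norm u = Num.sqrt
      (hform (hclass HB x) (hclass HB x) + hform (0 : hquot HB) 0) by [].
  by rewrite hformE (sip0l (semi_inner_hform HB)) addr0.
have [||||v v0 vinv] :=
  TT (cplx (semi_inner_hform HB) (@hform_def _ _ _ HB) (semi_complete_hform Bc))
     (@cplx_dot _ _ _ _ _ _) (unitary HB Bc Hrho).
- exact: cplx_dot_norm.
- exact: unitary_continuous_action.
- exact: unitary_dot.
- exists u.
    apply/eqP => /(congr1 (fun u => `|u|)); rewrite normr0 cplx_normE nu.
    by move=> /complexI/eqP; rewrite (negbTE x0).
  move=> g Qg; rewrite !cplx_normE nu -rmorphM/= ltcR ltNge.
  apply/negP => K; apply: Hn; exists g => //; apply: (le_trans K).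
  have -> : unitary HB Bc Hrho g u - u = (hclass HB (rho g x - x), 0).
    rewrite hclassB -(quot_repE HB Hrho).
    by congr pair => //=; rewrite (quot_rep0 HB Hrho g) oppr0 addr0.
  apply: le_trans (cplx_norm_le _) _ => /=.
  by rewrite (seminorm0 (semi_inner_hform HB)) addr0 seminorm_hform.
- apply/negP: v0; rewrite negbK; case: v vinv => v1 v2 vinv.
  suff h w : (forall g, @quot_rep _ _ HB rho g w = w) -> w = 0.
    rewrite (h v1); last by move=> g; have /(congr1 fst) := vinv g.
    by rewrite (h v2)//; move=> g; have /(congr1 snd) := vinv g.
  rewrite -(hrepK w) => K; apply/hclassP; rewrite subr0; apply: noinv => g.
  by apply/hclassP; rewrite -quot_repE.
Qed.

(** Property (T) turns small displacement on Q into proximity to an invariant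
    vector: apply it to the quotient by the invariant vectors, realised by the
    form B x y - B (P x) (P y) with P the projection on them. *)
Lemma propertyT_close_invariant : propertyT R G -> exists (Q : set G) (K : R),
  [/\ compact Q, 0 < K & forall (V : lmodType R) (B : V -> V -> R) rho,
    semi_inner B -> semi_complete B -> semi_rep B rho ->
    forall x d, 0 <= d -> (forall g, Q g -> seminorm B (rho g x - x) <= d) ->
    exists2 x0, (forall g, seminorm B (rho g x0 - x0) = 0) &
      seminorm B (x - x0) <= K * d].
Proof.
move=> /propertyT_displacement[Q [e [cQ e0 TT]]].
exists Q, e^-1; split; rewrite ?invr_gt0// => V B rho HB Bc Hrho.
have [inv Rm R1 Rc] := Hrho.
pose L := [set x | forall g, seminorm B (rho g x - x) = 0].
have q_eq0 y : (forall r, 0 < r -> seminorm B y < r) -> seminorm B y = 0.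
  move=> H; apply/eqP; rewrite eq_le (seminorm_ge0 (B := B)) andbT.
  by apply/ler_addgt0Pl => r r0; rewrite addr0 ltW// H.
have L0 : L 0.
  by move=> g; rewrite subr0 (semi_rep_norm Hrho) (seminorm0 HB).
have Llin a x y : L x -> L y -> L (a *: x + y).
  move=> Lx Ly g; apply/eqP; rewrite eq_le seminorm_ge0 andbT.
  apply: (le_trans (seminorm_trans HB (a *: rho g x + rho g y) _ _)).
  rewrite (semi_rep_lin HB Hrho) add0r opprD addrACA -scalerBr.
  by rewrite (le_trans (seminormD HB _ _))// (seminormZ HB) Lx Ly mulr0 addr0.
have Lcl y : (forall r : R, 0 < r -> exists2 x, L x & seminorm B (x - y) < r) -> L y.
  move=> K g; apply: q_eq0 => r r0; have [x Lx xy] := K _ (divr_gt0 r0 (@ltr0Sn R 1)).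
  apply: (le_lt_trans (seminorm_trans HB (rho g x) _ _)).
  rewrite (semi_rep_sub HB Hrho) (seminormB HB).
  apply: (@le_lt_trans _ _ (seminorm B (x - y) + (seminorm B (rho g x - x) + seminorm B (x - y)))).
    by rewrite lerD2l seminorm_trans.
  by rewrite Lx add0r; lra.
have /choice[P PP] : forall x, exists x0, L x0 /\ forall w, L w -> B (x - x0) w = 0.
  by move=> x; have [x0 ? ?] := sip_projection HB Bc L0 Llin Lcl x; exists x0.
have LP x : L (P x) by case: (PP x).
have PW x w : L w -> B (P x) w = B x w.
  move=> Lw; case: (PP x) => _ /(_ w Lw); rewrite (sipBl HB) => /eqP.
  by rewrite subr_eq0 => /eqP.
pose B' x y := B x y - B (P x) (P y).
have B'E x y : B' x y = B (x - P x) (y - P y).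
  rewrite /B' !(sipBl HB, sipBr HB) (PW x (P y))//.
  by rewrite (sipC HB (P x) y) -(PW y (P x))// (sipC HB (P y)) (PW x (P y))//; ring.
have HB' : semi_inner B'.
  split=> [a x y z|x y|x]; rewrite /B'.
  - by rewrite !(PW _ (P z))// !(sipDl HB) !(sipZl HB); ring.
  - by rewrite !(sipC HB x) (sipC HB (P x)).
  - by rewrite -/(B' x x) B'E (sip_ge0 HB).
have q'E x : seminorm B' x = seminorm B (x - P x) by rewrite /seminorm B'E.
have q'q x : seminorm B' x <= seminorm B x.
  by rewrite /seminorm ler_wsqrtr// /B' gerBl (sip_ge0 HB).
have q'0 w : L w -> seminorm B' w = 0.
  move=> Lw; apply/eqP; rewrite (seminorm_eq0 HB') B'E; apply/eqP.
  case: (PP w) => _; apply; rewrite addrC -scaleN1r; exact: Llin.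
have BL x w g : L w -> B (rho g x) w = B x w.
  move=> Lw; have : B (rho g w - w) (rho g x) = 0 by exact: sip_null.
  rewrite (sipBl HB) inv => /eqP; rewrite subr_eq0 => /eqP.
  by rewrite (sipC HB (rho g x)) (sipC HB x) => ->.
have qq x : (forall w, L w -> B x w = 0) -> seminorm B' x = seminorm B x.
  move=> K; rewrite /seminorm /B'; congr Num.sqrt.
  by rewrite (PW x (P x))// (K (P x))// subr0.
have q'tri := seminormD HB'.
have Bc' : semi_complete B'.
  move=> x xc; have [r r0|z zP] := Bc (fun n => x n - P (x n)).
    have [N NP] := xc r r0; exists N => i j Ni Nj.
    suff -> : seminorm B (x i - P (x i) - (x j - P (x j))) = seminorm B' (x i - x j) by exact: NP.
    rewrite /seminorm; congr Num.sqrt.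
    have E (A : V -> V -> R) (HA : semi_inner A) a b :
        A (a - b) (a - b) = A a a - A a b - (A b a - A b b).
      by rewrite (sipBl HA) !(sipBr HA).
    by rewrite (E B)// (E B')// !B'E.
  exists z => r r0; have [N NP] := zP r r0; exists N => i Ni.
  apply: le_lt_trans (NP i Ni).
  have -> : x i - z = (x i - P (x i) - z) + P (x i).
    by rewrite addrAC subrK.
  apply: (le_trans (q'tri _ _)).
  by rewrite (q'0 (P (x i)))// addr0 q'q.
have Hrho' : semi_rep B' rho.
  split=> [g x y|g h x|x|x g0 r r0].
  - rewrite /B' inv; congr (_ - _).
    rewrite (PW (rho g x))// BL// -(PW x)// (sipC HB).
    by rewrite (PW (rho g y))// BL// -(PW y)// (sipC HB).
  - by apply/eqP; rewrite eq_le seminorm_ge0 andbT -(Rm g h x) q'q.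
  - by apply/eqP; rewrite eq_le seminorm_ge0 andbT -(R1 x) q'q.
  - by apply: filterS (Rc x g0 r r0) => g; exact: le_lt_trans.
have noinv x : (forall g, seminorm B' (rho g x - x) = 0) -> seminorm B' x = 0.
  move=> xinv; pose y := x - P x.
  have yw w : L w -> B y w = 0 by case: (PP x) => _; apply.
  suff Ly : L y by apply/eqP; rewrite (seminorm_eq0 HB') B'E -/y yw.
  move=> g; rewrite -qq; last first.
    by move=> w Lw; rewrite (sipBl HB) BL// yw// subr0.
  have -> : rho g y - y = (rho g (-1 *: P x + x) - (-1 *: rho g (P x) + rho g x))
      + ((rho g x - x) + (-1) *: (rho g (P x) - P x)).
    have -> : y = -1 *: P x + x by rewrite scaleN1r addrC.
    set A := rho g (_ + _); rewrite !scaleN1r !opprD !opprK -!addrA.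
    by congr (A + _); rewrite addKr addrCA addNKr addrC.
  apply/eqP; rewrite eq_le (seminorm_ge0 (B := B')) andbT.
  apply: (le_trans (q'tri _ _)).
  have -> : seminorm B' (rho g (-1 *: P x + x) - (-1 *: rho g (P x) + rho g x)) = 0.
    by apply/eqP; rewrite eq_le seminorm_ge0 andbT -(semi_rep_lin HB Hrho g (-1) (P x) x) q'q.
  rewrite add0r; apply: (le_trans (q'tri _ _)); rewrite xinv add0r.
  by rewrite (seminormZ HB') normrN1 mul1r  (le_trans (q'q _))// LP.
move=> x d d0 xd; exists (P x); first exact: LP.
rewrite -q'E; have [->|x0] := eqVneq (seminorm B' x) 0.
  by rewrite mulr_ge0// invr_ge0 ltW.
have [g Qg] := TT V B' rho HB' Bc' Hrho' noinv x x0.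
move=> K; rewrite ler_pdivlMl//; apply: (le_trans K).
by apply: (le_trans (q'q _)); exact: xd.
Qed.

End orthogonal_representation.

(** * The duality pairing and the Mazur map on functions *)

Lemma Lfun_mk {d} {T : measurableType d} {R : realType} (m : {measure set T -> \bar R})
    (p : R) (p1 : (1 <= p%:E)%E) (f : T -> R) : measurable_fun setT f ->
  m.-integrable setT (EFin \o (fun x => `|f x| `^ p)) ->
  exists F : LfunType m p1, (F : T -> R) = f.
Proof.
move=> mf fi.
have fL : f \in Lfun m p%:E.
  rewrite inE; apply/andP; split; rewrite inE//= /finite_norm unlock /=.
  rewrite poweR_lty//; have /integrableP[_ fy] := fi.
  apply: (le_lt_trans _ fy); apply: ge0_le_integral => //.
  - by apply/measurable_EFinP; exact: measurable_powR_comp.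
  - apply: measurableT_comp => //.
    by apply/measurable_EFinP; exact: measurable_powR_comp.
  - by move=> x _ /=; rewrite lee_fin ler_norm.
by exists (Lfun_Sub p1 fL).
Qed.

Section Lp_function_level.
Context {d} {Omega : measurableType d} {R : realType}
  (m : {measure set Omega -> \bar R}) (p : R) (p1 : (1 <= p%:E)%E) (p2 : 2 < p).
Notation Lf := (LfunType m p1).
Notation rint f := (m.-integrable setT (EFin \o f)).
Notation rI f := (\int[m]_x f x).
Implicit Types f g h : Lf.

Let p0 : 0 < p. Proof. exact: lt_trans p2. Qed.
Let p11 : 1 <= p. Proof. by apply: ltW; apply: lt_trans p2; rewrite ltr1n. Qed.
Let pB1 : 0 < p - 1. Proof. by rewrite subr_gt0; apply: lt_trans p2; rewrite ltr1n. Qed.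

Lemma Lfun_meas f : measurable_fun setT f.
Proof. exact: (measurable_funP f). Qed.

Lemma Lfun_rint f : rint (fun x => `|f x| `^ p).
Proof. exact: (Lfun_integrable p11 (LfunP f)). Qed.

Lemma Lfun_pairing_bound s f g x : 0 < s ->
  `|spow (p - 1) (f x) * g x| <= s * `|f x| `^ p + s `^ (1 - p) * `|g x| `^ p.
Proof.
move=> s0; rewrite normrM norm_spow ?(gt_eqF pB1)//.
have r1 : (0 : R) < 1 < p by apply/andP; split; [exact: ltr01|rewrite -subr_gt0].
have := powR_split r1 s0 (normr_ge0 (g x)) (normr_ge0 (f x)).
by rewrite !powRr1// ?(ltW s0)// [leLHS]mulrC.
Qed.

Lemma Lfun_pairing_rint f g : rint (fun x => spow (p - 1) (f x) * g x).
Proof.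
apply: (rint_dom (g := fun x => 1 * `|f x| `^ p + 1 * `|g x| `^ p)).
- apply: measurable_funM; last exact: Lfun_meas.
  by apply: measurable_spow_comp; [exact: pB1|exact: Lfun_meas].
- by apply: rintD; apply: rintZ; exact: Lfun_rint.
- by move=> x; have := Lfun_pairing_bound f g x ltr01; rewrite powR1.
Qed.

(** The derivative of [Lpow] at f in the direction g, up to the factor p. *)
Definition Lpair f g : R := rI (fun x => spow (p - 1) (f x) * g x).
Definition Lpow f : R := rI (fun x => `|f x| `^ p).

Lemma Lpow_ge0 f : 0 <= Lpow f.
Proof. by apply: rI_ge0 => x; exact: powR_ge0. Qed.

Lemma Lpair_bound s f g : 0 < s -> `|Lpair f g| <= s * Lpow f + s `^ (1 - p) * Lpow g.
Proof.
move=> s0; rewrite /Lpow -!rIZ; [|exact: Lfun_rint..].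
rewrite -rID; [|by apply: rintZ; exact: Lfun_rint..].
apply: rI_norm_le; first exact: Lfun_pairing_rint.
  by apply: rintD; apply: rintZ; exact: Lfun_rint.
by move=> x; exact: Lfun_pairing_bound.
Qed.

Lemma Lpair_lin f a g h : Lpair f (a *: g + h) = a * Lpair f g + Lpair f h.
Proof.
rewrite /Lpair -rIZ; last exact: Lfun_pairing_rint.
rewrite -rID; [|by apply: rintZ; exact: Lfun_pairing_rint|exact: Lfun_pairing_rint].
by apply: eq_Rintegral => x _ /=; rewrite mulrDr mulrCA.
Qed.

Lemma Lpair_self f : Lpair f f = Lpow f.
Proof. by apply: eq_Rintegral => x _; rewrite mulr_spow. Qed.

Lemma Lpow_convex f g :
  Lpow f + p * Lpair f g + 2 `^ (1 - p) * Lpow g <= Lpow (f + g).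
Proof.
have i1 := Lfun_rint f; have i2 := Lfun_rint g; have i3 := Lfun_pairing_rint f g.
rewrite /Lpow /Lpair -!rIZ// -!rID//; last 3 first.
- by apply: rintD => //; exact: rintZ.
- exact: rintZ.
- exact: rintZ.
apply: rI_le; [|exact: Lfun_rint|].
  by apply: rintD; [apply: rintD => //|]; exact: rintZ.
move=> x; rewrite mulrA; exact: powR_convex (ltW p2).
Qed.

Lemma Lpow_smooth : exists2 C : R, 0 < C & forall s f g, 0 < s <= 1 ->
  Lpow (f + g) <= Lpow f + p * Lpair f g
     + C * (s ^+ 2 * Lpow f + s `^ (2 - p) * Lpow g).
Proof.
have [C C0 HC] := @powR_smooth R p p2; exists C => // s f g s01.
have i1 := Lfun_rint f; have i2 := Lfun_rint g; have i3 := Lfun_pairing_rint f g.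
have i4 : rint (fun x => s ^+ 2 * `|f x| `^ p + s `^ (2 - p) * `|g x| `^ p).
  by apply: rintD; exact: rintZ.
have i5 : rint (fun x => `|f x| `^ p + p * (spow (p - 1) (f x) * g x)).
  by apply: rintD => //; exact: rintZ.
have -> : Lpow f + p * Lpair f g + C * (s ^+ 2 * Lpow f + s `^ (2 - p) * Lpow g) =
    rI (fun x => `|f x| `^ p + p * (spow (p - 1) (f x) * g x)
      + C * (s ^+ 2 * `|f x| `^ p + s `^ (2 - p) * `|g x| `^ p)).
  rewrite rID//; last exact: rintZ.
  rewrite rID//; last exact: rintZ.
  rewrite rIZ// rIZ// rID//; [|exact: rintZ..].
  by rewrite !rIZ.
apply: rI_le; [exact: Lfun_rint|by apply: rintD => //; exact: rintZ|].
by move=> x; rewrite mulrA; exact: HC.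
Qed.

Let one2 : (1 <= 2%:E :> \bar R)%E. Proof. by rewrite lee_fin ler1n. Qed.
Notation L2 := (LfunType m one2).

Lemma L2_rint (F : L2) : rint (fun x => F x ^+ 2).
Proof. exact: (Lfun2_integrable_sqr (LfunP F)). Qed.

Lemma L2_meas (F : L2) : measurable_fun setT F.
Proof. exact: (measurable_funP F). Qed.

Lemma L2_prod (F G : L2) : rint (fun x => F x * G x).
Proof.
apply: (rint_dom (g := fun x => F x ^+ 2 + G x ^+ 2)).
- by apply: measurable_funM; exact: L2_meas.
- by apply: rintD; exact: L2_rint.
- move=> x; rewrite ler_norml; apply/andP; split; nra.
Qed.

Definition L2_form (F G : L2) : R := rI (fun x => F x * G x).

Lemma L2_form_semi : semi_inner L2_form.
Proof.
split=> [a F G H|F G|F].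
- rewrite /L2_form -rIZ; last exact: L2_prod.
  rewrite -rID; [|by apply: rintZ; exact: L2_prod|exact: L2_prod].
  by apply: eq_Rintegral => x _ /=; rewrite mulrDl mulrA.
- by apply: eq_Rintegral => x _ /=; rewrite mulrC.
- by apply: rI_ge0 => x; rewrite -expr2 sqr_ge0.
Qed.

Lemma L2_mk (f : Omega -> R) : measurable_fun setT f ->
  rint (fun x => f x ^+ 2) -> exists F : L2, (F : Omega -> R) = f.
Proof.
move=> mf fi; apply: Lfun_mk => //.
have -> // : (fun x => `|f x| `^ 2) = (fun x => f x ^+ 2).
by apply/funext => x; rewrite powR_mulrn// real_normK ?num_real.
Qed.

Lemma Lmazur_rint f : rint (fun x => spow (p / 2) (f x) ^+ 2).
Proof.
have -> : (fun x => spow (p / 2) (f x) ^+ 2) = (fun x => `|f x| `^ p).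
  by apply/funext => x; rewrite sqr_spow.
exact: Lfun_rint.
Qed.

Definition Lmazur f : L2 := projT1 (cid (L2_mk
  (measurable_spow_comp (divr_gt0 p0 (@ltr0Sn R 1)) (Lfun_meas f))
  (Lmazur_rint f))).

Lemma LmazurE f x : Lmazur f x = spow (p / 2) (f x).
Proof. by rewrite /Lmazur; case: cid => F /= ->. Qed.

Lemma Lmazur_upper : exists2 C : R, 0 < C & forall s f g, 0 < s ->
  seminorm L2_form (Lmazur f - Lmazur g) ^+ 2 <=
  C * (s ^+ 2 * (Lpow f + Lpow g) + s `^ (2 - p) * Lpow (f - g)).
Proof.
have [C C0 HC] := @mazur_upper R p p2; exists C => // s f g s0.
have i1 := Lfun_rint f; have i2 := Lfun_rint g; have i3 := Lfun_rint (f - g).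
have i12 := rintD i1 i2.
have i4 : rint (fun x => s ^+ 2 * (`|f x| `^ p + `|g x| `^ p)
    + s `^ (2 - p) * `|(f - g) x| `^ p).
  by apply: rintD; exact: rintZ.
have -> : C * (s ^+ 2 * (Lpow f + Lpow g) + s `^ (2 - p) * Lpow (f - g)) =
    rI (fun x => C * (s ^+ 2 * (`|f x| `^ p + `|g x| `^ p)
      + s `^ (2 - p) * `|(f - g) x| `^ p)).
  rewrite rIZ// rID//; [|exact: rintZ..].
  by rewrite !rIZ// rID.
rewrite (sqr_seminorm L2_form_semi).
apply: rI_le; [exact: L2_prod|exact: rintZ|].
move=> x; have := HC s (f x) (g x) s0.
by rewrite expr2 -!LmazurE.
Qed.

Lemma Lmazur_lower f g :
  Lpow (f - g) <= 4 `^ p * seminorm L2_form (Lmazur f - Lmazur g) ^+ 2.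
Proof.
rewrite (sqr_seminorm L2_form_semi) /L2_form /Lpow -rIZ; last exact: L2_prod.
apply: rI_le; [exact: Lfun_rint|by apply: rintZ; exact: L2_prod|].
move=> x; have := mazur_lower (f x) (g x) (ltW p2).
by rewrite expr2 -!LmazurE.
Qed.

Lemma Lmazur_norm f : L2_form (Lmazur f) (Lmazur f) = Lpow f.
Proof. by apply: eq_Rintegral => x _; rewrite !LmazurE -expr2 sqr_spow. Qed.

Lemma Lmazur_onto (F : L2) : exists f : Lf, forall x, Lmazur f x = F x.
Proof.
have pi0 : 0 < (p / 2)^-1 by rewrite invr_gt0 divr_gt0.
have E x : spow (p / 2) (spow (p / 2)^-1 (F x)) = F x.
  by rewrite -{2}[F x](spowK _ pi0) invrK.
have [||f fE] := @Lfun_mk _ _ _ m p p1 (fun x => spow (p / 2)^-1 (F x)).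
- by apply: measurable_spow_comp => //; exact: L2_meas.
- have -> : (fun x => `|spow (p / 2)^-1 (F x)| `^ p) = (fun x => F x ^+ 2).
    by apply/funext => x; rewrite -{2}(E x) sqr_spow.
  exact: L2_rint.
by exists f => x; rewrite LmazurE fE E.
Qed.

(** Equality in Clarkson's inequality characterises disjoint supports up to null
    sets; stated this way, disjointness is visible to every isometry. *)
Definition Ldisjoint f g :=
  Lpow (f + g) + Lpow (f - g) = 2 * (Lpow f + Lpow g).

Lemma Ldisjoint_prod0 f g : (forall x, f x * g x = 0) -> Ldisjoint f g.
Proof.
move=> fg; rewrite /Ldisjoint /Lpow.
have i1 := Lfun_rint f; have i2 := Lfun_rint g.
rewrite -!rID//; [|exact: Lfun_rint..]; rewrite -rIZ; last exact: rintD.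
by apply: eq_Rintegral => x _; apply: clarkson_prod0; [rewrite gt_eqF|exact: fg].
Qed.

Lemma Ldisjoint_ae (I : finType) (f : I -> Lf) :
  (forall i j, i != j -> Ldisjoint (f i) (f j)) ->
  {ae m, forall x, forall i j, i != j -> f i x * f j x = 0}.
Proof.
move=> fD.
pose h i j x := `|(f i + f j) x| `^ p + `|(f i - f j) x| `^ p
   - 2 * (`|f i x| `^ p + `|f j x| `^ p).
have hi i j : rint (h i j).
  apply: rintB; first by apply: rintD; exact: Lfun_rint.
  by apply: rintZ; apply: rintD; exact: Lfun_rint.
have h0 i j x : 0 <= h i j x.
  rewrite subr_ge0; exact: clarkson_le (ltW p2).
have hI i j : i != j -> rI (h i j) = 0.
  move=> /fD D; rewrite rIB; last first.
  - by apply: rintZ; apply: rintD; exact: Lfun_rint.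
  - by apply: rintD; exact: Lfun_rint.
  rewrite rIZ ?rID; try exact: Lfun_rint.
    by apply/eqP; rewrite subr_eq0; apply/eqP.
  by apply: rintD; exact: Lfun_rint.
pose H x := \sum_(ij <- enum [pred ij : I * I | ij.1 != ij.2]) h ij.1 ij.2 x.
have : {ae m, forall x, H x = 0}.
  apply: rI_eq0.
  - by apply: rint_sum => ij; exact: hi.
  - by move=> x; apply: sumr_ge0.
  - rewrite rI_sum; last by move=> ij; exact: hi.
    rewrite big_seq big1// => -[i j]; rewrite mem_enum inE /=; exact: hI.
apply: filterS => x Hx i j ij.
apply: (@clarkson_eq _ p) => //; apply/eqP; rewrite -subr_eq0; apply/eqP.
move: Hx; rewrite /H (big_rem (i, j))/=; last by rewrite mem_enum inE.
move=> /eqP; rewrite paddr_eq0//; last by apply: sumr_ge0.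
by case/andP => /eqP.
Qed.

Lemma Lfun_sumE (I : finType) (f : I -> Lf) (a : I -> R) x :
  (\sum_i a i *: f i : Lf) x = \sum_i a i * f i x.
Proof.
by rewrite (big_morph (fun F : Lf => F x) (id1 := 0) (op1 := +%R)).
Qed.

(** At almost every point at most one of the f i is nonzero, so the Mazur map
    acts term by term. *)
Lemma Lmazur_form_disjoint (I : finType) (f : I -> Lf) (a b : I -> R) :
  (forall i j, i != j -> Ldisjoint (f i) (f j)) ->
  L2_form (Lmazur (\sum_i a i *: f i)) (Lmazur (\sum_i b i *: f i)) =
  \sum_i spow (p / 2) (a i) * spow (p / 2) (b i) * Lpow (f i).
Proof.
move=> /Ldisjoint_ae fD.
rewrite [RHS](eq_bigr (fun i => rI (fun x => spow (p / 2) (a i) * spow (p / 2) (b i)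
  * `|f i x| `^ p))); last by move=> i _; rewrite rIZ//; exact: Lfun_rint.
rewrite -rI_sum; last by move=> i; apply: rintZ; exact: Lfun_rint.
apply: rI_ae; first exact: L2_prod.
  by apply: rint_meas; apply: rint_sum => i; apply: rintZ; exact: Lfun_rint.
apply: filterS fD => x xD; rewrite !LmazurE !Lfun_sumE.
have pN0 : p != 0 by rewrite gt_eqF.
have [i0 i0N|allz] := pickP (fun i => f i x != 0).
  have z i : i != i0 -> f i x = 0.
    move=> /xD /eqP; rewrite mulf_eq0 (negbTE i0N) orbF; exact: eqP.
  rewrite (bigD1 i0)//= [X in _ + X]big1 => [|i /z ->]; last by rewrite mulr0.
  rewrite [X in _ * spow _ X](bigD1 i0)//= [X in _ * spow _ (_ + X)]big1 => [|i /z ->]; last by rewrite mulr0.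
  rewrite [RHS](bigD1 i0)//= [X in _ = _ + X]big1 => [|i /z ->]; last first.
    by rewrite normr0 powR0// mulr0.
  by rewrite !addr0 !spowM mulrACA -expr2 sqr_spow.
have z i : f i x = 0 by have /negbFE/eqP := allz i.
rewrite !big1 ?spow0 ?mul0r// => i _; rewrite z ?mulr0//.
by rewrite normr0 powR0// mulr0.
Qed.

End Lp_function_level.

(** * Simultaneous approximation by disjoint functions *)

Section Lp_binning.
Context {d} {Omega : measurableType d} {R : realType}
  (m : {measure set Omega -> \bar R}) (p : R) (p1 : (1 <= p%:E)%E) (p2 : 2 < p).
Notation Lf := (LfunType m p1).
Notation rint f := (m.-integrable setT (EFin \o f)).
Notation rI f := (\int[m]_x f x).
Implicit Types f g h w : Lf.

Let p0 : 0 < p. Proof. exact: lt_trans p2. Qed.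

(** The value of f / w + 1, scaled by N, has integral part i; written without
    division so that it makes sense where w vanishes. *)
Definition in_bin (N i : nat) f w x : bool :=
  (i%:R * w x <= N%:R * (f x + w x)) && (N%:R * (f x + w x) < i.+1%:R * w x).

Lemma measurable_in_bin N i f w : measurable_fun setT (in_bin N i f w).
Proof.
apply: measurable_and.
  apply: measurable_fun_ler; apply: measurable_funM => //.
  exact: measurable_funD.
apply: measurable_fun_ltr; apply: measurable_funM => //.
exact: measurable_funD.
Qed.

Lemma in_binP N f w x : `|f x| <= w x -> 0 < w x ->
  exists2 i : 'I_((N.+1).*2.+1), `|f x - (i%:R - N.+1%:R) / N.+1%:R * w x| <= N.+1%:R^-1 * w x &
    forall j : 'I_((N.+1).*2.+1), in_bin N.+1 j f w x = (j == i).
Proof.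
move=> fw w0; pose M : R := N.+1%:R; have M0 : 0 < M by rewrite ltr0n.
pose t := M * (f x + w x) / w x.
have /andP[fw1 fw2] : - w x <= f x <= w x by rewrite -ler_norml.
have t0 : 0 <= t by rewrite divr_ge0 ?mulr_ge0 ?(ltW M0) ?(ltW w0)// -lerBlDr sub0r.
have iM : (Num.truncn t < (N.+1).*2.+1)%N.
  rewrite ltnS truncn_le_nat -addn1 natrD -muln2 natrM /t ltr_pdivrMr// -/M.
  rewrite mulrDl mul1r -mulrA; apply: (@le_lt_trans _ _ (M * (2 * w x))).
    by rewrite ler_pM2l//; lra.
  by rewrite ltrDl.
have bin j : in_bin N.+1 j f w x = (Num.truncn t == j).
  by rewrite truncn_eq// /t ler_pdivlMr// ltr_pdivrMr.
exists (Ordinal iM) => /=; last first.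
  by move=> j; rewrite bin eq_sym.
have := bin (Num.truncn t); rewrite eqxx /in_bin -/M => /andP[].
set i := (Num.truncn t)%:R; rewrite -natr1 -/i => h1 h2.
rewrite -(ler_pM2l M0) -{1}(gtr0_norm M0) -normrM.
have -> : M * (f x - (i - M) / M * w x) = M * (f x + w x) - i * w x.
  by field; rewrite gt_eqF.
rewrite mulrA divff ?gt_eqF// mul1r ler_norml; apply/andP; split; lra.
Qed.

Lemma Lfun_dom f w (k : Omega -> R) : measurable_fun setT k ->
  (forall x, `|k x| <= w x) -> exists F : Lf, (F : Omega -> R) = k.
Proof.
move=> mk kw; apply: Lfun_mk => //.
apply: (rint_dom (g := fun x => `|w x| `^ p)); last first.
- move=> x; rewrite ger0_norm ?powR_ge0// ge0_ler_powR ?nnegrE// ?(ltW p0)//.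
  by rewrite (le_trans (kw x))// ler_norm.
- exact: Lfun_rint.
- exact: measurable_powR_comp.
Qed.

Lemma Lpow_le f g : (forall x, `|f x| <= g x) -> Lpow f <= Lpow g.
Proof.
move=> fg; apply: rI_le; [exact: Lfun_rint..|] => x.
rewrite ge0_ler_powR ?nnegrE// ?(ltW p0)//.
by rewrite (le_trans (fg x))// ler_norm.
Qed.

Lemma LpowZ a f : Lpow (a *: f) = `|a| `^ p * Lpow f.
Proof.
rewrite /Lpow -rIZ; last exact: Lfun_rint.
by apply: eq_Rintegral => x _; rewrite -powRM// -normrM.
Qed.

(** Two functions are approximated simultaneously by combinations of disjointly
    supported ones: cut w = |f| + |g| according to the values, rounded to
    multiples of 1/N, of the bounded ratios f / w and g / w. *)
Lemma Lfun_approx f g (e : R) : 0 < e ->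
  exists (I : finType) (h : I -> Lf) (a b : I -> R),
  [/\ forall i j, i != j -> Ldisjoint (h i) (h j),
      Lpow (f - \sum_i a i *: h i) <= e &
      Lpow (g - \sum_i b i *: h i) <= e].
Proof.
move=> e0.
have [w wE] : exists w : Lf, forall x, w x = `|f x| + `|g x|.
  have nr (k : Lf) : exists K : Lf, (K : Omega -> R) = (fun x => `|k x|).
    apply: Lfun_mk.
      by apply: measurable_norm_comp; exact: Lfun_meas.
    have -> : (fun x => `| `|k x| | `^ p) = (fun x => `|k x| `^ p).
      by apply/funext => x; rewrite normr_id.
    exact: Lfun_rint.
  have [F FE] := nr f; have [G GE] := nr g.
  by exists (F + G) => x; rewrite -[LHS]/(F x + G x) FE GE.
have w0 x : 0 <= w x by rewrite wE addr_ge0.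
have fw x : `|f x| <= w x by rewrite wE lerDl.
have gw x : `|g x| <= w x by rewrite wE lerDr.
have [N NP] : exists N : nat, Lpow w / N.+1%:R <= e.
  exists (Num.truncn (Lpow w / e)).
  rewrite ler_pdivrMr ?ltr0n// mulrC -ler_pdivrMr// ltW// truncnS_gt//.
(* f / w + 1 takes its values in [0, 2]. *)
pose K := (N.+1).*2.+1.
have ex (ij : 'I_K * 'I_K) : exists F : Lf, (F : Omega -> R) =
    (fun x => if in_bin N.+1 ij.1 f w x && in_bin N.+1 ij.2 g w x then w x else 0).
  apply: (@Lfun_dom f w).
    apply: measurable_fun_ifT; [|exact: Lfun_meas|exact: measurable_cst].
    by apply: measurable_and; exact: measurable_in_bin.
  by move=> x; case: ifP => _; rewrite ?normr0// ger0_norm.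
pose h ij := projT1 (cid (ex ij)).
have hE ij x : h ij x = if in_bin N.+1 ij.1 f w x && in_bin N.+1 ij.2 g w x then w x else 0.
  by rewrite /h; case: cid => F /= ->.
pose v (i : 'I_K) : R := (i%:R - N.+1%:R) / N.+1%:R.
have small (k : Lf) : (forall x, `|k x| <= N.+1%:R^-1 * w x) -> Lpow k <= e.
  move=> kw; apply: (le_trans _ NP).
  apply: (@le_trans _ _ (Lpow (N.+1%:R^-1 *: w))); first exact: Lpow_le.
  rewrite LpowZ mulrC ler_wpM2l ?Lpow_ge0//.
  rewrite ger0_norm ?invr_ge0// -[leRHS]powRr1 ?invr_ge0//.
  apply: ger_powR; last by rewrite ltW// (lt_trans _ p2)// ltr1n.
  by rewrite invr_gt0 ltr0n/= invf_le1 ?ltr0n// ler1n.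
have key x : w x != 0 -> exists2 ij : 'I_K * 'I_K,
    (`|f x - v ij.1 * w x| <= N.+1%:R^-1 * w x) /\
    (`|g x - v ij.2 * w x| <= N.+1%:R^-1 * w x) &
    forall kl, h kl x = if kl == ij then w x else 0.
  move=> wx; have wx0 : 0 < w x by rewrite lt_neqAle eq_sym wx w0.
  have [i iP iE] := in_binP N (fw x) wx0.
  have [j jP jE] := in_binP N (gw x) wx0.
  by exists (i, j) => // -[k l]; rewrite hE /= iE jE xpair_eqE.
have bound (k : Lf) (u : 'I_K * 'I_K -> R) : (forall x, w x = 0 -> k x = 0) ->
    (forall x ij, (forall kl, h kl x = if kl == ij then w x else 0) ->
      w x != 0 -> `|f x - v ij.1 * w x| <= N.+1%:R^-1 * w x ->
      `|g x - v ij.2 * w x| <= N.+1%:R^-1 * w x ->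
      `|k x - u ij * w x| <= N.+1%:R^-1 * w x) ->
    Lpow (k - \sum_ij u ij *: h ij) <= e.
  move=> k0 kP; apply: small => x.
  rewrite -[(k - _) x]/(k x - (\sum_ij u ij *: h ij : Lf) x) Lfun_sumE.
  have [wx|wx] := eqVneq (w x) 0.
    rewrite k0// wx mulr0 big1 ?subr0 ?normr0// => ij _.
    by rewrite hE wx if_same mulr0.
  have [ij [fP gP] hP] := key x wx.
  rewrite (bigD1 ij)//= big1 => [|kl klij].
    by rewrite addr0 hP eqxx kP.
  by rewrite hP (negbTE klij) mulr0.
exists ('I_K * 'I_K)%type, h, (fun ij => v ij.1), (fun ij => v ij.2); split.
- move=> ij kl ijkl; apply: Ldisjoint_prod0 => // x.
  have [wx|wx] := eqVneq (w x) 0; first by rewrite hE wx if_same mul0r.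
  have [ab _ hP] := key x wx; rewrite !hP.
  case: eqVneq => [E|_]; last by rewrite mul0r.
  by rewrite -E eq_sym (negbTE ijkl) mulr0.
- apply: bound => // x wx; apply/eqP; rewrite -normr_le0 -wx; exact: fw.
- apply: bound => // x wx; apply/eqP; rewrite -normr_le0 -wx; exact: gw.
Qed.

End Lp_binning.

(** * The duality and Mazur maps of an Lp-space *)

(** D x is the derivative at x of the p-th power of the norm, up to the factor
    p; the last two clauses are uniform convexity and uniform smoothness. *)
Definition duality_map {R : realType} (p : R) (E : normedModType R)
    (D : E -> E -> R) (c C : R) :=
  [/\ forall x a y z, D x (a *: y + z) = a * D x y + D x z,
      forall x, D x x = `|x| `^ p,
      forall x y, `|D x y| <= 2 * `|x| `^ (p - 1) * `|y|,
      forall x y, `|x| `^ p + p * D x y + c * `|y| `^ p <= `|x + y| `^ p &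
      forall s x y, 0 < s <= 1 -> `|x + y| `^ p <= `|x| `^ p + p * D x y
        + C * (s ^+ 2 * `|x| `^ p + s `^ (2 - p) * `|y| `^ p)].

(** M maps E, up to null vectors, onto a space with a semi-inner product B. On
    bounded sets M and its inverse N are uniformly continuous, and M conjugates
    linear isometries of E into maps that preserve B. *)
Definition mazur_map {R : realType} (p : R) (E : normedModType R)
    (V : lmodType R) (B : V -> V -> R) (M : E -> V) (N : V -> E) (C : R) :=
  [/\ semi_inner B,
      forall F, seminorm B (M (N F) - F) = 0,
      forall s u v, 0 < s -> seminorm B (M u - M v) ^+ 2 <=
        C * (s ^+ 2 * (`|u| `^ p + `|v| `^ p) + s `^ (2 - p) * `|u - v| `^ p),
      forall u v, `|u - v| `^ p <= C * seminorm B (M u - M v) ^+ 2 &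
      forall U : {linear E -> E}, (forall u, `|U u| = `|u|) ->
        forall u v, B (M (U u)) (M (U v)) = B (M u) (M v)].

Lemma le0_by_scaling {R : realType} (a b : R) :
  (forall s, 0 < s -> a <= s * b) -> a <= 0.
Proof.
move=> H; apply/ler_addgt0Pr => e e0; rewrite add0r.
have b1 : 0 < `|b| + 1 by rewrite ltr_pwDr.
apply: (le_trans (H _ (divr_gt0 e0 b1))).
rewrite mulrAC ler_pdivrMr// ler_pM2l// (le_trans (ler_norm _))// lerDl//.
Qed.

(** Choose s to make the first term small, then r to make the second one small. *)
Lemma mazur_uniform {R : realType} (p : R) (E : normedModType R) (V : lmodType R)
    (B : V -> V -> R) (M : E -> V) (C : R) : 2 < p -> 0 < C ->
  (forall s u v, 0 < s -> seminorm B (M u - M v) ^+ 2 <=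
    C * (s ^+ 2 * (`|u| `^ p + `|v| `^ p) + s `^ (2 - p) * `|u - v| `^ p)) ->
  forall A e : R, 0 <= A -> 0 < e -> exists2 r : R, 0 < r &
    forall u v, `|u| `^ p <= A -> `|u - v| `^ p <= r -> seminorm B (M u - M v) <= e.
Proof.
move=> p2 C0 H A e A0 e0; have p0 : 0 < p by apply: lt_trans p2.
pose K := A + 2 `^ p * (A + 1).
have K0 : 0 < K.
  by rewrite ltr_wpDl// mulr_gt0// ltr_wpDl.
pose s2 := e ^+ 2 / (2 * C * K).
have s20 : 0 < s2 by rewrite divr_gt0 ?exprn_gt0// !mulr_gt0.
pose s := Num.sqrt s2; have s0 : 0 < s by rewrite sqrtr_gt0.
have w0 : 0 < s `^ (2 - p) by rewrite powR_gt0.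
pose r := Num.min 1 (e ^+ 2 / (2 * C * s `^ (2 - p))).
have r0 : 0 < r.
  by rewrite lt_min ltr01 divr_gt0 ?exprn_gt0// !mulr_gt0.
exists r => // u v uA uvr.
have r1 : r <= 1 by rewrite ge_min lexx.
have r2 : r <= e ^+ 2 / (2 * C * s `^ (2 - p)) by rewrite ge_min lexx orbT.
have vA : `|v| `^ p <= 2 `^ p * (A + 1).
  have -> : v = u - (u - v) by rewrite opprB addrC subrK.
  apply: (@le_trans _ _ ((`|u| + `|u - v|) `^ p)).
    by rewrite ge0_ler_powR ?nnegrE ?addr_ge0 ?(ltW p0)// ler_normB.
  apply: (le_trans (powR_add_le (ltW p0) (normr_ge0 _) (normr_ge0 _))).
  by rewrite ler_pM2l// lerD// (le_trans uvr).
rewrite -ler_sqr ?nnegrE ?sqrtr_ge0 ?(ltW e0)//.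
apply: (le_trans (H s u v s0)).
have -> : s ^+ 2 = s2 by rewrite sqr_sqrtr// ltW.
have h1 : s2 * (`|u| `^ p + `|v| `^ p) <= s2 * K by rewrite ler_pM2l// lerD.
have h2 : s `^ (2 - p) * `|u - v| `^ p <= s `^ (2 - p) * (e ^+ 2 / (2 * C * s `^ (2 - p))).
  by rewrite ler_pM2l// (le_trans uvr).
have e1 : C * (s2 * K) = e ^+ 2 / 2 by rewrite /s2; field; rewrite !gt_eqF.
have e2 : C * (s `^ (2 - p) * (e ^+ 2 / (2 * C * s `^ (2 - p)))) = e ^+ 2 / 2.
  by field; rewrite !gt_eqF.
have := ler_wpM2l (ltW C0) h1; have := ler_wpM2l (ltW C0) h2.
by rewrite e1 e2 mulrDr; lra.
Qed.

Lemma sqr_inj_ge0 {R : realType} (x y : R) : 0 <= x -> 0 <= y -> x ^+ 2 = y ^+ 2 -> x = y.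
Proof. by move=> x0 y0 /eqP; rewrite eqrXn2// => /eqP. Qed.

Lemma dist_four_quarters {R : realType} (a b c d1 d2 d3 d4 e : R) :
  `|a - c| <= d1 + d2 -> `|b - c| <= d3 + d4 ->
  d1 <= e / 4 -> d2 <= e / 4 -> d3 <= e / 4 -> d4 <= e / 4 -> `|a - b| <= e.
Proof.
rewrite !ler_norml => /andP[? ?] /andP[? ?] *; apply/andP; split; lra.
Qed.

Section Lp_space_level.
Context {R : realType} (p : R) (p2 : 2 < p) {E : normedModType R} (p1 : (1 <= p%:E)%E)
  {d} {Omega : measurableType d} (m : {measure set Omega -> \bar R})
  (J : {linear LfunType m p1 -> E})
  (JN : forall f : LfunType m p1, (`|J f|%:E = 'N[m]_p%:E[EFin \o f])%E)
  (Jonto : forall v : E, exists f : LfunType m p1, J f = v).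
Notation Lf := (LfunType m p1).
Implicit Types (f g : Lf) (u v x y : E).

Let p0 : 0 < p. Proof. exact: lt_trans p2. Qed.
Let pN0 : p != 0. Proof. by rewrite gt_eqF. Qed.
Let pB1 : 0 < p - 1. Proof. by rewrite subr_gt0; apply: lt_trans p2; rewrite ltr1n. Qed.

Lemma norm_quotient f : `|J f| `^ p = Lpow f.
Proof.
have := powR_Lnorm m (EFin \o f) pN0; rewrite -JN /Lpow /Rintegral => h.
by rewrite -[LHS]/(fine (`|J f|%:E `^ p)%E) h.
Qed.

Definition rep v : Lf := projT1 (cid (Jonto v)).
Lemma repK v : J (rep v) = v. Proof. by rewrite /rep; case: cid. Qed.

Lemma norm_rep v : Lpow (rep v) = `|v| `^ p.
Proof. by rewrite -norm_quotient repK. Qed.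

Lemma Lpair_quotient f g g' : J g = J g' -> Lpair f g = Lpair f g'.
Proof.
move=> gg'; have -> : g = 1 *: (g - g') + g' by rewrite scale1r subrK.
rewrite (Lpair_lin p2) mul1r; suff -> : Lpair f (g - g') = 0 by rewrite add0r.
apply/eqP; rewrite -normr_le0; apply: (@le0_by_scaling _ _ (Lpow f)) => s s0.
have := Lpair_bound p2 f (g - g') s0.
by rewrite -[Lpow (g - g')]norm_quotient linearB/= gg' subrr normr0 powR0// mulr0 addr0.
Qed.

Definition Dual x y : R := Lpair (rep x) (rep y).

(** [Lpair_bound] at s = |y| / |x|, where its two terms are equal. *)
Lemma Dual_bound x y : `|Dual x y| <= 2 * `|x| `^ (p - 1) * `|y|.
Proof.
have H s : 0 < s -> `|Dual x y| <= s * `|x| `^ p + s `^ (1 - p) * `|y| `^ p.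
  by move=> /(Lpair_bound p2 (rep x) (rep y)); rewrite !norm_rep.
have [->|yN0] := eqVneq y 0.
  rewrite normr0 mulr0; apply: (@le0_by_scaling _ _ (`|x| `^ p)) => s s0.
  have := Lpair_bound p2 (rep x) (rep 0) s0.
  by rewrite norm_rep -/(Dual x 0) norm_rep normr0 powR0// mulr0 addr0.
have [->|xN0] := eqVneq x 0.
  rewrite normr0 powR0 ?gt_eqF// mulr0 mul0r.
  apply: (@le0_by_scaling _ _ (`|y| `^ p)) => t t0.
  have := Lpair_bound p2 (rep 0) (rep y) (powR_gt0 (- (p - 1)^-1) t0).
  rewrite norm_rep -/(Dual 0 y) norm_rep normr0 powR0// mulr0 add0r -powRrM.
  rewrite (_ : - (p - 1)^-1 * (1 - p) = 1); last by field; rewrite gt_eqF.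
  by rewrite powRr1// ltW.
have x0 : 0 < `|x| by rewrite normr_gt0.
have y0 : 0 < `|y| by rewrite normr_gt0.
apply: (le_trans (H _ (divr_gt0 y0 x0))).
rewrite powRM ?invr_ge0// -powR_inv1// -powRrM.
have E1 (a : R) : 0 < a -> a `^ p = a * a `^ (p - 1).
  by move=> a0; rewrite mulr_powRB1// ltW.
rewrite (_ : -1 * (1 - p) = p - 1); last by ring.
rewrite powR_inv1// (E1 _ x0) (_ : 1 - p = - (p - 1)); last by ring.
rewrite powRN (E1 _ y0).
rewrite le_eqVlt; apply/orP; left; apply/eqP.
by field; rewrite !gt_eqF// powR_gt0.
Qed.

Lemma Dual_duality_map : exists c C : R, [/\ 0 < c, 0 < C & duality_map p Dual c C].
Proof.
have [C C0 HC] := Lpow_smooth m p1 p2.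
exists (2 `^ (1 - p)), C; split; rewrite ?powR_gt0//; split.
- move=> x a y z; rewrite /Dual -(Lpair_lin p2).
  by apply: Lpair_quotient; rewrite linearP/= !repK.
- by move=> x; rewrite /Dual (Lpair_self p2) norm_rep.
- exact: Dual_bound.
- move=> x y; have := Lpow_convex p2 (rep x) (rep y).
  by rewrite -[Lpow (_ + _)]norm_quotient linearD/= !repK !norm_rep.
- move=> s x y s01; have := HC s (rep x) (rep y) s01.
  by rewrite -[Lpow (_ + _)]norm_quotient linearD/= !repK !norm_rep.
Qed.

Notation q := (seminorm (@L2_form _ _ _ m)).
Notation HB := (@L2_form_semi _ _ _ m).
Notation B := (@L2_form _ _ _ m).

Definition Mazur v := Lmazur p2 (rep v).

Lemma Mazur_quotient f g : J f = J g -> q (Lmazur p2 f - Lmazur p2 g) = 0.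
Proof.
move=> fg; apply/eqP; rewrite -sqrf_eq0 -normr_le0 normrX real_normK ?num_real//.
have [C C0 HC] := Lmazur_upper m p1 p2.
apply: (@le0_by_scaling _ _ (C * (Lpow f + Lpow g))) => s s0.
have ss : 0 < Num.sqrt s by rewrite sqrtr_gt0.
have := HC _ f g ss; rewrite -[Lpow (f - g)]norm_quotient linearB/= fg subrr.
rewrite normr0 powR0// mulr0 addr0 (sqr_sqrtr (ltW s0)).
by move=> /le_trans; apply; rewrite mulrCA.
Qed.

Lemma Mazur_rep f : q (Mazur (J f) - Lmazur p2 f) = 0.
Proof. by apply: Mazur_quotient; rewrite repK. Qed.

Lemma Mazur_dist u v : q (Mazur u - Mazur v) ^+ 2 = `|u| `^ p + `|v| `^ p - 2 * B (Mazur u) (Mazur v).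
Proof.
rewrite (sqr_seminorm HB) (sipBl HB) !(sipBr HB) (sipC HB (Mazur v) (Mazur u)).
by rewrite /Mazur !Lmazur_norm !norm_rep; ring.
Qed.

Lemma Mazur_upper : exists2 C : R, 0 < C & forall s u v, 0 < s ->
  q (Mazur u - Mazur v) ^+ 2 <=
  C * (s ^+ 2 * (`|u| `^ p + `|v| `^ p) + s `^ (2 - p) * `|u - v| `^ p).
Proof.
have [C C0 HC] := Lmazur_upper m p1 p2; exists C => // s u v s0.
have := HC s (rep u) (rep v) s0.
by rewrite !norm_rep -norm_quotient linearB/= !repK.
Qed.

Lemma Mazur_lower u v : `|u - v| `^ p <= 4 `^ p * q (Mazur u - Mazur v) ^+ 2.
Proof.
have := Lmazur_lower p2 (rep u) (rep v).
by rewrite -norm_quotient linearB/= !repK.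
Qed.

(** The next three lemmas are Lamperti's observation, in the form needed: an
    isometry preserves disjointness, hence the values of the form on
    combinations of disjoint vectors, hence everywhere by density. *)
Lemma Mazur_form_disjoint (I : finType) (e : I -> E) (a b : I -> R) :
  (forall i j, i != j -> `|e i + e j| `^ p + `|e i - e j| `^ p
     = 2 * (`|e i| `^ p + `|e j| `^ p)) ->
  B (Mazur (\sum_i a i *: e i)) (Mazur (\sum_i b i *: e i)) =
  \sum_i spow (p / 2) (a i) * spow (p / 2) (b i) * `|e i| `^ p.
Proof.
move=> eD.
have EE (c : I -> R) : \sum_i c i *: e i = J (\sum_i c i *: rep (e i)).
  by rewrite linear_sum; apply: eq_bigr => i _; rewrite linearZ/= repK.
rewrite !EE (sip_null_congr HB (Mazur_rep _) (Mazur_rep _)).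
rewrite (Lmazur_form_disjoint p2) => [|i j ij].
  by apply: eq_bigr => i _; rewrite norm_rep.
rewrite /Ldisjoint -!norm_quotient linearD linearB /= !repK; exact: eD.
Qed.

Lemma Mazur_isometry_disjoint (U : {linear E -> E}) (I : finType) (e : I -> E)
    (a b : I -> R) : (forall u, `|U u| = `|u|) ->
  (forall i j, i != j -> `|e i + e j| `^ p + `|e i - e j| `^ p
     = 2 * (`|e i| `^ p + `|e j| `^ p)) ->
  B (Mazur (U (\sum_i a i *: e i))) (Mazur (U (\sum_i b i *: e i))) =
  B (Mazur (\sum_i a i *: e i)) (Mazur (\sum_i b i *: e i)).
Proof.
move=> UN eD; have UE (c : I -> R) : U (\sum_i c i *: e i) = \sum_i c i *: U (e i).
  by rewrite linear_sum; apply: eq_bigr => i _; rewrite linearZ.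
rewrite !UE !Mazur_form_disjoint//.
  by apply: eq_bigr => i _; rewrite UN.
by move=> i j ij; rewrite -linearD -linearB !UN eD.
Qed.

Lemma Mazur_isometry (U : {linear E -> E}) : (forall u, `|U u| = `|u|) ->
  forall u v, B (Mazur (U u)) (Mazur (U v)) = B (Mazur u) (Mazur v).
Proof.
move=> UN u v.
suff D : q (Mazur (U u) - Mazur (U v)) = q (Mazur u - Mazur v).
  have := Mazur_dist (U u) (U v); rewrite D !UN Mazur_dist.
  by move=> /addrI/oppr_inj/mulfI-> //; rewrite pnatr_eq0.
have [C C0 HC] := Mazur_upper.
apply/eqP; rewrite -subr_eq0 -normr_le0; apply/ler_addgt0Pr => e e0; rewrite add0r.
pose A := `|u| `^ p + `|v| `^ p.
have A0 : 0 <= A by rewrite addr_ge0 ?powR_ge0.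
have [r r0 rP] := mazur_uniform p2 C0 HC A0 (divr_gt0 e0 (@ltr0Sn R 3)).
have [I [h [a [b [hD uh vh]]]]] := Lfun_approx p2 (rep u) (rep v) r0.
pose u' := \sum_i a i *: J (h i); pose v' := \sum_i b i *: J (h i).
have JE (c : I -> R) : J (\sum_i c i *: h i) = \sum_i c i *: J (h i).
  by rewrite linear_sum; apply: eq_bigr => i _; rewrite linearZ.
move: uh vh; rewrite -!norm_quotient !linearB/= !repK !JE -/u' -/v' => uu' vv'.
have uA : `|u| `^ p <= A by rewrite lerDl powR_ge0.
have vA : `|v| `^ p <= A by rewrite lerDr powR_ge0.
have d1 := rP _ _ uA uu'; have d2 := rP _ _ vA vv'.
have d3 : q (Mazur (U u) - Mazur (U u')) <= e / 4.
  by apply: rP; rewrite ?UN// -linearB UN.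
have d4 : q (Mazur (U v) - Mazur (U v')) <= e / 4.
  by apply: rP; rewrite ?UN// -linearB UN.
have eD i j : i != j -> `|J (h i) + J (h j)| `^ p + `|J (h i) - J (h j)| `^ p
     = 2 * (`|J (h i)| `^ p + `|J (h j)| `^ p).
  by move=> ij; rewrite -linearD -linearB !norm_quotient; exact: hD.
have D' : q (Mazur (U u') - Mazur (U v')) = q (Mazur u' - Mazur v').
  apply: sqr_inj_ge0; [exact: sqrtr_ge0|exact: sqrtr_ge0|].
  have BE : B (Mazur (U u')) (Mazur (U v')) = B (Mazur u') (Mazur v') :=
    Mazur_isometry_disjoint a b UN eD.
  have M3 (r1 r1' r2 r2' r3 r3' : R) : r1 = r1' -> r2 = r2' -> r3 = r3' ->
      r1 `^ p + r2 `^ p - 2 * r3 = r1' `^ p + r2' `^ p - 2 * r3'.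
    by move=> -> -> ->.
  have h1 := Mazur_dist (U u') (U v').
  have h2 := M3 _ _ _ _ _ _ (UN u') (UN v') BE.
  exact: (etrans h1 (etrans h2 (esym (Mazur_dist u' v')))).
have T := seminorm_quad HB.
have t1 := T (Mazur (U u)) (Mazur (U v)) (Mazur (U u')) (Mazur (U v')).
have t2 := T (Mazur u) (Mazur v) (Mazur u') (Mazur v').
rewrite D' in t1.
exact: dist_four_quarters t1 t2 d3 d4 d1 d2.
Qed.

Lemma Mazur_mazur_map : exists (N : LfunType m _ -> E) (C : R),
  0 < C /\ mazur_map p B Mazur N C.
Proof.
have [C C0 HC] := Mazur_upper.
have /choice[N NP] : forall F : LfunType m _, exists u : E, q (Mazur u - F) = 0.
  move=> F; have [f fF] := Lmazur_onto p1 p2 F; exists (J f).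
  by have := Mazur_rep f; have /LfuneqP -> := fF.
have P0 : 0 < 4 `^ p :> R by rewrite powR_gt0.
exists N, (C + 4 `^ p); split; first by rewrite addr_gt0.
split=> [|//|s u v s0|u v|U UN u v].
- exact: HB.
- apply: (le_trans (HC s u v s0)); rewrite ler_wpM2r ?lerDl ?(ltW P0)//.
  by rewrite addr_ge0// mulr_ge0 ?powR_ge0 ?sqr_ge0// addr_ge0 ?powR_ge0.
- by apply: (le_trans (Mazur_lower u v)); rewrite ler_wpM2r ?sqr_ge0// lerDr ltW.
- exact: Mazur_isometry.
Qed.

End Lp_space_level.

Lemma Lp_space_duality {R : realType} (p : R) (E : normedModType R) :
  2 < p -> Lp_space p E ->
  exists (D : E -> E -> R) (c C : R), [/\ 0 < c, 0 < C & duality_map p D c C].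
Proof.
move=> p2 [p1 [disp [T [m [J [JN Jo]]]]]].
by exists (Dual Jo); exact: Dual_duality_map JN Jo.
Qed.

Lemma Lp_space_mazur {R : realType} (p : R) (E : normedModType R) :
  2 < p -> Lp_space p E ->
  exists (V : lmodType R) (B : V -> V -> R) (M : E -> V) (N : V -> E) (C : R),
    0 < C /\ mazur_map p B M N C.
Proof.
move=> p2 [p1 [disp [T [m [J [JN Jo]]]]]].
have [N [C [C0 H]]] := Mazur_mazur_map p2 JN Jo.
by exists _, (@L2_form _ _ _ m), (Mazur p2 Jo), N, C.
Qed.

(** * Haar measure and small translations *)

Import HBNNSimple.

Section nnsfun_sum.
Import finmap.

Lemma nnsfun_sumE {d} {T : measurableType d} {R : realType} (f : {nnsfun T >-> R}) :
  exists s : seq R, (forall y, y \in s -> 0 <= y) /\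
    forall x, f x = \sum_(y <- s) y * \1_(f @^-1` [set y]) x.
Proof.
exists (enum_fset (fset_set (range f))); split=> [y|x].
  rewrite -[y \in _]/(y \in fset_set (range f)) in_fset_set; last exact: fimfunP.
  by move=> /set_mem[x _ <-]; exact: fun_ge0.
by rewrite fimfunE fsbig_finite//=; exact: fimfunP.
Qed.

End nnsfun_sum.

Section topological_group.
Context {G : topologicalGroupType}.
Implicit Types (x y g h : G) (A K U : set G).

Lemma open_borel U : open U -> measurable (U : set (borel G)).
Proof. by move=> oU; apply: sub_sigma_algebra. Qed.

Lemma closed_borel U : closed U -> measurable (U : set (borel G)).
Proof.
move=> cU; rewrite -[U]setCK; apply: (@measurableC _ (borel G)).
by apply: open_borel; exact: closed_openC.
Qed.

Lemma lmul_continuous g : continuous (fun x : G => (g * x)%g).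
Proof.
move=> x; have c1 : {for x, continuous (fun x : G => (g, x))}.
  by apply: cvg_pair => //; exact: cvg_cst.
exact: (continuous_comp c1 (@mulg_continuous G (g, x))).
Qed.

Lemma continuous_borel (f : G -> G) : continuous f ->
  measurable_fun [set: borel G] (f : borel G -> borel G).
Proof.
move=> cf; apply: (@measurability _ _ (borel G) (borel G) setT f (@open G)) => //.
move=> _ [U oU <-]; rewrite setTI; apply: open_borel.
by apply: open_comp => // x _; exact: cf.
Qed.

Lemma measurable_lmul g :
  measurable_fun [set: borel G] ((fun x : G => (g * x)%g) : borel G -> borel G).
Proof. by apply: continuous_borel; exact: lmul_continuous. Qed.

Lemma measurable_invg :
  measurable_fun [set: borel G] ((fun x : G => (x^-1)%g) : borel G -> borel G).
Proof. by apply: continuous_borel; exact: invg_continuous. Qed.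

Lemma measurable_translate g (A : set (borel G)) : measurable A ->
  measurable ([set y | A (g * y)%g] : set (borel G)).
Proof.
by move=> mA; have := measurable_lmul g measurableT mA; rewrite setTI.
Qed.

Lemma continuous_real_borel {R : realType} (f : G -> R) : continuous f ->
  measurable_fun [set: borel G] (f : borel G -> R).
Proof.
move=> cf; apply: (@measurability _ _ (borel G) _ setT f _ (RGenOInfty.measurableE R)).
move=> _ [_ [r ->] <-]; rewrite setTI; apply: open_borel.
apply: open_comp; first by move=> x _; exact: cf.
exact: interval_open.
Qed.

Lemma lmul_near g (P : G -> Prop) :
  (\forall v \near (1%g : G), P (g * v)%g) -> \forall y \near g, P y.
Proof.
move=> H; have := @lmul_continuous (g^-1)%g g.
rewrite /continuous_at mulVg => K.
have H2 : \forall y \near g, P (g * (g^-1 * y))%g by exact: (K _ H).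
by apply: filterS H2 => y; rewrite mulVKg.
Qed.

Lemma near_compact_translate K U : compact K -> open U -> K `<=` U ->
  \forall v \near (1%g : G), forall x, K x -> U (v * x)%g.
Proof.
move=> /compact_near_coveringP cK oU KU.
apply: (cK G (nbhs (1%g : G)) (fun v x => U (v * x)%g)) => x Kx.
have Ux : nbhs (1 * x)%g U by rewrite mul1g; apply: open_nbhs_nbhs; split=> //; exact: KU.
have [[/= A B] [nA nB] AB] := @mulg_continuous G (1%g, x) _ Ux.
by exists (B, A) => // -[y v] [/= By Av]; exact: (AB (v, y)).
Qed.

End topological_group.

Section haar.
Context {R : realType} {G : topologicalGroupType} (Ghaus : hausdorff_space G)
  (mG : {measure set (borel G) -> \bar R}) (haarG : is_haar mG).
Local Open Scope ereal_scope.

Lemma compact_borel (K : set G) : compact K -> measurable (K : set (borel G)).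
Proof. by move=> cK; apply: closed_borel; exact: compact_closed. Qed.

Lemma haar_translate (g : G) (A : set (borel G)) : measurable A ->
  mG [set x | A (g * x)%g] = mG A.
Proof.
have [_ inv _ _ _] := haarG => mA.
rewrite -(inv g^-1%g A mA); congr (mG _); apply/seteqP; split=> x /=.
  by move=> Ax; exists (g * x)%g => //; rewrite mulKg.
by move=> [y Ay <-]; rewrite mulVKg.
Qed.

Lemma haar_outer (A : set (borel G)) (e : R) : measurable A ->
  mG A \is a fin_num -> (0 < e)%R ->
  exists U : set G, [/\ open U, A `<=` U & mG U < mG A + e%:E].
Proof.
have [_ _ Kfin outer inner] := haarG => mA Anum e0.
rewrite (outer _ mA) in Anum *.
have [_ [U [oU AU] <-] h] := lb_ereal_inf_adherent e0 Anum.
by exists U.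
Qed.

Lemma haar_inner_open (U : set G) (e : R) : open U ->
  mG U \is a fin_num -> (0 < e)%R ->
  exists K : set G, [/\ compact K, K `<=` U & mG U - e%:E < mG K].
Proof.
have [_ _ Kfin outer inner] := haarG => oU Unum e0.
rewrite (inner _ oU) in Unum *.
have [_ [K [cK KU] <-] h] := ub_ereal_sup_adherent e0 Unum.
by exists K.
Qed.

(** Approximate A by an open U from outside and U by a compact C from inside,
    then remove from C an open set slightly larger than U minus A. *)
Lemma haar_inner_regular (A : set (borel G)) (e : R) : measurable A ->
  mG A < +oo -> (0 < e)%R ->
  exists K : set G, [/\ compact K, K `<=` A & mG A <= mG K + e%:E].
Proof.
have [_ _ Kfin outer inner] := haarG => mA Afin e0.
have e30 : (0 < e / 3)%R by rewrite divr_gt0.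
have Anum : mG A \is a fin_num by rewrite ge0_fin_numE.
have [U [oU AU UA]] := haar_outer mA Anum e30.
have mU := open_borel oU.
have Ufin : mG U < +oo by rewrite (lt_trans UA)// lte_add_pinfty ?ltry.
have Unum : mG U \is a fin_num by rewrite ge0_fin_numE.
have [C [cC CU UC]] := haar_inner_open oU Unum e30.
have mC := compact_borel cC.
have mUA : measurable (U `\` A : set (borel G)) by exact: measurableD.
have UAfin : mG (U `\` A) < (e / 3)%:E.
  rewrite measureD// setIidr//.
  by rewrite lteBlDr// addeC.
have UAnum : mG (U `\` A) \is a fin_num by rewrite ge0_fin_numE// (lt_trans UAfin) ?ltry.
have [W [oW UAW WUA]] := haar_outer mUA UAnum e30.
have mW := open_borel oW.
exists (C `&` ~` W); split.
- by apply: compact_closedI => //; exact: open_closedC.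
- move=> x [Cx nW]; apply: contrapT => nA; apply: nW; apply: UAW; split=> //.
  exact: CU.
have Cle : mG C <= mG (C `&` ~` W) + mG W.
  apply: (@le_trans _ _ (mG ((C `&` ~` W) `|` W))).
    apply: le_measure; rewrite ?inE//.
      by apply: measurableU => //; apply: measurableI => //; exact: measurableC.
    by move=> x Cx; have [Wx|nWx] := pselect (W x); [right|left].
  apply: measureU2 => //; apply: measurableI => //; exact: measurableC.
have AUle : mG A <= mG U by apply: le_measure; rewrite ?inE.
have CnW : mG (C `&` ~` W) \is a fin_num.
  rewrite ge0_fin_numE// (le_lt_trans _ (Kfin C cC))//.
  apply: le_measure; rewrite ?inE//.
  by apply: measurableI => //; exact: measurableC.
have Cnum : mG C \is a fin_num by rewrite ge0_fin_numE// Kfin.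
have Wnum : mG W \is a fin_num.
  by rewrite ge0_fin_numE// (lt_trans WUA)// lte_add_pinfty ?ltry// ltey_eq UAnum.
move: UC Cle AUle UAfin WUA.
rewrite -(fineK Unum) -(fineK CnW) -(fineK Cnum) -(fineK Wnum) -(fineK UAnum) -(fineK Anum).
rewrite -?EFinB -?EFinD !lte_fin !lee_fin; lra.
Qed.

(** Haar measure of a compact set moves little under small translations: both K
    and v K lie in an open set that is only slightly larger than K. *)
Lemma haar_compact_translate (K : set G) (e : R) : compact K -> (0 < e)%R ->
  \forall v \near (1%g : G),
    mG (K `\` [set y | K (v^-1 * y)%g]) <= e%:E.
Proof.
have [_ _ Kfin outer inner] := haarG => cK e0.
have mK := compact_borel cK.
have Knum : mG K \is a fin_num by rewrite ge0_fin_numE// Kfin.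
have [U [oU KU UK]] := haar_outer mK Knum e0.
apply: filterS (near_compact_translate cK oU KU) => v vKU.
set vK := [set y | K (v^-1 * y)%g].
have mvK : measurable (vK : set (borel G)) by exact: measurable_translate.
have vKE : mG vK = mG K by exact: haar_translate.
have : mG (vK `|` (K `\` vK)) <= mG U.
  apply: le_measure; rewrite ?inE//.
  - by apply: measurableU => //; exact: measurableD.
  - exact: open_borel.
  - move=> x [Kx|[Kx _]]; last exact: KU.
    by rewrite -(mulVKg v x); exact: vKU.
rewrite measureU//; last 2 first.
- exact: measurableD.
- by apply/seteqP; split=> // x [? [_ ?]].
move=> h0; have h : mG K + mG (K `\` vK) <= mG U by rewrite -vKE; exact: h0.
have Dnum : mG (K `\` vK) \is a fin_num.
  rewrite ge0_fin_numE// (le_lt_trans _ (Kfin K cK))//.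
  by apply: le_measure; rewrite ?inE//; exact: measurableD.
have := le_lt_trans h UK; rewrite lteD2lE// => /ltW.
exact.
Qed.

(** Lower semicontinuity at 1, uniform in A, of the mass that the measure with
    density f gives to the translates of A. *)
Definition translation_lsc (f : borel G -> \bar R) := forall e : R, (0 < e)%R ->
  \forall v \near (1%g : G), forall A : set (borel G), measurable A ->
    \int[mG]_(x in A) f x <= \int[mG]_(x in [set x | A (v * x)%g]) f x + e%:E.

Lemma translation_lscD f g : translation_lsc f -> translation_lsc g ->
  measurable_fun setT f -> measurable_fun setT g ->
  (forall x, 0 <= f x) -> (forall x, 0 <= g x) ->
  translation_lsc (fun x => f x + g x).
Proof.
move=> Hf Hg mf mg f0 g0 e e0; have e20 : (0 < e / 2)%R by rewrite divr_gt0.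
apply: filterS2 (Hf _ e20) (Hg _ e20) => v fv gv A mA.
have mB := measurable_translate v mA.
rewrite !ge0_integralD//; [|exact: measurable_funTS..].
have := leeD (fv A mA) (gv A mA).
by rewrite [leRHS]addeACA -EFinD -splitr.
Qed.

Lemma translation_lsc_indic (c : R) (B : set (borel G)) : measurable B -> (0 <= c)%R ->
  c%:E * mG B < +oo -> translation_lsc (fun x => (c * \1_B x)%:E).
Proof.
move=> mB; rewrite le_eqVlt => /predU1P[<- _|c0 cB].
  move=> e e0; near=> v => A mA.
  rewrite integral0_eq; last by move=> x _; rewrite mul0r.
  by rewrite integral0_eq ?add0e ?lee_fin ?(ltW e0)// => x _; rewrite mul0r.
have Bfin : mG B < +oo.
  rewrite ltNge leye_eq; apply/negP => /eqP Bi; move: cB.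
  by rewrite Bi mulry gtr0_sg// mul1e.
move=> e e0; have d0 : (0 < e / c / 2)%R by rewrite !divr_gt0.
have [K [cK KB BK]] := haar_inner_regular mB Bfin d0.
have mK := compact_borel cK.
apply: filterS (haar_compact_translate cK d0) => v vK A mA.
have mvA := measurable_translate v mA.
have E (D : set (borel G)) : measurable D ->
    \int[mG]_(x in D) (c * \1_B x)%:E = c%:E * mG (B `&` D).
  move=> mD; under eq_integral do rewrite EFinM.
  rewrite ge0_integralZl_EFin ?(ltW c0)//; last first.
    by apply/measurable_EFinP; exact: measurable_indic.
  by rewrite integral_indic.
rewrite !E//.
suff : mG (B `&` A) <= mG (B `&` [set x | A (v * x)%g]) + (e / c)%:E.
  move=> H; have := lee_wpmul2l (_ : 0 <= c%:E) H; rewrite lee_fin (ltW c0) => /(_ isT).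
  by rewrite ge0_muleDr ?lee_fin ?divr_ge0 ?(ltW e0) ?(ltW c0)// -EFinM mulrC divfK ?gt_eqF.
set vA := [set x | A (v * x)%g]; set KV := [set y | K (v^-1 * y)%g].
have mKV : measurable (KV : set (borel G)) by exact: measurable_translate.
have h1 : mG (B `&` A) <= mG (K `&` A) + mG (B `\` K).
  apply: (@le_trans _ _ (mG ((K `&` A) `|` (B `\` K)))).
    apply: le_measure; rewrite ?inE//; first exact: measurableI.
      by apply: measurableU; [exact: measurableI|exact: measurableD].
    by move=> x [Bx Ax]; have [Kx|nKx] := pselect (K x); [left|right].
  by apply: measureU2; [exact: measurableI|exact: measurableD].
have h2 : mG (K `&` A) <= mG (KV `&` A) + mG (K `\` KV).
  apply: (@le_trans _ _ (mG ((KV `&` A) `|` (K `\` KV)))).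
    apply: le_measure; rewrite ?inE//; first exact: measurableI.
      by apply: measurableU; [exact: measurableI|exact: measurableD].
    by move=> x [Bx Ax]; have [Kx|nKx] := pselect (KV x); [left|right].
  by apply: measureU2; [exact: measurableI|exact: measurableD].
have h3 : mG (KV `&` A) = mG (K `&` vA).
  rewrite -(@haar_translate v (KV `&` A)); last exact: measurableI.
  congr (mG _); apply/seteqP; split=> x /=; rewrite /KV /vA /= mulKg//.
have h4 : mG (K `&` vA) <= mG (B `&` vA).
  apply: le_measure; rewrite ?inE; [exact: measurableI|exact: measurableI|].
  exact: setSI.
have h5 : mG (B `\` K) <= (e / c / 2)%:E.
  rewrite measureD// setIidr// leeBlDr//; last first.
    by rewrite ge0_fin_numE// (le_lt_trans _ Bfin)// le_measure ?inE.
  by rewrite addeC.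
rewrite (splitr (e / c)) EFinD.
apply: (le_trans h1); apply: (@le_trans _ _ (mG (KV `&` A) + (e / c / 2)%:E + (e / c / 2)%:E)).
  by rewrite leeD// (le_trans h2)// leeD2l.
by rewrite h3 addeA !leeD.
Unshelve. all: by end_near. Qed.

Lemma translation_lsc_nnsfun (f : {nnsfun (borel G) >-> R}) :
  \int[mG]_x (f x)%:E < +oo -> translation_lsc (fun x => (f x)%:E).
Proof.
move=> ffin; have [s [s0 fE]] := nnsfun_sumE f.
have H (r : seq R) : {subset r <= s} ->
    translation_lsc (fun x => \sum_(y <- r) (y * \1_(f @^-1` [set y]) x)%:E)
    /\ measurable_fun [set: borel G] (fun x => \sum_(y <- r) (y * \1_(f @^-1` [set y]) x)%:E)
    /\ forall x, 0 <= \sum_(y <- r) (y * \1_(f @^-1` [set y]) x)%:E.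
  elim: r => [_|y r IH yrs].
    split.
      move=> e e0; near=> v => A mA; rewrite !integral0_eq ?add0e ?lee_fin ?(ltW e0)//.
        by move=> x _; rewrite big_nil.
      by move=> x _; rewrite big_nil.
    split; first by under eq_fun do rewrite big_nil; exact: measurable_cst.
    by move=> x; rewrite big_nil.
  have y0 : (0 <= y)%R by apply: s0; apply: yrs; rewrite mem_head.
  have [|Hr [mr r0]] := IH; first by move=> z zr; apply: yrs; rewrite inE zr orbT.
  have my : measurable (f @^-1` [set y] : set (borel G)) by exact: measurable_sfunP.
  have m1 : measurable_fun [set: borel G] (fun x => (y * \1_(f @^-1` [set y]) x)%:E).
    apply/measurable_EFinP; apply: measurable_funM => //; exact: measurable_indic.
  have p1 x : 0 <= (y * \1_(f @^-1` [set y]) x)%:E.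
    by rewrite lee_fin mulr_ge0.
  have yfin : y%:E * mG (f @^-1` [set y]) < +oo.
    apply: le_lt_trans ffin.
    have -> : y%:E * mG (f @^-1` [set y]) = \int[mG]_x (y * \1_(f @^-1` [set y]) x)%:E.
      under eq_integral do rewrite EFinM.
      rewrite ge0_integralZl_EFin//; last first.
        by apply/measurable_EFinP; exact: measurable_indic.
      by rewrite integral_indic// setIT.
    apply: ge0_le_integral => //.
    - by apply/measurable_EFinP; exact: measurable_funPT.
    - move=> x _; rewrite lee_fin indicE; case: (boolP (x \in _)).
        by rewrite inE => /= ->; rewrite mulr1.
      by rewrite mulr0.
  split; [|split].
  - have := translation_lscD (translation_lsc_indic my y0 yfin) Hr m1 mr p1 r0.
    by under [X in _ -> translation_lsc X]eq_fun do rewrite big_cons.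
  - by under eq_fun do rewrite big_cons; exact: emeasurable_funD.
  - by move=> x; rewrite big_cons adde_ge0.
have [//|Hs _] := H s.
suff -> : (fun x => (f x)%:E) = (fun x => \sum_(y <- s) (y * \1_(f @^-1` [set y]) x)%:E).
  exact: Hs.
by apply/funext => x; rewrite fE -sumEFin.
Unshelve. all: by end_near. Qed.

(** Approximating the density from below by a simple function reduces the claim
    to sets of finite Haar measure, and inner regularity to compact sets. Both
    approximations only lose a little mass because mu is a probability. *)
Lemma density_translation (mu : probability (borel G) R) (f : borel G -> \bar R) :
  is_density mu mG f -> forall e : R, (0 < e)%R ->
  \forall v \near (1%g : G), forall A : set (borel G), measurable A ->
    mu A <= mu [set x | A (v * x)%g] + e%:E.
Proof.
move=> [mf f0 muE] e e0; have e20 : (0 < e / 2)%R by rewrite divr_gt0.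
have If : \int[mG]_x f x = 1 by rewrite -muE// probability_setT.
have [s [sf sI]] : exists s : {nnsfun (borel G) >-> R},
    (forall x, (s x)%:E <= f x) /\ 1 - (e / 2)%:E < \int[mG]_x (s x)%:E.
  have : \int[mG]_x f x \is a fin_num by rewrite If.
  rewrite ge0_integralTE// => /(ub_ereal_sup_adherent e20)[_ [s sf <-]].
  rewrite -ge0_integralTE// If => h; exists s; split=> //.
  by rewrite integralT_nnsfun.
have ms : measurable_fun [set: borel G] (fun x => (s x)%:E) by exact/measurable_EFinP.
have s0 x : 0 <= (s x)%:E by rewrite lee_fin.
have sfin : \int[mG]_x (s x)%:E < +oo.
  by rewrite (@le_lt_trans _ _ 1) ?ltry// -If; apply: ge0_le_integral.
apply: filterS (translation_lsc_nnsfun sfin e20) => v vs A mA.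
have mvA := measurable_translate v mA.
have h1 : mu A <= \int[mG]_(x in A) (s x)%:E + (e / 2)%:E.
  have snum D : measurable D -> \int[mG]_(x in D) (s x)%:E \is a fin_num.
    move=> mD; rewrite ge0_fin_numE ?integral_ge0// (le_lt_trans _ sfin)//.
    exact: ge0_subset_integral.
  have D1 : mu A + mu (~` A) = 1.
    by rewrite -(probability_setT mu) -(setUv A) measureU// ?setICr//; exact: measurableC.
  have D2 : \int[mG]_(x in A) (s x)%:E + \int[mG]_(x in ~` A) (s x)%:E = \int[mG]_x (s x)%:E.
    rewrite -ge0_integral_setU ?setUv//; first exact: measurableC.
    by rewrite disj_set2E setICr.
  have D3 : \int[mG]_(x in ~` A) (s x)%:E <= mu (~` A).
    rewrite muE; last exact: measurableC.
    apply: ge0_le_integral => //; [exact: measurableC|exact: measurable_funTS..].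
  have n1 := fin_num_measure mu A mA.
  have n2 := fin_num_measure mu (~` A) (measurableC mA).
  have n3 := snum A mA; have n4 := snum (~` A) (measurableC mA).
  move: sI D1 D3; rewrite -D2.
  rewrite -(fineK n1) -(fineK n2) -(fineK n3) -(fineK n4).
  rewrite -?EFinB -?EFinD !lte_fin !lee_fin => hh [] ? ?; lra.
have h3 : \int[mG]_(x in [set x | A (v * x)%g]) (s x)%:E <= mu [set x | A (v * x)%g].
  by rewrite muE//; apply: ge0_le_integral => //; exact: measurable_funTS.
apply: (le_trans h1); apply: (le_trans (leeD2r _ (vs A mA))).
by rewrite -[leLHS]addeA -EFinD -splitr; exact: leeD2r.
Qed.

End haar.

(** * Convolution powers *)

Lemma count_thresholds {R : realType} (N : nat) (t : R) : 0 <= t ->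
  Num.min t N%:R <= \sum_(i < N) (i%:R < t)%R%:R <= t + 1.
Proof.
move=> t0; elim: N => [|N IH].
  by rewrite big_ord0 ge_min lexx orbT /= addr_ge0.
rewrite big_ord_recr /=; have [Nt|tN] := ltP N%:R t.
  have -> : \sum_(i < N) (i%:R < t)%R%:R = N%:R :> R.
    rewrite (eq_bigr (fun=> 1)) => [|i _].
      by rewrite big_const_ord iter_addr_0.
    by rewrite (lt_trans _ Nt)// ltr_nat.
  by rewrite natr1 ge_min lexx orbT/= -natr1 lerD2r ltW.
rewrite addr0; case/andP: IH; rewrite min_l// => h1 h2.
by rewrite h2 andbT ge_min h1.
Qed.

Lemma rint_bounded {d} {T : measurableType d} {R : realType}
    (mu : {finite_measure set T -> \bar R}) (f : T -> R) (M : R) :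
  measurable_fun setT f -> (forall x, `|f x| <= M) -> mu.-integrable setT (EFin \o f).
Proof.
move=> mf fM; apply: measurable_bounded_integrable => //.
  by rewrite ltey_eq fin_num_measure.
by exists M; split; [exact: num_real|move=> y My x _ /=; rewrite (le_trans (fM x))// ltW].
Qed.

Section convolution_powers.
Context {R : realType} {G : topologicalGroupType}.
Notation giryG := (giry (borel G) R).

(** The property of absolutely continuous measures on which the rest relies. *)
Definition translation_cont (mu : probability (borel G) R) := forall e : R, 0 < e ->
  \forall v \near (1%g : G), forall A : set (borel G), measurable A ->
    (mu A <= mu [set x | A (v * x)%g] + e%:E)%E.

Variables (mu : probability (borel G) R) (mut : translation_cont mu).

Lemma rI_indic (A : set (borel G)) : measurable A -> \int[mu]_x (\1_A x) = fine (mu A).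
Proof. by move=> mA; rewrite /Rintegral integral_indic// setIT. Qed.

(** From sets to functions, by averaging the indicators of N superlevel sets. *)
Lemma translation_fun (e : R) : 0 < e -> \forall v \near (1%g : G),
  forall h : borel G -> R, measurable_fun setT h -> (forall x, 0 <= h x <= 1) ->
    \int[mu]_x h x <= \int[mu]_x h (v * x)%g + e.
Proof.
move=> e0; have [N N0] : exists N : nat, N.+1%:R^-1 < e / 2.
  by apply: invS_small; rewrite divr_gt0.
have e20 : 0 < e / 2 by rewrite divr_gt0.
pose M : R := N.+1%:R; have M0 : 0 < M by rewrite ltr0n.
apply: filterS (mut e20) => v vA h mh h01.
pose A i := [set x : borel G | i%:R / M < h x].
have mA i : measurable (A i).
  have := measurable_fun_ltr (measurable_cst (i%:R / M)) mh.
  by move=> /(_ measurableT [set true] I); rewrite setTI.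
pose hN x := \sum_(i < N.+1) M^-1 * \1_(A i) x.
have hN1 x : h x <= hN x <= h x + M^-1.
  have /andP[h0 h1] := h01 x.
  have t0 : 0 <= M * h x by rewrite mulr_ge0// ltW.
  have := count_thresholds N.+1 t0; rewrite min_l; last by rewrite ler_piMr// ltW.
  have -> : \sum_(i < N.+1) (i%:R < M * h x)%R%:R = M * hN x.
    rewrite /hN -mulr_sumr mulrA divff ?gt_eqF// mul1r; apply: eq_bigr => i _.
    rewrite indicE; congr (nat_of_bool _)%:R.
    by rewrite /A; apply/idP/idP; rewrite inE /= ltr_pdivrMr// mulrC.
  move=> /andP[]; rewrite ler_pM2l// => -> /=.
  by move=> H; rewrite -(ler_pM2l M0) mulrDr divff ?gt_eqF.
have mvh : measurable_fun setT (fun x : borel G => h (v * x)%g).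
  exact: (measurableT_comp mh (measurable_lmul v)).
have bnd (k : borel G -> R) : measurable_fun setT k -> (forall x, 0 <= k x <= 1) ->
    mu.-integrable setT (EFin \o k).
  move=> mk k01; apply: (@rint_bounded _ _ _ mu k 1) => // x.
  by have /andP[? ?] := k01 x; rewrite ger0_norm.
have ii (B : set (borel G)) : measurable B -> mu.-integrable setT (EFin \o \1_B).
  move=> mB; apply: bnd; first exact: measurable_indic.
  by move=> x; rewrite indicE; case: (_ \in _); rewrite ?lexx ?ler01.
have Isum (B : 'I_N.+1 -> set (borel G)) : (forall i, measurable (B i)) ->
    mu.-integrable setT (EFin \o (fun x => \sum_(i < N.+1) M^-1 * \1_(B i) x)) /\
    \int[mu]_x (\sum_(i < N.+1) M^-1 * \1_(B i) x) = \sum_(i < N.+1) M^-1 * fine (mu (B i)).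
  move=> mB; have ri i : mu.-integrable setT (EFin \o (fun x => M^-1 * \1_(B i) x)).
    by apply: rintZ; exact: ii.
  split; first exact: rint_sum.
  rewrite rI_sum//; apply: eq_bigr => i _.
  by rewrite rIZ ?rI_indic//; exact: ii.
pose B i := [set x : borel G | A i (v * x)%g].
have mB i : measurable (B i) by exact: measurable_translate.
have [iA IA] := Isum _ mA; have [iB IB] := Isum _ mB.
have iv := bnd _ mvh (fun x => h01 _).
have ih := bnd _ mh h01.
have h1 : \int[mu]_x h x <= \sum_(i < N.+1) M^-1 * fine (mu (A i)).
  by rewrite -IA; apply: rI_le => // x; have /andP[] := hN1 x.
have h2 : \sum_(i < N.+1) M^-1 * fine (mu (B i)) <= \int[mu]_x h (v * x)%g + M^-1.
  have ic : mu.-integrable setT (EFin \o cst M^-1) by exact: finite_measure_integrable_cst.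
  have -> : \int[mu]_x h (v * x)%g + M^-1 = \int[mu]_x (h (v * x)%g + M^-1).
    rewrite (rID iv ic) Rintegral_cst//; congr (_ + _).
    by rewrite [X in fine X](@probability_setT _ _ _ mu) mulr1.
  rewrite -IB; apply: rI_le => //; first exact: rintD.
  by move=> x; have /andP[_] := hN1 (v * x)%g.
apply: (le_trans h1).
have h3 : \sum_(i < N.+1) M^-1 * fine (mu (A i)) <= \sum_(i < N.+1) M^-1 * fine (mu (B i)) + e / 2.
  have -> : e / 2 = \sum_(i < N.+1) M^-1 * (e / 2).
    rewrite big_const_ord iter_addr_0 -[RHS]mulr_natl -/M [RHS]mulrA divff ?mul1r//.
    by rewrite gt_eqF.
  rewrite -big_split/=; apply: ler_sum => i _; rewrite -mulrDr ler_pM2l ?invr_gt0//.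
  have := vA _ (mA i).
  rewrite -(fineK (fin_num_measure mu _ (mA i))) -(fineK (fin_num_measure mu _ (mB i))).
  by rewrite -EFinD lee_fin.
apply: (le_trans h3); rewrite (le_trans (lerD h2 (lexx _)))// -addrA lerD2l.
by rewrite [leRHS]splitr lerD2r ltW.
Qed.

(** What makes the convolution with nu a measure. It is not automatic, since
    multiplication need not be measurable for the product sigma-algebra. *)
Definition translation_measurable (nu : giryG) := forall A : set (borel G),
  measurable A -> measurable_fun [set: borel G] (fun x : borel G => nu [set y | A (x * y)%g]).

Definition translates (nu : giryG) (x : borel G) : giryG := giry_map (measurable_lmul x) nu.

Lemma measurable_translates nu : translation_measurable nu ->
  measurable_fun setT (translates nu).
Proof. by move=> Hnu; apply: measurable_giry_codensity. Qed.

Lemma giry_le1 (nu : giryG) (A : set (borel G)) : measurable A -> (nu A <= 1)%E.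
Proof.
move=> mA; have h1 := @sprobability_setT _ _ _ nu; rewrite (le_trans _ h1)//.
by apply: le_measure; rewrite ?inE.
Qed.

Lemma giry_fin (nu : giryG) (A : set (borel G)) : measurable A -> nu A \is a fin_num.
Proof.
move=> mA; rewrite ge0_fin_numE//; apply: (le_lt_trans (giry_le1 nu mA)).
by rewrite ltry.
Qed.

(** Convolving with mu on the left turns the measurable function
    x |-> nu (x^-1 A) into a lower semicontinuous one. *)
Lemma conv_translation_measurable (nu nu' : giryG) : translation_measurable nu ->
  (forall A, measurable A -> nu' A = (\int[mu]_x nu [set y | A (x * y)%g])%E) ->
  translation_measurable nu'.
Proof.
move=> Hnu nu'E A mA.
pose h (x : borel G) : R := fine (nu [set y | A (x * y)%g]).
have mAx x : measurable ([set y | A (x * y)%g] : set (borel G)) by exact: measurable_translate.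
have hE x : nu [set y | A (x * y)%g] = (h x)%:E by rewrite fineK// giry_fin.
have mh : measurable_fun setT h.
  by apply/measurable_EFinP; apply: eq_measurable_fun (Hnu A mA) => x _; rewrite hE.
have h01 x : 0 <= h x <= 1.
  by rewrite -!lee_fin -hE measure_ge0 giry_le1.
have mhy (y : G) : measurable_fun setT (fun x : borel G => h (y * x)%g).
  exact: (measurableT_comp mh (measurable_lmul y)).
pose H (y : G) := \int[mu]_x h (y * x)%g.
have HE (y : borel G) : nu' [set z | A (y * z)%g] = (H y)%:E.
  rewrite nu'E; last exact: measurable_translate.
  rewrite /H /Rintegral fineK; last first.
    apply: (@integrable_fin_num _ _ _ mu setT measurableT (EFin \o (fun x => h (y * x)%g))).
    apply: (@rint_bounded _ _ _ mu _ 1) => // x.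
    by have /andP[? ?] := h01 (y * x)%g; rewrite ger0_norm.
  apply: eq_integral => x _; rewrite -hE; congr (nu _).
  by apply/seteqP; split=> z /=; rewrite mulgA.
apply: (eq_measurable_fun (fun y : borel G => (H y)%:E)) => [y _|]; first by rewrite HE.
apply/measurable_EFinP.
apply: (@measurability _ _ (borel G) _ setT (H : borel G -> R) _ (RGenOInfty.measurableE R)).
move=> _ [_ [r ->] <-]; rewrite setTI.
have oU : open ([set y | r < H y] : set G).
  rewrite openE => y /= ry; rewrite /interior.
  apply: lmul_near; have e0 : 0 < (H y - r) / 2 by rewrite divr_gt0// subr_gt0.
  apply: filterS (translation_fun e0) => v vP /=.
  have := vP _ (mhy y) (fun x => h01 _).
  rewrite (_ : \int[mu]_x h (y * (v * x))%g = H (y * v)%g); last first.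
    by apply: eq_Rintegral => x _; rewrite mulgA.
  by rewrite -/(H y); lra.
rewrite (_ : _ @^-1` _ = [set y | r < H y]); first exact: open_borel.
by apply/seteqP; split=> y /=; rewrite in_itv/= andbT.
Qed.

Lemma translate_indic (nu : giryG) (A : set (borel G)) (x : borel G) : measurable A ->
  (\int[nu]_y (\1_A (x * y)%g)%:E = nu [set y | A (x * y)%g])%E.
Proof.
move=> mA; have mAx := measurable_translate x mA.
transitivity (\int[nu]_y (\1_([set y | A (x * y)%g] : set (borel G)) y)%:E)%E.
  by [].
by rewrite integral_indic// setIT.
Qed.

(** The powers are built as iterated binds in the Giry monad, whose calculus
    provides the integration formulas. *)
Lemma convolution_powers : exists nu : nat -> giryG,
  [/\ forall n A, measurable A -> conv_exp mu n A = nu n A,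
      forall n, nu n setT = 1%E,
      forall F : borel G -> \bar R, measurable_fun setT F -> (forall x, 0 <= F x)%E ->
        (\int[nu 0%N]_x F x = F 1%g)%E &
      forall n (F : borel G -> \bar R), measurable_fun setT F -> (forall x, 0 <= F x)%E ->
        measurable_fun setT (fun x : borel G => \int[nu n]_y F (x * y)%g)%E /\
        (\int[nu n.+1]_x F x = \int[mu]_x \int[nu n]_y F (x * y)%g)%E].
Proof.
pose mu' : giryG := mu.
have bindE (nu : giryG) (tm : translation_measurable nu) F : measurable_fun setT F ->
    (forall x, 0 <= F x)%E ->
    (\int[giry_bind mu' (measurable_translates tm)]_x F x = \int[mu]_x \int[nu]_y F (x * y)%g)%E.
  move=> mF F0; have := giry_int_bind mu' (measurable_translates tm) mF F0.
  rewrite /giry_int => ->; apply: eq_integral => x _.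
  by have := giry_int_map (measurable_lmul x) nu mF F0.
have ex n : exists nu : giryG, translation_measurable nu /\
    ((forall A, measurable A -> conv_exp mu n A = nu A) /\ nu setT = 1%E).
  elim: n => [|n [nu [tm [nuE nu1]]]].
    exists (giry_ret (1%g : borel G)); split; last by split=> //; rewrite /giry_ret /= diracT.
    move=> A mA; rewrite /giry_ret /=.
    apply: (eq_measurable_fun (fun x : borel G => (\1_A x)%:E)) => [x _|].
      by rewrite /= diracE indicE; congr ((nat_of_bool _)%:R%:E); apply/idP/idP; rewrite !inE /= mulg1.
    by apply/measurable_EFinP; exact: measurable_indic.
  pose nu' := giry_bind mu' (measurable_translates tm).
  have nu'E A : measurable A -> nu' A = (\int[mu]_x nu [set y | A (x * y)%g])%E.
    move=> mA; have mI : measurable_fun setT (fun x : borel G => (\1_A x)%:E : \bar R).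
      by apply/measurable_EFinP; exact: measurable_indic.
    have := bindE nu tm _ mI; rewrite integral_indic// setIT => ->; last first.
      by move=> x; rewrite lee_fin.
    by apply: eq_integral => x _; rewrite translate_indic.
  exists nu'; split; first exact: conv_translation_measurable tm nu'E.
  split=> [A mA|].
    rewrite nu'E//= /convolution; apply: eq_integral => x _.
    by rewrite nuE//; exact: measurable_translate.
  rewrite nu'E//; under eq_integral do rewrite nu1.
  by rewrite integral_cst// mul1e; exact: probability_setT.
pose nu n := projT1 (cid (ex n)).
have nuP n : translation_measurable (nu n) /\
    ((forall A, measurable A -> conv_exp mu n A = nu n A) /\ nu n setT = 1%E).
  by rewrite /nu; case: cid.
exists nu; split.
- by move=> n A mA; have [_ [-> //]] := nuP n.
- by move=> n; have [_ []] := nuP n.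
- move=> F mF F0; rewrite -(@giry_int_ret _ _ _ (1%g : borel G) F mF).
  apply: eq_measure_integral => A mA _.
  by have [_ [h _]] := nuP 0%N; exact: esym (h A mA).
- move=> n F mF F0; have [tm [nuE _]] := nuP n; split.
    have := measurableT_comp (measurable_giry_int mF F0) (measurable_translates tm).
    apply: eq_measurable_fun => x _ /=.
    by have := giry_int_map (measurable_lmul x) (nu n) mF F0.
  rewrite -(bindE _ tm F mF F0); apply: eq_measure_integral => A mA _.
  have [_ [h _]] := nuP n.+1; transitivity (conv_exp mu n.+1 A); first exact: esym (h A mA).
  have mI : measurable_fun setT (fun x : borel G => (\1_A x)%:E : \bar R).
    by apply/measurable_EFinP; exact: measurable_indic.
  have := bindE _ tm _ mI; rewrite integral_indic// setIT => ->; last first.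
    by move=> x; rewrite lee_fin.
  rewrite /= /convolution; apply: eq_integral => x _.
  by rewrite nuE ?translate_indic//; exact: measurable_translate.
Qed.

End convolution_powers.

Import HBNNSimple.

(** For bare set functions, because [conv_exp] is one. *)
Lemma integral_set_function {d} {T : measurableType d} {R : realType}
    (m1 m2 : set T -> \bar R) (F : T -> \bar R) :
  (forall A, measurable A -> m1 A = m2 A) ->
  (\int[m1]_x F x = \int[m2]_x F x)%E.
Proof.
move=> m12; rewrite /integral.
have S (h : {nnsfun T >-> R}) : sintegral m1 h = sintegral m2 h.
  by rewrite /sintegral; apply: eq_fsbigr => x _; rewrite m12.
by congr (_ - _)%E; congr ereal_sup; apply/seteqP; split=> _ [h hF <-]; exists h.
Qed.

(** * Barycenters *)

Lemma banach_seq_complete {R : realType} (E : completeNormedModType R) (u : nat -> E) :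
  (forall e : R, 0 < e -> exists N, forall i j, (N <= i)%N -> (N <= j)%N -> `|u i - u j| < e) ->
  exists l, forall e : R, 0 < e -> exists N, forall i, (N <= i)%N -> `|u i - l| < e.
Proof.
move=> uc; have /cvg_ex[l ul] : cvg (u @ \oo).
  apply: cauchy_cvg; apply/cauchyP => e e0.
  have [N NP] := uc e e0; exists (u N); exists N => // j /= Nj.
  by rewrite -ball_normE /=; exact: NP.
exists l => e e0; move/cvgrPdist_lt : ul => /(_ e e0)[N _ NP].
by exists N => i Ni; rewrite distrC; exact: NP.
Qed.

Lemma dense_sequence {R : realType} (E : normedModType R) : separable_space E ->
  exists d : nat -> E, forall x (e : R), 0 < e -> exists k, `|x - d k| < e.
Proof.
move=> [D /countable_injP[f fi] dD].
have Dne x (e : R) : 0 < e -> exists2 y, D y & `|x - y| < e.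
  move=> e0; have [||y [xy Dy]] := dD (ball x e).
  - by exists x; exact: ballxx.
  - exact: ball_open.
  by exists y => //; move: xy; rewrite -ball_normE.
exists (fun k => xget 0 [set y | D y /\ f y = k]) => x e e0.
have [y Dy xy] := Dne x e e0; exists (f y).
case: xgetP => [z _ [Dz fz]|/(_ y)]; last by case.
by rewrite (fi z y) ?inE.
Qed.

(** The mean of an E-valued function for a probability measure, characterised by
    the functionals L. The duality map D supplies enough of them to separate
    points and to estimate norms. *)
Section barycenter.
Context {R : realType} {G : topologicalGroupType} (mu : probability (borel G) R)
  {E : completeNormedModType R} (sepE : separable_space E)
  (p : R) (p1 : 1 < p) (D : E -> E -> R)
  (Dlin : forall x a y z, D x (a *: y + z) = a * D x y + D x z)
  (Dself : forall x, D x x = `|x| `^ p)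
  (Dbound : forall x y, `|D x y| <= 2 * `|x| `^ (p - 1) * `|y|).
Notation rint f := (mu.-integrable [set: borel G] (EFin \o f)).

Definition bounded_linear (L : E -> R) (C : R) :=
  (forall a x y, L (a *: x + y) = a * L x + L y) /\ forall x, `|L x| <= C * `|x|.

Lemma bounded_linear0 L C : bounded_linear L C -> L 0 = 0.
Proof. by move=> [_ /(_ 0)]; rewrite normr0 mulr0 normr_le0 => /eqP. Qed.

Lemma bounded_linearB L C x y : bounded_linear L C -> L (x - y) = L x - L y.
Proof.
by move=> [Ll _]; rewrite addrC -scaleN1r Ll mulN1r addrC.
Qed.

Lemma bounded_linear_sum L C (I : Type) (r : seq I) (a : I -> R) (d : I -> E) :
  bounded_linear L C -> L (\sum_(i <- r) a i *: d i) = \sum_(i <- r) a i * L (d i).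
Proof.
move=> Lb; elim: r => [|i r IH]; first by rewrite !big_nil (bounded_linear0 Lb).
by rewrite !big_cons -IH; case: Lb.
Qed.

Lemma bounded_linear_continuous L C (f : G -> E) : bounded_linear L C ->
  continuous f -> continuous (fun x => L (f x)).
Proof.
move=> Lb cf x; apply/cvgrPdist_lt => e e0.
have C0 : 0 < `|C| + 1 by rewrite ltr_wpDl.
have /cvgrPdist_lt/(_ _ (divr_gt0 e0 C0)) := cf x.
apply: filterS => y; rewrite ltr_pdivlMr// => xy.
rewrite -(bounded_linearB _ _ Lb); case: Lb => _ /(_ (f x - f y)) h.
apply: (le_lt_trans h); apply: le_lt_trans xy.
by rewrite mulrC ler_wpM2l// (le_trans (ler_norm _))// lerDl.
Qed.

Variables (f : G -> E) (cf : continuous f) (fi : rint (fun x => `|f x|)).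

Lemma bounded_linear_rint L C : bounded_linear L C -> rint (fun x => L (f x)).
Proof.
move=> Lb; apply: (@rint_dom _ (borel G) _ mu (fun x => L (f x)) (fun x => C * `|f x|)).
- exact: (continuous_real_borel (bounded_linear_continuous Lb cf)).
- exact: rintZ.
- by move=> x; case: Lb => _; apply.
Qed.

(** Replace f on the cell A k, where d k is the first point of a dense sequence
    close to f, by the constant d k; finitely many cells carry almost all of the
    integral of the norm of f. *)
Lemma barycenter_approx (e : R) : 0 < e -> exists z : E, forall L C, 0 <= C ->
  bounded_linear L C -> `|L z - \int[mu]_x L (f x)| <= C * e.
Proof.
move=> e0; have [d dP] := dense_sequence sepE.
have e20 : 0 < e / 2 by rewrite divr_gt0.
pose N k : set (borel G) := [set x | `|f x - d k| < e / 2].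
have mN k : measurable (N k).
  apply: open_borel.
  have cn : continuous (fun x => `|f x - d k|).
    move=> x; apply: cvg_norm; apply: cvgB; [exact: cf|exact: cvg_cst].
  exact: (open_comp (f := fun x => `|f x - d k|) (fun x _ => cn x) (@open_lt _ (e / 2))).
pose A k : set (borel G) := N k `\` \bigcup_(j in `I_k) N j.
have mA k : measurable (A k).
  by apply: measurableD => //; apply: bigcup_measurable.
pose B n : set (borel G) := \bigcup_(j in `I_n) N j.
have mB n : measurable (B n) by apply: bigcup_measurable.
have Bsum n x : B n x -> exists2 k, (k < n)%N & A k x.
  move=> [j jn Nj]; have [k [Nk kmin]] : exists k, N k x /\ forall i, (i < k)%N -> ~ N i x.
    have ex : exists k, `[< N k x >] by exists j; apply/asboolP.
    exists (ex_minn ex); case: ex_minnP => k /asboolP Nk kmin; split=> // i ik Ni.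
    by have := kmin i (asboolT Ni); rewrite leqNgt ik.
  exists k; last by split=> // -[i ik Ni]; exact: (kmin i ik).
  by rewrite (leq_ltn_trans _ jn)// leqNgt; apply/negP => jk; exact: (kmin j jk).
have Adisj k j x : A k x -> A j x -> k = j.
  move=> [Nk nk] [Nj nj]; apply/eqP; rewrite eqn_leq; apply/andP; split; rewrite leqNgt; apply/negP => h.
    by apply: nk; exists j.
  by apply: nj; exists k.
have tail : exists n, \int[mu]_x (`|f x| * \1_(~` B n) x) <= e / 2.
  have mn : measurable_fun setT (fun x : borel G => (`|f x|)%:E) by exact: measurable_int fi.
  have m n : measurable_fun setT (fun x : borel G => (`|f x| * \1_(~` B n) x)%:E).
    apply/measurable_EFinP; apply: measurable_funM; first exact/measurable_EFinP.
    by apply: measurable_indic; exact: measurableC.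
  have [|||_ _] := @dominated_convergence _ _ _ mu setT measurableT
     (fun n x => (`|f x| * \1_(~` B n) x)%:E) (cst 0%E) (fun x => `|f x|%:E) m _ _ fi.
  - exact: measurable_cst.
  - apply: nearW => x _; apply/fine_cvgP; split; first exact: nearW.
    have [k Nk] := dP (f x) _ e20.
    apply: cvg_near_cst; exists k.+1 => // n /= kn.
    by rewrite indicE memNset ?mulr0// => nB; apply: nB; exists k.
  - apply: nearW => x n _; rewrite gee0_abs ?lee_fin ?mulr_ge0//.
    by rewrite ler_piMr// indicE; case: (_ \in _).
  rewrite integral0 => /fine_cvgP[_ /cvgrPdist_lt/(_ _ e20)[n _ nP]].
  exists n; have := nP n (leqnn n); rewrite /= sub0r normrN /Rintegral => /ltW.
  exact: le_trans (ler_norm _).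
have [n nP] := tail.
exists (\sum_(k < n) fine (mu (A k)) *: d k) => L C C0 Lb.
have iA k : rint (fun x => \1_(A k) x * L (d k)).
  under eq_fun do rewrite mulrC.
  by apply: rintZ; exact: integrable_indic.
have IA k : \int[mu]_x (\1_(A k) x * L (d k)) = fine (mu (A k)) * L (d k).
  under eq_Rintegral do rewrite mulrC.
  rewrite rIZ; last exact: integrable_indic.
  by rewrite (rI_indic mu (mA k)) mulrC.
have iL := bounded_linear_rint Lb.
have iS : rint (fun x => \sum_(k < n) \1_(A k) x * L (d k)).
  by apply: rint_sum.
have -> : L (\sum_(k < n) fine (mu (A k)) *: d k) =
    \int[mu]_x (\sum_(k < n) \1_(A k) x * L (d k)).
  rewrite (bounded_linear_sum _ (fun k : 'I_n => fine (mu (A k))) _ Lb).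
  rewrite rI_sum//.
  by apply: eq_bigr => k _; rewrite IA.
rewrite -rIB//.
have iN : rint (fun x => `|f x| * \1_(~` B n) x).
  apply: (@rint_dom _ (borel G) _ mu (fun x => `|f x| * \1_(~` B n) x) (fun x => `|f x|)) => //.
    apply: measurable_funM; first exact: rint_meas fi.
    by apply: measurable_indic; exact: measurableC.
  move=> x; rewrite ger0_norm ?mulr_ge0// ler_piMr// indicE; by case: (_ \in _).
have i1 : rint (fun=> e / 2) by exact: finite_measure_integrable_cst.
apply: (@le_trans _ _ (\int[mu]_x (C * (e / 2 + `|f x| * \1_(~` B n) x)))).
  apply: rI_norm_le; first exact: rintB.
    by apply: rintZ; exact: rintD.
  move=> x; have [Bx|nBx] := pselect (B n x).
    have [k kn Ak] := Bsum n x Bx.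
    rewrite (bigD1 (Ordinal kn))//= big1 => [|j jk].
      rewrite indicE mem_set// mul1r addr0 -(bounded_linearB _ _ Lb).
      case: Lb => _ /(_ (d k - f x)) h; apply: (le_trans h); rewrite ler_wpM2l//.
      rewrite [X in _ + _ * X](_ : _ = 0) ?mulr0 ?addr0; last by rewrite indicE memNset//; apply.
      by rewrite distrC ltW//; case: Ak.
    rewrite indicE memNset ?mul0r// => Aj; move/eqP: jk; apply.
    by apply: val_inj; exact: (Adisj _ _ x).
  rewrite big1 ?sub0r ?normrN => [|k _].
    rewrite indicE mem_set// mulr1; case: Lb => _ /(_ (f x)) h.
    by apply: (le_trans h); rewrite ler_wpM2l// lerDr ltW.
  by rewrite indicE memNset ?mul0r// => -[Nk _]; apply: nBx; exists k => /=.
rewrite rIZ; last exact: rintD.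
rewrite ler_wpM2l// rID// Rintegral_cst// [X in fine X](@probability_setT _ _ _ mu) mulr1.
by rewrite [leRHS]splitr lerD2l.
Qed.

Lemma barycenter_unique (x y : E) : (forall w, D w x = D w y) -> x = y.
Proof.
move=> H; apply/eqP; rewrite -subr_eq0 -normr_eq0.
have := Dself (x - y); have -> : D (x - y) (x - y) = 0.
  have e w : D w (x - y) = 0.
    by rewrite [x - y]addrC -[- y]scaleN1r Dlin H mulN1r addNr.
  exact: e.
by move/esym/eqP; rewrite powR_eq0 => /andP[].
Qed.

Lemma D_bounded_linear w : bounded_linear (D w) (2 * `|w| `^ (p - 1)).
Proof. by split. Qed.

(** Approximate barycenters form a Cauchy sequence: the functional D w, for w the
    difference of two of them, has norm of order |w|^(p-1) and value |w|^p at w. *)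
Lemma barycenter : exists z : E, forall L C, bounded_linear L C ->
  L z = \int[mu]_x L (f x).
Proof.
have ex n : exists z : E, forall L C, 0 <= C -> bounded_linear L C ->
    `|L z - \int[mu]_x L (f x)| <= C * n.+1%:R^-1.
  by apply: barycenter_approx; rewrite invr_gt0.
have /choice[u uP] := ex.
have uij i j : `|u i - u j| <= 2 * (i.+1%:R^-1 + j.+1%:R^-1).
  have [->|w0] := eqVneq (u i - u j) 0.
    by rewrite normr0 mulr_ge0// addr_ge0 ?invr_ge0.
  set w := u i - u j in w0 *.
  have wp : 0 < `|w| `^ (p - 1) by apply: powR_gt0; rewrite normr_gt0.
  have C0 : 0 <= 2 * `|w| `^ (p - 1) by rewrite mulr_ge0 ?powR_ge0.
  have hi := uP i _ _ C0 (D_bounded_linear w); have hj := uP j _ _ C0 (D_bounded_linear w).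
  have : D w w <= 2 * `|w| `^ (p - 1) * (i.+1%:R^-1 + j.+1%:R^-1).
    rewrite {2}/w (bounded_linearB _ _ (D_bounded_linear w)) mulrDr.
    apply: (le_trans (ler_norm _)).
    rewrite -(subrKA (\int[mu]_x D w (f x))) (le_trans (ler_normD _ _))// lerD//.
    by rewrite distrC.
  rewrite Dself -(@mulr_powRB1 _ _ p)//; last by rewrite (lt_trans _ p1).
  by rewrite [leLHS]mulrC [2 * _]mulrC -mulrA ler_pM2l.
have [e e0|z zP] := @banach_seq_complete R E u.
  have [N NP] := invS_small (divr_gt0 e0 (@ltr0Sn R 3)).
  exists N => i j Ni Nj; apply: (le_lt_trans (uij i j)).
  have := @invS_le R _ _ Ni; have := @invS_le R _ _ Nj; move: NP.
  by move: (i.+1%:R^-1) (j.+1%:R^-1) (N.+1%:R^-1) => a b c; lra.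
exists z => L C Lb.
have C0 : 0 <= `|C| by [].
have Lb' : bounded_linear L `|C|.
  by case: Lb => Ll Lc; split=> // x; rewrite (le_trans (Lc x))// ler_wpM2r// ler_norm.
apply/eqP; rewrite -subr_eq0 -normr_le0; apply/ler_addgt0Pr => e e0; rewrite add0r.
have d0 : 0 < e / (`|C| + 1) / 2 by rewrite !divr_gt0.
have [N1 NP1] := zP _ d0; have [N2 NP2] := invS_small d0.
pose N := maxn N1 N2.
have h1 := NP1 N (leq_maxl _ _).
have h2 := le_lt_trans (@invS_le R _ _ (leq_maxr N1 N2)) NP2.
rewrite -/N in h2.
rewrite -(subrKA (L (u N))) (le_trans (ler_normD _ _))//.
have h3 : `|L z - L (u N)| <= `|C| * (e / (`|C| + 1) / 2).
  rewrite -(bounded_linearB _ _ Lb'); case: Lb' => _ /(_ (z - u N)) h.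
  by apply: (le_trans h); rewrite ler_wpM2l// distrC ltW.
have h4 : `|L (u N) - \int[mu]_x L (f x)| <= `|C| * (e / (`|C| + 1) / 2).
  by apply: (le_trans (uP N _ _ C0 Lb')); rewrite ler_wpM2l// ltW.
apply: (le_trans (lerD h3 h4)); rewrite -mulrDr -splitr mulrCA.
by rewrite ler_piMr ?(ltW e0)// ler_pdivrMr// mul1r lerDl.
Qed.

End barycenter.

(** * Length functions small in mean are small on compact sets *)

Lemma dualityZ {R : realType} (p : R) (E : normedModType R) (D : E -> E -> R)
    (c C t : R) (x y : E) : duality_map p D c C -> D x (t *: y) = t * D x y.
Proof.
move=> [Dl _ _ _ _]; have D0 : D x 0 = 0.
  by have := Dl x 1 0 0; rewrite scale1r addr0 mul1r -{1}[D x 0]addr0 => /addrI.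
by have := Dl x t y 0; rewrite D0 !addr0.
Qed.

(** The two inequalities of [duality_map] for a small multiple of y: they recover
    D from the norm. *)
Lemma duality_derivative {R : realType} (p : R) (E : normedModType R) (D : E -> E -> R)
    (c C t : R) (x y : E) : 2 < p -> 0 < c -> duality_map p D c C -> 0 < t <= 1 ->
  p * t * D x y <= `|x + t *: y| `^ p - `|x| `^ p <=
    p * t * D x y + C * t ^+ 2 * (`|x| `^ p + `|y| `^ p).
Proof.
move=> p2 c0 HD /andP[t0 t1]; have [_ _ _ Dc Dm] := HD.
have DZ : D x (t *: y) = t * D x y by exact: dualityZ HD.
have h1 := Dc x (t *: y); have h2 := Dm t x (t *: y).
rewrite t0 t1 in h2; have {}h2 := h2 isT; rewrite !DZ in h1 h2.
have e2 : t `^ (2 - p) * `|t *: y| `^ p = t ^+ 2 * `|y| `^ p.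
  rewrite normrZ (gtr0_norm t0) powRM ?(ltW t0)// mulrA -powRD; last first.
    by rewrite (gt_eqF t0) implybT.
  by rewrite subrK powR_mulrn// ltW.
rewrite e2 -mulrDr [C * (_ * _)]mulrA [p * (t * _)]mulrA in h2.
rewrite [p * (t * _)]mulrA in h1.
have h3 : 0 <= c * `|t *: y| `^ p by rewrite mulr_ge0// ?powR_ge0// ltW.
by rewrite lerBrDl lerBlDl addrA h2 andbT (le_trans _ h1)// lerDl.
Qed.

(** The derivative of the p-th power of the norm only depends on the norm. *)
Lemma duality_isometry {R : realType} (p : R) (E : normedModType R) (D : E -> E -> R)
    (c C : R) (U : {linear E -> E}) : 2 < p -> 0 < c -> 0 < C -> duality_map p D c C ->
  (forall u, `|U u| = `|u|) -> forall x y, D (U x) (U y) = D x y.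
Proof.
move=> p2 c0 C0 HD UN.
have p0 : 0 < p by apply: lt_trans p2.
have H x y : D (U x) (U y) <= D x y.
  rewrite -subr_le0.
  have small t : 0 < t -> t <= 1 ->
      D (U x) (U y) - D x y <= t * (C / p * (`|x| `^ p + `|y| `^ p)).
    move=> t0 t1; have tt : 0 < t <= 1 by rewrite t0.
    have /andP[h1 _] := duality_derivative (U x) (U y) p2 c0 HD tt.
    have /andP[_ h2] := duality_derivative x y p2 c0 HD tt.
    have e1 : `|U x + t *: U y| = `|x + t *: y| by rewrite -linearZ -linearD UN.
    rewrite e1 UN in h1; have pt : 0 < p * t by rewrite mulr_gt0.
    rewrite -(ler_pM2l pt) mulrBr lerBlDl (le_trans h1)// (le_trans h2)// lerD2l.
    by rewrite le_eqVlt; apply/orP; left; apply/eqP; field; rewrite gt_eqF.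
  apply: (@le0_by_scaling _ _ (C / p * (`|x| `^ p + `|y| `^ p))) => s s0.
  have [s1|s1] := leP s 1; first exact: small.
  apply: (le_trans (small 1 ltr01 (lexx _))).
  by apply: ler_wpM2r (ltW s1); rewrite mulr_ge0// divr_ge0// ltW.
move=> x y; apply/eqP; rewrite eq_le H /=.
have := H x (-1 *: y); have -> : U (-1 *: y) = -1 *: U y by exact: linearZ.
by rewrite !(dualityZ _ _ _ HD) !mulN1r lerN2.
Qed.

Section length_functions.
Context {R : realType} {G : topologicalGroupType} (mu : probability (borel G) R)
  (mut : translation_cont mu) (S : set G) (genS : generating S)
  (suppS : S `<=` msupport mu).

Definition length_fun (phi : G -> R) := [/\ continuous phi,
  forall g h, phi (g * h)%g <= phi g + phi h,
  forall g, phi (g^-1)%g = phi g &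
  forall g, 0 <= phi g].

Definition mass_above (phi : G -> R) (t : R) : R :=
  fine (mu [set x | t < phi x]).

Lemma above_measurable phi t : length_fun phi ->
  measurable ([set x | t < phi x] : set (borel G)).
Proof.
move=> [cphi _ _ _]; have m := continuous_real_borel cphi.
have := measurable_fun_ltr (measurable_cst t) m.
by move=> /(_ measurableT [set true] I); rewrite setTI.
Qed.

(** A single integer n bounds the factor and the mass, which makes the property
    monotone in n and additive in g. *)
Definition controlled (n : nat) (g : G) := forall phi t, length_fun phi -> 0 <= t ->
  mass_above phi t < n.+1%:R^-1 -> phi g <= n%:R * t.

Lemma controlled_mono m n g : (m <= n)%N -> controlled m g -> controlled n g.
Proof.
move=> mn mg phi t Hphi t0 H.
apply: (@le_trans _ _ (m%:R * t)).
  apply: mg => //; apply: (lt_le_trans H).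
  by rewrite lef_pV2 ?posrE ?ltr0n// ler_nat.
by rewrite ler_wpM2r// ler_nat.
Qed.

Lemma controlledM m n g h : controlled m g -> controlled n h ->
  controlled (m + n) (g * h)%g.
Proof.
move=> mg nh phi t Hphi t0 H.
have [_ sub _ _] := Hphi; apply: (le_trans (sub g h)).
rewrite natrD mulrDl; apply: lerD.
  apply: mg => //; apply: (lt_le_trans H).
  by rewrite lef_pV2 ?posrE ?ltr0n// ler_nat ltnS leq_addr.
apply: nh => //; apply: (lt_le_trans H).
by rewrite lef_pV2 ?posrE ?ltr0n// ler_nat ltnS leq_addl.
Qed.

(** The argument of Steinhaus: a set A of almost full measure meets its translate
    by any small enough v, so that v lies in A A^-1, on which phi <= 2 t. *)
Lemma controlled_near1 : \forall v \near (1%g : G), controlled 3 v.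
Proof.
have e0 : 0 < 4^-1 :> R by rewrite invr_gt0.
apply: filterS (mut e0) => v vA phi t Hphi t0 H.
have [_ sub inv _] := Hphi.
pose B : set (borel G) := [set x | t < phi x]; pose A : set (borel G) := ~` B.
have mB : measurable B by exact: above_measurable.
have mA : measurable A by exact: measurableC.
have mvA : measurable ([set x | A (v * x)%g] : set (borel G)) by exact: measurable_translate.
have AB : mu A = (1 - mu B)%E by rewrite /A probability_setC.
have := vA A mA; have Bn := fin_num_measure mu B mB.
have vAn := fin_num_measure mu _ mvA.
rewrite AB -(fineK Bn) -(fineK vAn) -EFinB -EFinD lee_fin => h.
have [x [nBx Ax]] : exists x, ~ B x /\ A (v * x)%g.
  apply: contrapT => nex.
  have sub' : [set x | A (v * x)%g] `<=` B.
    by move=> x Ax; apply: contrapT => nBx; apply: nex; exists x.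
  have : fine (mu [set x | A (v * x)%g]) <= fine (mu B).
    by apply: fine_le => //; apply: le_measure; rewrite ?inE.
  move: H h; rewrite /mass_above -/B; lra.
have /negP := nBx; rewrite -leNgt => px.
have /negP := Ax; rewrite -leNgt => pvx.
have -> : v = ((v * x) * x^-1)%g by rewrite mulgK.
apply: (le_trans (sub _ _)); rewrite inv; lra.
Qed.

(** A neighbourhood of s has positive mass, hence contains a point a where phi is
    at most t, and s^-1 a is close to 1. *)
Lemma controlled_support s : S s -> exists n, controlled n s.
Proof.
move=> Ss; have := controlled_near1.
rewrite /prop_near1 nbhsE => -[V [oV V1] VP].
pose W : set G := [set y | V (s^-1 * y)%g].
have oW : open W by apply: open_comp => // x _; exact: lmul_continuous.
have Ws : W s by rewrite /W /= mulVg.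
have mW := open_borel oW.
have W0 := suppS Ss oW Ws.
have Wn := fin_num_measure mu _ mW.
have w0 : 0 < fine (mu W) by rewrite fine_gt0// W0 ltey_eq Wn.
pose k := Num.truncn (1 / fine (mu W)).
have kw : k.+1%:R^-1 <= fine (mu W).
  by rewrite -[leLHS]mul1r ler_pdivrMr ?ltr0n// mulrC -ler_pdivrMr// ltW// truncnS_gt.
exists (maxn k 4) => phi t Hphi t0 H.
have [_ sub inv _] := Hphi.
have mB := above_measurable t Hphi.
have [a [Wa pa]] : exists a, W a /\ phi a <= t.
  apply: contrapT => nex.
  have sub' : W `<=` [set x | t < phi x].
    by move=> x Wx; rewrite /= ltNge; apply/negP => ?; apply: nex; exists x.
  have : fine (mu W) <= mass_above phi t.
    apply: fine_le => //; first exact: fin_num_measure.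
    by apply: le_measure; rewrite ?inE.
  rewrite leNgt => /negP; apply; apply: (lt_le_trans H); apply: le_trans kw.
  by rewrite lef_pV2 ?posrE ?ltr0n// ler_nat ltnS leq_maxl.
have -> : s = (a * (s^-1 * a)^-1)%g by rewrite invgM invgK mulVKg.
have pv : phi (s^-1 * a)%g <= 3%:R * t.
  apply: (VP _ Wa) => //; apply: (lt_le_trans H).
  by rewrite lef_pV2 ?posrE ?ltr0n// ler_nat ltnS (leq_trans _ (leq_maxr _ _)).
apply: (le_trans (sub _ _)); rewrite inv.
apply: (@le_trans _ _ (4%:R * t)); first lra.
by rewrite ler_wpM2r// ler_nat leq_maxr.
Qed.

Lemma controlled_all g : exists n, controlled n g.
Proof.
have [k] := genS g; elim: k g => [|k IH] g /=.
  by move=> ->; exists 3%N; exact: nbhs_singleton controlled_near1.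
move=> [s Ss [h Hh <-]]; have [n sn] := controlled_support Ss; have [m hm] := IH h Hh.
by exists (n + m)%N; exact: controlledM.
Qed.

Lemma controlled_compact (Q : set G) : compact Q ->
  exists n, forall g, Q g -> controlled n g.
Proof.
move=> /compact_near_coveringP cQ.
have [|N _ NP] := cQ nat \oo (fun n g => controlled n g).
  move=> g _; have [n ng] := controlled_all g.
  have h : \forall y \near g, controlled (n + 3) y.
    apply: lmul_near; apply: filterS controlled_near1 => v v3.
    exact: controlledM.
  exists ([set y | controlled (n + 3) y], [set m | (n + 3 <= m)%N]) => /=.
    by split=> //; exact: nbhs_infty_ge.
  by move=> [y m] [/= yn nm]; exact: controlled_mono yn.
by exists N => g Qg; exact: (NP N (leqnn N)).
Qed.

(** Markov's inequality bounds the mass above a level; the number of steps needed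
    to control the points of Q is bounded by compactness. *)
Lemma length_compact (p : R) (Q : set G) (e : R) : 0 < p -> compact Q -> 0 < e ->
  exists2 eta : R, 0 < eta & forall phi, length_fun phi ->
    mu.-integrable [set: borel G] (EFin \o (fun x => phi x `^ p)) ->
    \int[mu]_x (phi x `^ p) < eta -> forall g, Q g -> phi g <= e.
Proof.
move=> p0 cQ e0; have [n nP] := controlled_compact cQ.
pose t := e / n.+1%:R; have t0 : 0 < t by rewrite divr_gt0.
have tp : 0 < t `^ p by rewrite powR_gt0.
exists (t `^ p / n.+1%:R); first by rewrite divr_gt0.
move=> phi Hphi iphi Iphi g Qg.
have [_ _ _ phi0] := Hphi.
have mB := above_measurable t Hphi.
have Markov : t `^ p * mass_above phi t <= \int[mu]_x (phi x `^ p).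
  rewrite /mass_above -(rI_indic mu)// -rIZ; last exact: integrable_indic.
  apply: rI_le => //; first by apply: rintZ; exact: integrable_indic.
  move=> x; rewrite indicE; case: (boolP (x \in _)) => [|_]; last first.
    by rewrite mulr0 powR_ge0.
  rewrite inE /= mulr1 => tx; rewrite ge0_ler_powR ?nnegrE// ?(ltW p0) ?(ltW t0)//.
  exact: ltW.
apply: (@le_trans _ _ (n%:R * t)).
  apply: nP => //; first exact: ltW.
  by rewrite -(ltr_pM2l tp) (le_lt_trans Markov).
rewrite /t mulrCA ler_piMr ?(ltW e0)// ler_pdivrMr ?ltr0n// mul1r ler_nat//.
Qed.

End length_functions.

(** * Almost invariant vectors *)

Section rep_facts.
Context {R : realType} {G : topologicalGroupType} {E : normedModType R}
  (pi : G -> {linear E -> E}) (pi_rep : isometric_rep pi).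

Lemma rep1 v : pi 1%g v = v. Proof. by have [[]] := pi_rep. Qed.
Lemma repM g h v : pi (g * h)%g v = pi g (pi h v). Proof. by have [[]] := pi_rep. Qed.
Lemma rep_norm g v : `|pi g v| = `|v|. Proof. by have [] := pi_rep. Qed.
Lemma rep_invK g v : pi g^-1%g (pi g v) = v. Proof. by rewrite -repM mulVg rep1. Qed.
Lemma rep_dist g u v : `|pi g u - pi g v| = `|u - v|.
Proof. by rewrite -linearB rep_norm. Qed.

Lemma rep_continuous v : continuous (fun g => pi g v).
Proof.
move=> g; have [[_ _ c] _] := pi_rep.
have c1 : {for g, continuous (fun x : G => (x, v))}.
  by apply: cvg_pair => //; exact: cvg_cst.
exact: (@continuous_comp _ _ _ (fun x : G => (x, v)) (fun x : G * E => pi x.1 x.2) g c1 (c _)).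
Qed.

Lemma rep_displacement v : length_fun (fun g => `|pi g v - v|).
Proof.
split=> [g|g h|g|g]; last exact: normr_ge0.
- by apply: cvg_norm; apply: cvgB; [exact: rep_continuous|exact: cvg_cst].
- rewrite repM -(subrKA (pi g v)) addrC (le_trans (ler_normD _ _))//.
  by rewrite rep_dist.
- by rewrite -{2}(rep_invK g v) rep_dist distrC.
Qed.

Definition invariant (w : E) := forall g, pi g w = w.

End rep_facts.

Section mazur_rep.
Context {R : realType} {G : topologicalGroupType} {E : completeNormedModType R}
  (pi : G -> {linear E -> E}) (pi_rep : isometric_rep pi)
  (p : R) (p2 : 2 < p) (V : lmodType R) (B : V -> V -> R) (M : E -> V) (N : V -> E)
  (C : R) (C0 : 0 < C) (HM : mazur_map p B M N C).
Notation q := (seminorm B).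

Let p0 : 0 < p. Proof. exact: lt_trans p2. Qed.
Let HB : semi_inner B. Proof. by case: HM. Qed.
Let MN F : q (M (N F) - F) = 0. Proof. by case: HM. Qed.
Let lower u v : `|u - v| `^ p <= C * q (M u - M v) ^+ 2. Proof. by case: HM. Qed.
Let upper (A e : R) : 0 <= A -> 0 < e -> exists2 r : R, 0 < r &
  forall u v, `|u| `^ p <= A -> `|u - v| `^ p <= r -> q (M u - M v) <= e.
Proof. by case: HM => _ _ + _ _ => /(mazur_uniform p2 C0); apply. Qed.

Lemma mazur_inj u v : q (M u - M v) = 0 -> u = v.
Proof.
move=> uv; have := lower u v; rewrite uv expr0n mulr0 => h.
have /eqP : `|u - v| `^ p = 0 by apply/eqP; rewrite eq_le h powR_ge0.
by rewrite powR_eq0 normr_eq0 subr_eq0 => /andP[/eqP].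
Qed.

Lemma mazurK u : N (M u) = u.
Proof. by apply: mazur_inj; exact: MN. Qed.

Lemma norm_powR_near (e : R) : 0 < e -> exists2 d : R, 0 < d &
  forall x : E, `|x| < d -> `|x| `^ p <= e.
Proof.
move=> e0; exists (e `^ p^-1); first exact: powR_gt0.
move=> x xd; have -> : e = (e `^ p^-1) `^ p.
  by rewrite -powRrM mulVf ?gt_eqF// powRr1// ltW.
by apply: ge0_ler_powR; rewrite ?nnegrE ?powR_ge0 ?(ltW p0) ?(ltW xd).
Qed.

Lemma mazur_semi_complete : semi_complete B.
Proof.
move=> x xc; have [e e0|l lP] := @banach_seq_complete R E (fun n => N (x n)).
  have ep : 0 < e `^ p by rewrite powR_gt0.
  have r0 : 0 < Num.sqrt (e `^ p / C) by rewrite sqrtr_gt0 divr_gt0.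
  have [n nP] := xc _ r0; exists n => i j ni nj.
  have h := lower (N (x i)) (N (x j)).
  rewrite ltNge; apply/negP => ee.
  have h2 : e `^ p <= `|N (x i) - N (x j)| `^ p.
    by rewrite ge0_ler_powR ?nnegrE ?(ltW p0) ?(ltW e0).
  have h3 : q (M (N (x i)) - M (N (x j))) <= q (x i - x j).
    have /(le_trans (ler_norm _)) := seminorm_quad HB (M (N (x i))) (M (N (x j))) (x i) (x j).
    by rewrite !MN addr0 subr_le0.
  have h4 := le_lt_trans h3 (nP i j ni nj).
  have h5 : q (M (N (x i)) - M (N (x j))) ^+ 2 < e `^ p / C.
    rewrite -[ltRHS]sqr_sqrtr ?ltW ?divr_gt0//.
    by rewrite ltr_pXn2r// nnegrE ?seminorm_ge0// ltW.
  have := le_trans h2 h; rewrite leNgt => /negP; apply.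
  by rewrite mulrC -ltr_pdivlMr.
exists (M l) => e e0; have e20 : 0 < e / 2 by rewrite divr_gt0.
have [r r0 rP] := upper (powR_ge0 `|l| p) e20.
have [d d0 dP] := norm_powR_near r0.
have [n nP] := lP d d0; exists n => i ni.
apply: (le_lt_trans (seminorm_trans HB (M (N (x i))) _ _)).
rewrite seminormB// MN add0r seminormB//; apply: (@le_lt_trans _ _ (e / 2)).
  by apply: rP => //; apply: dP; rewrite distrC; exact: nP.
by rewrite ltr_pdivrMr// mulr_natr mulr2n ltrDl.
Qed.

(** The conjugate of pi by the Mazur map, which preserves the form B and is
    therefore linear up to null vectors. *)
Definition mazur_rep (g : G) (F : V) : V := M (pi g (N F)).

Lemma mazur_rep_semi_rep : semi_rep B mazur_rep.
Proof.
split.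
- move=> g x y; have [_ _ _ _ iso] := HM.
  rewrite /mazur_rep iso; last by move=> u; exact: rep_norm.
  exact: (sip_null_congr HB).
- move=> g h x; rewrite /mazur_rep mazurK (repM pi_rep) subrr; exact: seminorm0.
- by move=> x; rewrite /mazur_rep (rep1 pi_rep).
- move=> x g0 e e0; have e20 : 0 < e / 2 by rewrite divr_gt0.
  have [r r0 rP] := upper (powR_ge0 `|N x| p) e20.
  have [d d0 dP] := norm_powR_near r0.
  have /cvgrPdist_lt/(_ d d0) := @rep_continuous _ _ _ pi pi_rep (N x) g0.
  apply: filterS => g gd; rewrite seminormB//; apply: (@le_lt_trans _ _ (e / 2)).
    by apply: rP; [rewrite rep_norm|exact: dP].
  by rewrite ltr_pdivrMr// mulr_natr mulr2n ltrDl.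
Qed.

End mazur_rep.

(** Property (T) acts on the Mazur image of E in a Hilbert space; uniform
    continuity of the Mazur map and of its inverse carries the conclusion back
    to E. *)
Lemma propertyT_almost_invariant {R : realType} {G : topologicalGroupType}
    (E : completeNormedModType R) (pi : G -> {linear E -> E}) (p e : R) :
  propertyT R G -> isometric_rep pi -> 2 < p -> Lp_space p E -> 0 < e ->
  exists (Q : set G) (d : R), [/\ compact Q, 0 < d & forall u, `|u| = 1 ->
    (forall g, Q g -> `|pi g u - u| <= d) ->
    exists2 w, invariant pi w & `|u - w| < e].
Proof.
move=> TG pi_rep p2 LpE e0; have p0 : 0 < p by exact: lt_trans p2.
have [V [B [M [N [C [C0 HM]]]]]] := Lp_space_mazur p2 LpE.
have [HB MN up low _] := HM.
have [Q [K [cQ K0 QP]]] := propertyT_close_invariant TG.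
have [HBc Hrep] := (mazur_semi_complete p2 C0 HM, mazur_rep_semi_rep pi_rep p2 C0 HM).
(* A Hilbert distance K d becomes, by [low], a distance less than e in E. *)
have [d d0 dP] : exists2 d : R, 0 < d & C * (K * d) ^+ 2 < e `^ p.
  have ep : 0 < e `^ p / C by rewrite divr_gt0// powR_gt0.
  exists (Num.sqrt (e `^ p / C) / (K * 2)); first by apply: divr_gt0; [rewrite sqrtr_gt0|exact: mulr_gt0].
  have -> : K * (Num.sqrt (e `^ p / C) / (K * 2)) = Num.sqrt (e `^ p / C) / 2.
    by field; rewrite gt_eqF.
  rewrite expr_div_n sqr_sqrtr ?ltW// mulrC -ltr_pdivlMr//.
  by rewrite ltr_pdivrMr// ltr_pMr// expr2; lra.
have [r r0 rP] := mazur_uniform p2 C0 up ler01 d0.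
exists Q, (r `^ p^-1); split=> [//||u u1 uQ]; first exact: powR_gt0.
have [|g Qg|x0 x0P x0d] := QP V B (mazur_rep pi M N) HB HBc Hrep (M u) d.
- exact: ltW.
- rewrite /mazur_rep (mazurK HM) seminormB//; apply: rP; first by rewrite u1 powR1.
  have -> : r = (r `^ p^-1) `^ p by rewrite -powRrM mulVf ?gt_eqF// powRr1// ltW.
  by rewrite ge0_ler_powR ?nnegrE ?powR_ge0 ?(ltW p0)// distrC uQ.
exists (N x0).
  move=> g; apply: (mazur_inj HM); apply/eqP; rewrite eq_le seminorm_ge0 andbT.
  apply: (le_trans (seminorm_trans HB x0 _ _)).
  by rewrite -/(mazur_rep pi M N g x0) x0P add0r seminormB// MN.
have h : `|u - N x0| `^ p < e `^ p.
  apply: (le_lt_trans (low _ _)); apply: le_lt_trans dP.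
  rewrite ler_pM2l// ler_pXn2r// ?nnegrE ?seminorm_ge0 ?(ltW (mulr_gt0 K0 d0))//.
  apply: (le_trans (seminorm_trans HB x0 _ _)).
  by rewrite [X in _ + X](seminormB HB) MN addr0.
rewrite ltNge; apply/negP => h2; move: h; rewrite ltNge => /negP; apply.
by rewrite ge0_ler_powR ?nnegrE ?(ltW p0) ?(ltW e0).
Qed.

(** * Spectral gap and harmonic representatives *)

Section symmetric_measure.
Context {R : realType} {G : topologicalGroupType} (mu : probability (borel G) R)
  (muV : forall A : set (borel G), measurable A -> mu [set (x^-1)%g | x in A] = mu A).
Notation rint f := (mu.-integrable [set: borel G] (EFin \o f)).

Lemma integral_invg (F : borel G -> \bar R) : measurable_fun setT F ->
  (\int[mu]_x F (x^-1)%g = \int[mu]_x F x)%E.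
Proof.
move=> mF.
have muE A : measurable A -> pushforward mu (fun x : borel G => (x^-1)%g : borel G) A = mu A.
  move=> mA; rewrite -(muV mA); congr (mu _); apply/seteqP; split=> x.
    by move=> Ax; exists (x^-1)%g => //; rewrite invgK.
  by move=> [y Ay <-]; rewrite /= invgK.
have mi := @measurable_invg G.
have H (f : borel G -> \bar R) : measurable_fun setT f -> (forall x, 0 <= f x)%E ->
    (\int[mu]_x f (x^-1)%g = \int[mu]_x f x)%E.
  move=> mf f0.
  have := @ge0_integral_pushforward _ _ (borel G) (borel G) R
    (fun x : borel G => (x^-1)%g : borel G) mi mu setT f measurableT mf (fun x _ => f0 x).
  rewrite preimage_setT => <-.
  exact: integral_set_function.
rewrite integralE [RHS]integralE; congr (_ - _)%E.
  have -> : (fun x : borel G => F x^-1%g)^\+%E = (fun x : borel G => F^\+%E (x^-1)%g).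
    by apply/funext => x; rewrite !funeposE.
  by apply: H => //; exact: measurable_funepos.
have -> : (fun x : borel G => F x^-1%g)^\-%E = (fun x : borel G => F^\-%E (x^-1)%g).
  by apply/funext => x; rewrite !funenegE.
by apply: H => //; exact: measurable_funeneg.
Qed.

Lemma rI_invg (f : borel G -> R) : measurable_fun setT f ->
  \int[mu]_x f (x^-1)%g = \int[mu]_x f x.
Proof. by move=> mf; congr fine; apply: integral_invg; exact/measurable_EFinP. Qed.

Lemma rint_invg (f : borel G -> R) : rint f -> rint (fun x => f (x^-1)%g).
Proof.
move=> fi; have mf := measurable_int _ fi; apply/integrableP; split.
  exact: (measurableT_comp mf (@measurable_invg G)).
rewrite (@integral_invg (fun x => `|(EFin \o f) x|%E)).
  by have /integrableP[] := fi.
exact: (measurableT_comp _ mf).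
Qed.

Lemma rI_cst_probability (a : R) : \int[mu]_x a = a.
Proof. by rewrite Rintegral_cst// [X in fine X](@probability_setT _ _ _ mu) mulr1. Qed.

Lemma rint_cst_probability (a : R) : rint (fun=> a).
Proof. exact: finite_measure_integrable_cst. Qed.

Lemma rint_bounded_continuous (f : G -> R) (C : R) : continuous f ->
  (forall x, `|f x| <= C) -> rint f.
Proof.
move=> cf fC; apply: (@rint_dom _ (borel G) _ mu f (fun=> C)) => //.
- exact: continuous_real_borel.
- exact: rint_cst_probability.
Qed.

End symmetric_measure.

Section harmonic.
Context {R : realType} {G : topologicalGroupType} (mu : probability (borel G) R)
  (muV : forall A : set (borel G), measurable A -> mu [set (x^-1)%g | x in A] = mu A)
  (mut : translation_cont mu) (S : set G) (genS : generating S)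
  (suppS : S `<=` msupport mu) (TG : propertyT R G)
  {E : completeNormedModType R} (sepE : separable_space E)
  (p : R) (p2 : 2 < p) (LpE : Lp_space p E)
  (D : E -> E -> R) (c C : R) (c0 : 0 < c) (C0 : 0 < C) (HD : duality_map p D c C)
  (pi : G -> {linear E -> E}) (pi_rep : isometric_rep pi).
Notation rint f := (mu.-integrable [set: borel G] (EFin \o f)).

Let p0 : 0 < p. Proof. exact: lt_trans p2. Qed.
Let p1 : 1 < p. Proof. by apply: lt_trans p2; rewrite ltr1n. Qed.
Let Dlin x a y z : D x (a *: y + z) = a * D x y + D x z. Proof. by case: HD. Qed.
Let Dself x : D x x = `|x| `^ p. Proof. by case: HD. Qed.
Let Dbound x y : `|D x y| <= 2 * `|x| `^ (p - 1) * `|y|. Proof. by case: HD. Qed.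
Let Dconv x y : `|x| `^ p + p * D x y + c * `|y| `^ p <= `|x + y| `^ p.
Proof. by case: HD. Qed.
Let DB w : bounded_linear (D w) (2 * `|w| `^ (p - 1)). Proof. by split. Qed.

(** A substitute for the orthogonal complement of the invariant vectors. *)
Definition coinvariant (u : E) := forall w, invariant pi w -> D w u = 0.

Lemma coinvariantP a u v : coinvariant u -> coinvariant v -> coinvariant (a *: u + v).
Proof. by move=> cu cv w iw; rewrite Dlin cu// cv// mulr0 addr0. Qed.

(** By D w w = |w|^p the norm of w is at most 2 |u - w|. *)
Lemma coinvariant_dist u w : coinvariant u -> invariant pi w -> `|u| <= 3 * `|u - w|.
Proof.
move=> cu iw; have [->|w0] := eqVneq w 0.
  by rewrite subr0 ler_peMl// ler1n.
have wp : 0 < `|w| `^ (p - 1) by apply: powR_gt0; rewrite normr_gt0.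
have h : `|w| <= 2 * `|u - w|.
  rewrite -(ler_pM2l wp) mulrC mulr_powRB1//.
  have -> : `|w| `^ p = - D w (u - w).
    by rewrite (bounded_linearB _ _ (DB w)) cu// Dself sub0r opprK.
  apply: (le_trans (ler_norm _)); rewrite normrN.
  by apply: (le_trans (Dbound _ _)); rewrite -mulrA mulrCA.
have := ler_normD (u - w) w; rewrite subrK => h2.
apply: (le_trans h2); lra.
Qed.

Lemma rint_displacement u : rint (fun x => `|pi x u - u| `^ p).
Proof.
apply: (@rint_dom _ (borel G) _ mu (fun x => `|pi x u - u| `^ p) (fun=> (2 * `|u|) `^ p)).
- apply: (measurableT_comp (measurable_powR _)).
  by have [cu _ _ _] := rep_displacement pi_rep u; exact: (continuous_real_borel cu).
- exact: rint_cst_probability.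
- move=> x; rewrite ger0_norm ?powR_ge0//; apply: ge0_ler_powR; rewrite ?nnegrE ?(ltW p0)//.
  by rewrite (le_trans (ler_normB _ _))// (rep_norm pi_rep) mulr_natl mulr2n.
Qed.

(** A unit vector with small mean displacement is moved little by the compact set
    of property (T), hence is close to an invariant vector, which
    [coinvariant_dist] forbids. *)
Lemma displacement_gap : exists2 eta : R, 0 < eta & forall u, coinvariant u ->
  eta * `|u| `^ p <= \int[mu]_x (`|pi x u - u| `^ p).
Proof.
have e0 : 0 < 4^-1 :> R by rewrite invr_gt0.
have [Q [d [cQ d0 QP]]] := propertyT_almost_invariant TG pi_rep p2 LpE e0.
have [eta eta0 etaP] := length_compact mut genS suppS p0 cQ d0.
exists eta => // u cu; have [->|u0] := eqVneq u 0.
  rewrite normr0 powR0 ?gt_eqF// mulr0; apply: rI_ge0 => x.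
  exact: powR_ge0.
have n0 : 0 < `|u| by rewrite normr_gt0.
pose w := `|u|^-1 *: u.
have w1 : `|w| = 1 by rewrite /w normrZ normfV normr_id mulVf// gt_eqF.
have cw : coinvariant w.
  have -> : w = `|u|^-1 *: u + 0 by rewrite addr0.
  by apply: coinvariantP => // z _; rewrite (bounded_linear0 (DB z)).
have wd x : `|pi x w - w| = `|u|^-1 * `|pi x u - u|.
  by rewrite /w linearZ -scalerBr normrZ normfV normr_id.
have h : eta <= \int[mu]_x (`|pi x w - w| `^ p).
  rewrite leNgt; apply/negP => h.
  have [g Qg|z iz wz] := QP w w1.
    exact: (etaP _ (rep_displacement pi_rep w) (rint_displacement w) h g Qg).
  have := coinvariant_dist cw iz; rewrite w1.
  by move: wz; set a := `|_|; lra.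
apply: (@le_trans _ _ ((\int[mu]_x (`|pi x w - w| `^ p)) * `|u| `^ p)).
  by rewrite ler_wpM2r// powR_ge0.
rewrite mulrC -rIZ; last exact: rint_displacement.
under eq_Rintegral do rewrite wd powRM ?invr_ge0// mulrA -powRM ?invr_ge0// divff ?gt_eqF// powR1 mul1r.
by [].
Qed.

Lemma average_exists u : exists z, forall L K, bounded_linear L K ->
  L z = \int[mu]_x L (pi x u).
Proof.
have cu := @rep_continuous _ _ _ pi pi_rep u.
apply: (barycenter sepE p1 Dlin Dself Dbound cu).
apply: rint_bounded_continuous.
  by move=> x; apply: cvg_norm; exact: cu.
by move=> x; rewrite normr_id (rep_norm pi_rep).
Qed.

Definition average u := projT1 (cid (average_exists u)).

Lemma averageE u L K : bounded_linear L K -> L (average u) = \int[mu]_x L (pi x u).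
Proof. by rewrite /average; case: cid => z /= zP; exact: zP. Qed.

Lemma rint_rep u L K : bounded_linear L K -> rint (fun x => L (pi x u)).
Proof.
move=> LK; apply: (@rint_bounded_continuous _ _ mu (fun x => L (pi x u)) (K * `|u|)).
  exact: (bounded_linear_continuous LK (@rep_continuous _ _ _ pi pi_rep u)).
by move=> x; case: LK => _ /(_ (pi x u)); rewrite (rep_norm pi_rep).
Qed.

Lemma average_linear a u v : average (a *: u + v) = a *: average u + average v.
Proof.
apply: (barycenter_unique Dlin Dself) => w.
rewrite Dlin !(averageE _ (DB w)).
under eq_Rintegral do rewrite linearP Dlin.
rewrite rID.
- by rewrite rIZ//; exact: rint_rep (DB w).
- by apply: rintZ; exact: rint_rep (DB w).
- exact: rint_rep (DB w).
Qed.

(** D w (pi x u) = D (pi x w) (pi x u) = D w u for invariant w. *)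
Lemma average_coinvariant u : coinvariant u -> coinvariant (average u).
Proof.
move=> cu w iw; rewrite (averageE _ (DB w)).
under eq_Rintegral => x _.
  rewrite -{1}(iw x) (duality_isometry p2 c0 C0 HD (rep_norm pi_rep x)) cu//.
  over.
exact: rI_cst_probability.
Qed.

Lemma half_double (v : E) : 2^-1 *: (v + v) = v.
Proof.
rewrite scalerDr -scalerDl; have -> : 2^-1 + 2^-1 = 1 :> R by field.
by rewrite scale1r.
Qed.

Definition half_average u := 2^-1 *: (u + average u).

(** Uniform convexity: the average of the vectors (u + pi x u) / 2, each shorter
    than u by an amount that grows with the displacement of u by x. *)
Lemma half_average_displacement u : `|half_average u| `^ p +
  c * 2 `^ (- p) * \int[mu]_x (`|pi x u - u| `^ p) <= `|u| `^ p.
Proof.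
set y := half_average u.
pose k x := D y (pi x u) - D y (average u).
have pt x : p / 2 * k x + c * 2 `^ (- p) * `|pi x u - u| `^ p <= `|u| `^ p - `|y| `^ p.
  pose m := 2^-1 *: (u + pi x u); pose h := 2^-1 *: (u - pi x u).
  have h1 : m + h = u by rewrite /m /h -scalerDr addrACA addrN addr0 half_double.
  have h2 : m - h = pi x u by rewrite /m /h -scalerBr opprB [u + _]addrC addrACA addrN addr0 half_double.
  have := Dconv m h; have := Dconv m (- h); rewrite h1 h2 (rep_norm pi_rep) normrN.
  have -> : D m (- h) = - D m h.
    by rewrite -[- h]sub0r (bounded_linearB _ _ (DB _)) (bounded_linear0 (DB _)) sub0r.
  have -> : `|h| `^ p = 2 `^ (- p) * `|pi x u - u| `^ p.
    rewrite /h normrZ distrC powRM// normfV ger0_norm//; congr (_ * _).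
    by rewrite -powR_inv1// -powRrM mulN1r.
  have := Dconv y (m - y); rewrite [y + _]addrC subrK.
  have -> : D y (m - y) = 2^-1 * k x.
    have -> : m - y = 2^-1 *: (pi x u - average u) + 0.
      by rewrite addr0 /y /half_average -scalerBr opprD addrACA addrN add0r.
    by rewrite Dlin (bounded_linear0 (DB _)) addr0 (bounded_linearB _ _ (DB _)).
  have := mulr_ge0 (ltW c0) (powR_ge0 `|m - y| p).
  move: (`|y| `^ p) (`|u| `^ p) (`|m| `^ p) (k x) (D m h) (2 `^ (- p)) (`|pi x u - u| `^ p) (c * `|m - y| `^ p) => a1 a2 a3 a4 a5 a6 a7 a8.
  rewrite -[c * a6 * a7]mulrA; move: (c * (a6 * a7)) => a9.
  have -> : p * (2^-1 * a4) = p / 2 * a4 by rewrite mulrA.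
  rewrite mulrN; move: (p / 2 * a4) (p * a5) => a10 a11; lra.
have ik : rint k.
  by apply: rintB; [exact: rint_rep (DB y)|exact: rint_cst_probability].
have Ik : \int[mu]_x k x = 0.
  rewrite rIB.
  - by rewrite rI_cst_probability -(averageE _ (DB y)) subrr.
  - exact: rint_rep (DB y).
  - exact: rint_cst_probability.
have id := rint_displacement u.
rewrite addrC -lerBrDr.
apply: le_trans (_ : \int[mu]_x (p / 2 * k x + c * 2 `^ (- p) * `|pi x u - u| `^ p) <= _).
  rewrite rID.
  - rewrite rIZ// Ik mulr0 add0r.
    by rewrite rIZ.
  - exact: rintZ.
  - exact: rintZ.
rewrite -[leRHS](rI_cst_probability mu); apply: rI_le => //.
- apply: rintD; first exact: rintZ.
  exact: rintZ.
- exact: rint_cst_probability.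
Qed.

Lemma powR_le_inv (x y : R) : 0 <= x -> 0 <= y -> x `^ p <= y `^ p -> x <= y.
Proof.
move=> x0 y0; rewrite !leNgt; apply: contra => yx.
by apply: gt0_ltr_powR => //; rewrite nnegrE.
Qed.

Lemma half_average_le u : `|half_average u| <= `|u|.
Proof.
apply: powR_le_inv => //; apply: le_trans (half_average_displacement u).
rewrite lerDl mulr_ge0// ?(mulr_ge0 (ltW c0)) ?powR_ge0//.
by apply: rI_ge0 => x; exact: powR_ge0.
Qed.

Lemma half_average_contraction : exists2 k : R, 0 <= k < 1 &
  forall u, coinvariant u -> `|half_average u| <= k * `|u|.
Proof.
have [eta eta0 etaP] := displacement_gap.
pose t := Num.max 0 (1 - c * 2 `^ (- p) * eta).
have t0 : 0 <= t by rewrite le_max lexx.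
have t1 : t < 1.
  by rewrite gt_max ltr01 gtrBl mulr_gt0 ?mulr_gt0// powR_gt0.
exists (t `^ p^-1).
  have e1 : 1 `^ p^-1 = 1 :> R by rewrite powR1.
  rewrite powR_ge0 /= -[ltRHS]e1.
  by apply: gt0_ltr_powR => //; rewrite ?invr_gt0// nnegrE.
move=> u cu; apply: powR_le_inv => //; first by rewrite mulr_ge0// powR_ge0.
rewrite powRM ?powR_ge0// -powRrM mulVf ?gt_eqF// powRr1//.
have h1 := half_average_displacement u.
have h2 : c * 2 `^ (- p) * (eta * `|u| `^ p) <= c * 2 `^ (- p) * \int[mu]_x (`|pi x u - u| `^ p).
  by rewrite ler_wpM2l ?etaP// mulr_ge0 ?powR_ge0// ltW.
apply: (@le_trans _ _ ((1 - c * 2 `^ (- p) * eta) * `|u| `^ p)).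
  rewrite mulrBl mul1r -mulrA lerBrDr; apply: le_trans h1.
  by rewrite lerD2l !mulrA; move: h2; rewrite !mulrA.
by rewrite ler_wpM2r ?powR_ge0// le_max lexx orbT.
Qed.

Lemma half_average_linear a u v :
  half_average (a *: u + v) = a *: half_average u + half_average v.
Proof.
by rewrite /half_average average_linear addrACA -[a *: u + _]scalerDr [LHS]scalerDr !scalerA [a * _]mulrC.
Qed.

Lemma half_average_coinvariant u : coinvariant u -> coinvariant (half_average u).
Proof.
move=> cu; have -> : half_average u = 2^-1 *: (1 *: u + average u) + 0.
  by rewrite scale1r addr0.
apply: coinvariantP; first by apply: coinvariantP => //; exact: average_coinvariant.
by move=> w _; exact: bounded_linear0 (DB w).
Qed.

(** The Neumann series of [half_average], since 1 - average is twice
    1 - half_average. *)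
Lemma average_solve z : coinvariant z -> exists v, v - average v = z.
Proof.
move=> cz; have [k /andP[k0 k1] kP] := half_average_contraction.
pose z2 := 2^-1 *: z.
have cz2 : coinvariant z2.
  have -> : z2 = 2^-1 *: z + 0 by rewrite addr0.
  by apply: coinvariantP => // w _; exact: bounded_linear0 (DB w).
pose u n := iter n half_average z2.
have cu n : coinvariant (u n) by elim: n => //= n IH; exact: half_average_coinvariant.
have ub n : `|u n| <= geometric `|z2| k n.
  rewrite /geometric /=; elim: n => [|n IH]; first by rewrite expr0 mulr1.
  by rewrite exprS mulrCA (le_trans (kP _ (cu n)))// ler_wpM2l.
have scv : cvg (series u @ \oo).
  apply: normed_cvg; apply: (series_le_cvg _ _ ub) => [n|n|].
  - exact: normr_ge0.
  - by rewrite /geometric/= mulr_ge0// exprn_ge0.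
  - by apply: is_cvg_geometric_series; rewrite ger0_norm.
have h0 : half_average 0 = 0.
  by apply/eqP; rewrite -normr_le0; apply: le_trans (half_average_le 0) _; rewrite normr0.
have sS n : series u n.+1 = half_average (series u n) + z2.
  elim: n => [|n IH]; first by rewrite /series /= big_nat1 big_geq// h0 add0r.
  have hD x y : half_average (x + y) = half_average x + half_average y.
    by rewrite -[x]scale1r half_average_linear !scale1r.
  by rewrite [LHS]seriesSr [in LHS]IH [in RHS]seriesSr hD addrAC.
set v := lim (series u @ \oo) in scv *; exists v.
suff vE : v = half_average v + z2.
  apply: (@scalerI _ _ 2^-1); first by rewrite invr_eq0 pnatr_eq0.
  rewrite scalerBr -/z2.
  have : v - half_average v = z2 by rewrite {1}vE addrC addKr.
  move=> <-; rewrite /half_average scalerDr opprD addrA; congr (_ - _).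
  by apply/eqP; rewrite eq_sym subr_eq -scalerDr half_double.
apply/eqP; rewrite -subr_eq0 -normr_le0; apply/ler_addgt0Pr => e e0; rewrite add0r.
have e20 : 0 < e / 2 by rewrite divr_gt0.
move: scv => /cvgrPdist_lt/(_ _ e20)[n _ nP].
have := nP n (leqnn n); have := nP n.+1 (leqnSn n); rewrite /= sS => a1 a2.
rewrite -(subrKA (half_average (series u n) + z2)) (le_trans (ler_normD _ _))//.
rewrite [e]splitr lerD// ?(ltW a1)//.
rewrite opprD addrACA subrr addr0.
have -> : half_average (series u n) - half_average v = half_average (series u n - v).
  by rewrite [in RHS]addrC -[- v]scaleN1r half_average_linear scaleN1r addrC.
by rewrite (le_trans (half_average_le _))// distrC ltW.
Qed.

Variables (b : G -> E) (Z1b : Z1 pi b) (ib : rint (fun x => `|b x|)).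

(** For an invariant w, the coordinate D w of a cocycle is a homomorphism to the
    reals, whose mean vanishes by symmetry of mu. *)
Lemma cocycle_mean_coinvariant z :
  (forall L K, bounded_linear L K -> L z = \int[mu]_x L (b x)) -> coinvariant z.
Proof.
have [cb bM] := Z1b; move=> zP w iw; rewrite (zP _ _ (DB w)).
have b1 : b 1%g = 0.
  by have := bM 1%g 1%g; rewrite mulg1 (rep1 pi_rep) -{1}[b 1%g]addr0 => /addrI.
have Vb x : D w (b (x^-1)%g) = - D w (b x).
  have := bM x (x^-1)%g; rewrite mulgV b1 => /esym bx.
  have : D w (1 *: b x + pi x (b (x^-1)%g)) = 0.
    by rewrite scale1r bx (bounded_linear0 (DB w)).
  rewrite Dlin mul1r -{2}(iw x) (duality_isometry p2 c0 C0 HD (rep_norm pi_rep x)).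
  by move/eqP; rewrite addr_eq0 => /eqP->; rewrite opprK.
have mD := continuous_real_borel (bounded_linear_continuous (DB w) cb).
have iD : rint (fun x => D w (b x)) := bounded_linear_rint cb ib (DB w).
have := rI_invg muV mD; under eq_Rintegral do rewrite Vb -mulN1r.
by rewrite rIZ// mulN1r => h; lra.
Qed.

(** The coboundary to subtract solves v - A v = z for z the mean of b and A the
    averaging operator. *)
Lemma harmonic_representative : exists v, forall L K, bounded_linear L K ->
  \int[mu]_x L (b x - (v - pi x v)) = 0.
Proof.
have [cb bM] := Z1b.
have [z zP] := barycenter sepE p1 Dlin Dself Dbound cb ib.
have [v vz] := average_solve (cocycle_mean_coinvariant zP).
exists v => L K LK; have iL := bounded_linear_rint cb ib LK.
under eq_Rintegral do rewrite !(bounded_linearB _ _ LK).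
rewrite rIB//.
  rewrite rIB//.
  - by rewrite rI_cst_probability -(zP _ _ LK) -(averageE _ LK) -vz (bounded_linearB _ _ LK) subrr.
  - exact: rint_cst_probability.
  - exact: rint_rep LK.
by apply: rintB; [exact: rint_cst_probability|exact: rint_rep LK].
Qed.

End harmonic.

(** * Moments of cocycles along convolution powers *)

Section cocycle_norm.
Context {R : realType} {G : topologicalGroupType} {E : normedModType R}
  (pi : G -> {linear E -> E}) (pi_rep : isometric_rep pi)
  (b : G -> E) (Z1b : Z1 pi b).

Lemma cocycle_continuous : continuous b. Proof. by case: Z1b. Qed.

Lemma cocycleM g h : b (g * h)%g = b g + pi g (b h). Proof. by case: Z1b. Qed.

Lemma cocycle1 : b 1%g = 0.
Proof. by have := cocycleM 1%g 1%g; rewrite mulg1 (rep1 pi_rep) -{1}[b 1%g]addr0 => /addrI. Qed.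

Lemma cocycleV g : pi g (b g^-1%g) = - b g.
Proof. by apply/eqP; rewrite -subr_eq0 opprK addrC -cocycleM mulgV cocycle1. Qed.

Lemma norm_cocycleM g h : `|b (g * h)%g| = `|b h - b g^-1%g|.
Proof. by rewrite -(rep_norm pi_rep g (b h - _)) linearB cocycleV opprK addrC -cocycleM. Qed.

Lemma norm_cocycleV g : `|b g^-1%g| = `|b g|.
Proof. by rewrite -(rep_norm pi_rep g) cocycleV normrN. Qed.

Lemma cocycle_length : length_fun (fun g => `|b g|).
Proof.
split=> [g|g h|g|g]; last exact: normr_ge0.
- by apply: cvg_norm; exact: cocycle_continuous.
- by rewrite cocycleM (le_trans (ler_normD _ _))// (rep_norm pi_rep).
- exact: norm_cocycleV.
Qed.

Lemma cocycle_sub_coboundary v : Z1 pi (fun g => b g - (v - pi g v)).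
Proof.
split=> [g|g h].
  apply: cvgB; first exact: cocycle_continuous.
  by apply: cvgB; [exact: cvg_cst|exact: rep_continuous].
have L x y : pi g (x - y) = pi g x - pi g y by exact: linearB.
rewrite cocycleM !L (repM pi_rep).
by rewrite !opprB [RHS]addrACA; congr (_ + _); rewrite [RHS]addrC subrKA.
Qed.

Lemma measurable_cocycle_power (p : R) : measurable_fun [set: borel G] (fun g : borel G => `|b g| `^ p).
Proof.
apply: (measurableT_comp (measurable_powR _)).
by have [cb _ _ _] := cocycle_length; exact: continuous_real_borel.
Qed.

End cocycle_norm.

(** The hypotheses on nu are those that [convolution_powers] provides. *)
Section convolution_moments.
Context {R : realType} {G : topologicalGroupType} (mu : probability (borel G) R)
  (nu : nat -> {measure set (borel G) -> \bar R}).
Hypothesis nuT : forall n, nu n setT = 1%E.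
Hypothesis nu0 : forall F : borel G -> \bar R, measurable_fun setT F ->
  (forall x, 0 <= F x)%E -> (\int[nu 0%N]_x F x = F 1%g)%E.
Hypothesis nuS : forall n (F : borel G -> \bar R), measurable_fun setT F ->
  (forall x, 0 <= F x)%E ->
  measurable_fun setT (fun x : borel G => \int[nu n]_y F (x * y)%g)%E /\
  (\int[nu n.+1]_x F x = \int[mu]_x \int[nu n]_y F (x * y)%g)%E.
Notation rint m f := ((m : set (borel G) -> \bar R).-integrable [set: borel G] (EFin \o f)).

Lemma measurable_fun_lmul (F : borel G -> \bar R) (x : G) : measurable_fun setT F ->
  measurable_fun setT (fun y : borel G => F (x * y)%g).
Proof. by move=> mF; exact: (measurableT_comp mF (measurable_lmul x)). Qed.

Lemma conv_integral1 (F : borel G -> \bar R) : measurable_fun setT F ->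
  (forall x, 0 <= F x)%E -> (\int[nu 1%N]_x F x = \int[mu]_x F x)%E.
Proof.
move=> mF F0; have [_ ->] := nuS 0 mF F0.
apply: eq_integral => x _; rewrite nu0 ?mulg1//; exact: measurable_fun_lmul.
Qed.

Lemma conv_integralD m n (F : borel G -> \bar R) : measurable_fun setT F ->
  (forall x, 0 <= F x)%E ->
  (\int[nu (m + n)%N]_x F x = \int[nu m]_x \int[nu n]_y F (x * y)%g)%E.
Proof.
elim: m F => [|m IH] F mF F0.
  have [mI _] := nuS n mF F0.
  rewrite add0n nu0//; last by move=> x; apply: integral_ge0.
  by apply: eq_integral => y _; rewrite mul1g.
have [mI _] := nuS n mF F0.
have I0 (x : borel G) : (0 <= \int[nu n]_y F (x * y)%g)%E by apply: integral_ge0.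
rewrite addSn; have [_ ->] := nuS (m + n) mF F0; have [_ ->] := nuS m mI I0.
apply: eq_integral => x _; rewrite IH//; last exact: measurable_fun_lmul.
by apply: eq_integral => y _; apply: eq_integral => z _; rewrite mulgA.
Qed.

Lemma rint_unit_cst n (a : R) : rint (nu n) (fun=> a).
Proof.
apply/integrableP; split; first exact: measurable_cst.
by rewrite /= integral_cst//= nuT mule1 ltry.
Qed.

Lemma rI_unit_cst n (a : R) : \int[nu n]_x a = a.
Proof. by rewrite Rintegral_cst// nuT mulr1. Qed.

Variables (E : normedModType R) (pi : G -> {linear E -> E}) (pi_rep : isometric_rep pi)
  (b : G -> E) (Z1b : Z1 pi b) (p : R) (p1 : 1 < p).
Hypothesis ib : rint mu (fun x => `|b x| `^ p).
Definition moment n : R := \int[nu n]_x (`|b x| `^ p).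

Let p0 : 0 < p. Proof. exact: lt_trans p1. Qed.
Let mb := measurable_cocycle_power pi_rep Z1b p.
Let mbE : measurable_fun [set: borel G] (EFin \o (fun g : borel G => `|b g| `^ p)).
Proof. exact/measurable_EFinP. Qed.
Let bE0 (x : borel G) : (0 <= (`|b x| `^ p)%:E)%E.
Proof. by rewrite lee_fin powR_ge0. Qed.

Lemma moment_ge0 n : 0 <= moment n.
Proof. by apply: rI_ge0 => x; exact: powR_ge0. Qed.

Lemma rint_power (m : {measure set (borel G) -> \bar R}) :
  (\int[m]_x (`|b x| `^ p)%:E < +oo)%E -> rint m (fun x => `|b x| `^ p).
Proof.
move=> h; apply/integrableP; split; first exact: mbE.
by under eq_integral => x _ do rewrite (gee0_abs (bE0 x)).
Qed.

Lemma moment_fin n : rint (nu n) (fun x => `|b x| `^ p) ->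
  (\int[nu n]_x (`|b x| `^ p)%:E)%E = (moment n)%:E.
Proof. by move=> i; rewrite fineK//; apply: (integrable_fin_num measurableT i). Qed.

Lemma moment_step m n : rint (nu m) (fun x => `|b x| `^ p) ->
  rint (nu n) (fun x => `|b x| `^ p) ->
  rint (nu (m + n)%N) (fun x => `|b x| `^ p) /\
  moment (m + n) <= 2 `^ p * (moment m + moment n).
Proof.
move=> im ini.
have [mI _] := nuS n mbE bE0.
have H : (\int[nu (m + n)%N]_x (`|b x| `^ p)%:E <= (2 `^ p * (moment m + moment n))%:E)%E.
  rewrite (conv_integralD m n mbE bE0).
  have i1 : rint (nu m) (fun x => 2 `^ p * (`|b x| `^ p + moment n)).
    apply: rintZ.
    by apply: rintD => //; exact: rint_unit_cst.
  apply: (@le_trans _ _ (\int[nu m]_x (2 `^ p * (`|b x| `^ p + moment n))%:E)%E).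
    apply: ge0_le_integral => //.
    - by move=> x _; apply: integral_ge0 => y _; exact: bE0.
    - exact: measurable_int i1.
    - move=> x _.
      have i2 : rint (nu n) (fun y => 2 `^ p * (`|b x| `^ p + `|b y| `^ p)).
        apply: rintZ.
        by apply: rintD => //; exact: rint_unit_cst.
      apply: (@le_trans _ _ (\int[nu n]_y (2 `^ p * (`|b x| `^ p + `|b y| `^ p))%:E)%E).
        apply: ge0_le_integral => //.
        + by move=> y _; exact: bE0.
        + exact: (measurable_fun_lmul x mbE).
        + exact: measurable_int i2.
        + move=> y _; rewrite lee_fin.
          apply: le_trans (powR_add_le (ltW p0) (normr_ge0 _) (normr_ge0 _)).
          have [_ sub _ _] := cocycle_length pi_rep Z1b.
          by apply: ge0_ler_powR; rewrite ?nnegrE ?(ltW p0)// addr_ge0.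
      rewrite -(fineK (integrable_fin_num measurableT i2)) lee_fin.
      rewrite -[fine _]/(\int[nu n]_y (2 `^ p * (`|b x| `^ p + `|b y| `^ p))).
      rewrite rIZ.
        rewrite rID//.
          by rewrite rI_unit_cst.
        exact: rint_unit_cst.
      by apply: rintD => //; exact: rint_unit_cst.
  rewrite -(fineK (integrable_fin_num measurableT i1)) lee_fin.
  rewrite -[fine _]/(\int[nu m]_x (2 `^ p * (`|b x| `^ p + moment n))).
  rewrite rIZ.
    rewrite rID//.
      by rewrite rI_unit_cst.
    exact: rint_unit_cst.
  by apply: rintD => //; exact: rint_unit_cst.
have imn : rint (nu (m + n)%N) (fun x => `|b x| `^ p).
  by apply: rint_power; exact: le_lt_trans H (ltry _).
by split=> //; rewrite -lee_fin -moment_fin.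
Qed.

Lemma rint_moment n : rint (nu n) (fun x => `|b x| `^ p).
Proof.
elim: n => [|n IH].
  by apply: rint_power; rewrite nu0// ltry.
have i1 : rint (nu 1%N) (fun x => `|b x| `^ p).
  apply: rint_power; rewrite conv_integral1//.
  by rewrite -(fineK (integrable_fin_num measurableT ib)) ltry.
by have [] := moment_step i1 IH.
Qed.

Lemma momentD m n : moment (m + n) <= 2 `^ p * (moment m + moment n).
Proof. by have [] := moment_step (rint_moment m) (rint_moment n). Qed.

Lemma moment0 : moment 0 = 0.
Proof.
rewrite /moment /Rintegral nu0// (cocycle1 pi_rep Z1b) normr0 powR0 ?gt_eqF//.
Qed.

Lemma rint_moment_shift n x : rint (nu n) (fun y => `|b y - b x^-1%g| `^ p).
Proof.
apply: (@rint_dom _ (borel G) _ (nu n) (fun y => `|b y - b x^-1%g| `^ p)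
  (fun y => 2 `^ p * (`|b y| `^ p + `|b x^-1%g| `^ p))).
- have := measurable_fun_lmul x mbE => /measurable_EFinP; congr measurable_fun.
  by apply/funext => y /=; rewrite (norm_cocycleM pi_rep Z1b).
- apply: rintZ.
  apply: rintD.
    exact: rint_moment.
  exact: rint_unit_cst.
- move=> y; rewrite ger0_norm ?powR_ge0//.
  apply: le_trans (powR_add_le (ltW p0) (normr_ge0 _) (normr_ge0 _)).
  by apply: ge0_ler_powR; rewrite ?nnegrE ?(ltW p0) ?addr_ge0 ?ler_normB.
Qed.

(** By [norm_cocycleM] one more convolution factor x shifts the random vector b y
    by b x^-1. *)
Lemma momentS n :
  rint mu (fun x => \int[nu n]_y (`|b y - b x^-1%g| `^ p)) /\
  moment n.+1 = \int[mu]_x \int[nu n]_y (`|b y - b x^-1%g| `^ p).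
Proof.
pose F : borel G -> \bar R := EFin \o (fun g : borel G => `|b g| `^ p).
have [mI IE] := @nuS n F mbE bE0.
have e (x : borel G) : (\int[nu n]_y F (x * y)%g =
    (\int[nu n]_y (`|b y - b x^-1%g| `^ p))%:E)%E.
  rewrite fineK; last exact: (integrable_fin_num measurableT (rint_moment_shift n x)).
  by apply: eq_integral => y _; rewrite /F /= (norm_cocycleM pi_rep Z1b).
have eE : (fun x : borel G => \int[nu n]_y F (x * y)%g)%E =
   EFin \o (fun x => \int[nu n]_y (`|b y - b x^-1%g| `^ p)) by apply/funext.
rewrite eE in mI IE; split; last by rewrite /moment /Rintegral IE.
apply/integrableP; split; first exact: mI.
pose I (x : borel G) : R := \int[nu n]_y (`|b y - b x^-1%g| `^ p).
have I0 (x : borel G) : (0 <= (EFin \o I) x)%E.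
  by rewrite lee_fin; apply: rI_ge0 => y; exact: powR_ge0.
under eq_integral => x _ do rewrite (gee0_abs (I0 x)).
by rewrite -IE moment_fin ?ltry//; exact: rint_moment.
Qed.

End convolution_moments.

(** * Growth of harmonic cocycles *)

Section growth.
Context {R : realType} {G : topologicalGroupType} (mu : probability (borel G) R)
  (muV : forall A : set (borel G), measurable A -> mu [set (x^-1)%g | x in A] = mu A)
  (nu : nat -> {measure set (borel G) -> \bar R}).
Hypothesis nuT : forall n, nu n setT = 1%E.
Hypothesis nu0 : forall F : borel G -> \bar R, measurable_fun setT F ->
  (forall x, 0 <= F x)%E -> (\int[nu 0%N]_x F x = F 1%g)%E.
Hypothesis nuS : forall n (F : borel G -> \bar R), measurable_fun setT F ->
  (forall x, 0 <= F x)%E ->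
  measurable_fun setT (fun x : borel G => \int[nu n]_y F (x * y)%g)%E /\
  (\int[nu n.+1]_x F x = \int[mu]_x \int[nu n]_y F (x * y)%g)%E.
Notation rint m f := ((m : set (borel G) -> \bar R).-integrable [set: borel G] (EFin \o f)).

Variables (E : completeNormedModType R) (p : R) (p2 : 2 < p)
  (D : E -> E -> R) (c C : R) (c0 : 0 < c) (C0 : 0 < C) (HD : duality_map p D c C)
  (pi : G -> {linear E -> E}) (pi_rep : isometric_rep pi)
  (b : G -> E) (Z1b : Z1 pi b).
Hypothesis ib1 : rint mu (fun x => `|b x|).
Hypothesis ib : rint mu (fun x => `|b x| `^ p).
Hypothesis harmonic : forall L K, bounded_linear L K -> \int[mu]_x L (b x) = 0.

Let p0 : 0 < p. Proof. exact: lt_trans p2. Qed.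
Let p1 : 1 < p. Proof. by apply: lt_trans p2; rewrite ltr1n. Qed.
Let Dlin x a y z : D x (a *: y + z) = a * D x y + D x z. Proof. by case: HD. Qed.
Let Dbound x y : `|D x y| <= 2 * `|x| `^ (p - 1) * `|y|. Proof. by case: HD. Qed.
Let Dconv x y : `|x| `^ p + p * D x y + c * `|y| `^ p <= `|x + y| `^ p.
Proof. by case: HD. Qed.
Let Dsmooth s x y : 0 < s <= 1 -> `|x + y| `^ p <= `|x| `^ p + p * D x y
  + C * (s ^+ 2 * `|x| `^ p + s `^ (2 - p) * `|y| `^ p).
Proof. by case: HD => _ _ _ _; apply. Qed.
Let cb : continuous b. Proof. exact: cocycle_continuous Z1b. Qed.
Let rm := rint_moment nuT nu0 nuS pi_rep Z1b p1 ib.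
Let rs n x := rint_moment_shift nuT nu0 nuS pi_rep Z1b p1 ib n x.

(** D (b x) w is a limit of difference quotients of continuous functions of x. *)
Lemma measurable_duality w : measurable_fun [set: borel G] (fun x : borel G => D (b x) w).
Proof.
pose t n : R := n.+1%:R^-1.
have t01 n : 0 < t n <= 1 by rewrite invr_gt0 ltr0n /= invf_le1 ?ltr0n// ler1n.
pose h n (x : borel G) := (p * t n)^-1 * (`|b x + t n *: w| `^ p - `|b x| `^ p).
apply: (@measurable_fun_cvg _ (borel G) R setT h) => [n|x _].
  apply: measurable_funM => //; apply: measurable_funB; last first.
    exact: (measurable_cocycle_power pi_rep Z1b p).
  apply: (measurableT_comp (measurable_powR _)); apply: continuous_real_borel => x.
  by apply: cvg_norm; apply: cvgD; [exact: cb|exact: cvg_cst].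
pose K := C / p * (`|b x| `^ p + `|w| `^ p).
apply: (@squeeze_cvgr _ _ _ _ (fun=> D (b x) w) (fun n => D (b x) w + K * t n)).
- apply: nearW => n; have /andP[tn0 tn1] := t01 n.
  have /andP[l u] := duality_derivative (b x) w p2 c0 HD (t01 n).
  have pt : 0 < p * t n by rewrite mulr_gt0.
  rewrite /h [_^-1 * _]mulrC ler_pdivlMr// ler_pdivrMr//.
  rewrite [D _ _ * _]mulrC l /= (le_trans u)// mulrDl [D _ _ * _]mulrC lerD2l.
  rewrite /K; move: (`|b x| `^ p + `|w| `^ p) (t n) => A s.
  by rewrite le_eqVlt; apply/orP; left; apply/eqP; field; rewrite gt_eqF.
- exact: cvg_cst.
- rewrite -[X in _ --> X]addr0 -[X in _ + X](mulr0 K).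
  apply: cvgD; first exact: cvg_cst.
  by apply: cvgMl_tmp; exact: cvg_harmonic.
Qed.

Lemma powR_pred_le (x : R) : 0 <= x -> x `^ (p - 1) <= 1 + x `^ p.
Proof.
move=> x0; have [x1|x1] := leP x 1.
  apply: (@le_trans _ _ 1); last by rewrite lerDl powR_ge0.
  have e1 : 1 `^ (p - 1) = 1 :> R by rewrite powR1.
  rewrite -[leRHS]e1; apply: ge0_ler_powR; rewrite ?nnegrE// subr_ge0 ltW//.
rewrite -(@mulr_powRB1 _ x p)//.
apply: (@le_trans _ _ (x * x `^ (p - 1))); last by rewrite lerDr.
by rewrite ler_peMl ?powR_ge0// ltW.
Qed.

Lemma rint_duality n w : rint (nu n) (fun y => D (b y) w).
Proof.
apply: (@rint_dom _ (borel G) _ (nu n) (fun y => D (b y) w)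
  (fun y => 2 * `|w| * (1 + `|b y| `^ p))).
- exact: measurable_duality.
- apply: rintZ.
  apply: rintD.
    exact: rint_unit_cst.
  exact: rm.
- move=> y; apply: (le_trans (Dbound _ _)); rewrite mulrAC ler_wpM2l ?mulr_ge0//.
  exact: powR_pred_le.
Qed.

Definition mean_duality n w := \int[nu n]_y D (b y) w.

Lemma mean_duality_bounded n :
  bounded_linear (mean_duality n) (2 * (1 + moment nu b p n)).
Proof.
split=> [a x y|x].
  rewrite /mean_duality; under eq_Rintegral do rewrite Dlin.
  rewrite rID.
  - by rewrite rIZ//; exact: rint_duality.
  - by apply: rintZ; exact: rint_duality.
  - exact: rint_duality.
have i1 : rint (nu n) (fun y => 1 + `|b y| `^ p).
  apply: rintD.
    exact: rint_unit_cst.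
  exact: rm.
have i2 : rint (nu n) (fun y => 2 * `|x| * (1 + `|b y| `^ p)).
  exact: rintZ.
apply: (@le_trans _ _ (\int[nu n]_y (2 * `|x| * (1 + `|b y| `^ p)))).
  apply: rI_norm_le => //; first exact: rint_duality.
  move=> y; apply: (le_trans (Dbound _ _)); rewrite mulrAC ler_wpM2l ?mulr_ge0//.
  exact: powR_pred_le.
rewrite rIZ//.
rewrite rID//.
  by rewrite rI_unit_cst// mulrAC.
exact: rint_unit_cst.
Qed.

(** The mean over mu of A - p L(w) + k |w|^p at w = b(x^-1), for a bounded linear
    L, does not depend on L: this is where harmonicity enters, with the symmetry
    of mu. *)
Lemma rI_profile n A k :
  rint mu (fun x => A - p * mean_duality n (b x^-1%g) + k * `|b x^-1%g| `^ p) /\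
  \int[mu]_x (A - p * mean_duality n (b x^-1%g) + k * `|b x^-1%g| `^ p) =
  A + k * \int[mu]_x (`|b x| `^ p).
Proof.
pose F x := A - p * mean_duality n (b x) + k * `|b x| `^ p.
have iL : rint mu (fun x => mean_duality n (b x)).
  exact: (bounded_linear_rint cb ib1 (mean_duality_bounded n)).
have i1 : rint mu (fun x => A - p * mean_duality n (b x)).
  apply: rintB.
    exact: rint_cst_probability.
  exact: rintZ.
have i2 : rint mu (fun x => k * `|b x| `^ p).
  exact: rintZ.
have iF : rint mu F by exact: rintD.
split; first exact: (rint_invg muV iF).
rewrite (rI_invg muV (rint_meas iF)) /F.
rewrite rID//.
rewrite rIZ//.
rewrite rIB.
- rewrite rI_cst_probability rIZ//.
  by rewrite (harmonic (mean_duality_bounded n)) mulr0 subr0.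
- exact: rint_cst_probability.
- exact: rintZ.
Qed.

Lemma rI_shift_profile n A k w :
  rint (nu n) (fun y => A * `|b y| `^ p - p * D (b y) w + k) /\
  \int[nu n]_y (A * `|b y| `^ p - p * D (b y) w + k) =
  A * moment nu b p n - p * mean_duality n w + k.
Proof.
have i1 : rint (nu n) (fun y => A * `|b y| `^ p).
  exact: rintZ.
have i2 : rint (nu n) (fun y => p * D (b y) w).
  by apply: rintZ; exact: rint_duality.
have i3 : rint (nu n) (fun y => A * `|b y| `^ p - p * D (b y) w).
  exact: rintB.
have i4 := rint_unit_cst nuT n k.
split; first exact: rintD.
rewrite rID//.
rewrite rIB// rI_unit_cst//.
rewrite rIZ//.
by rewrite rIZ//; exact: rint_duality.
Qed.

Let sigma := \int[mu]_x (`|b x| `^ p).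

Let DN x y : D x (- y) = - D x y.
Proof. by rewrite -scaleN1r (dualityZ _ _ _ HD) mulN1r. Qed.

(** Uniform convexity at b y in the direction - b x^-1. *)
Lemma moment_lower_step n : moment nu b p n + c * sigma <= moment nu b p n.+1.
Proof.
have [iI ->] := momentS nuT nu0 nuS pi_rep Z1b p1 ib n.
have [iP <-] := rI_profile n (moment nu b p n) c.
apply: rI_le => // x.
have [iS] := rI_shift_profile n 1 (c * `|b x^-1%g| `^ p) (b x^-1%g).
rewrite mul1r => <-; apply: rI_le => // y.
by have := Dconv (b y) (- b x^-1%g); rewrite DN normrN mul1r mulrN.
Qed.

Lemma moment_upper_step n s : 0 < s <= 1 -> moment nu b p n.+1 <=
  (1 + C * s ^+ 2) * moment nu b p n + C * s `^ (2 - p) * sigma.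
Proof.
move=> s01; have [iI ->] := momentS nuT nu0 nuS pi_rep Z1b p1 ib n.
have [iP <-] := rI_profile n ((1 + C * s ^+ 2) * moment nu b p n) (C * s `^ (2 - p)).
apply: rI_le => // x.
have [iS <-] := rI_shift_profile n (1 + C * s ^+ 2)
  (C * s `^ (2 - p) * `|b x^-1%g| `^ p) (b x^-1%g).
apply: rI_le => // y.
have := Dsmooth (b y) (- b x^-1%g) s01; rewrite DN normrN mulrN.
move=> h; apply: (le_trans h); rewrite le_eqVlt; apply/orP; left; apply/eqP.
by ring.
Qed.

Lemma moment_lower n : c * sigma * n%:R <= moment nu b p n.
Proof.
elim: n => [|n IH]; first by rewrite mulr0 moment_ge0.
apply: le_trans (moment_lower_step n).
by rewrite -natr1 mulrDr mulr1 lerD2r.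
Qed.

Lemma sigma_ge0 : 0 <= sigma.
Proof. by apply: rI_ge0 => x; exact: powR_ge0. Qed.

Lemma powR_succ_gap (n : nat) :
  n%:R `^ (p / 2) + n.+1%:R `^ (p / 2 - 1) <= n.+1%:R `^ (p / 2) :> R.
Proof.
have q0 : 0 < p / 2 by rewrite divr_gt0.
rewrite -(@mulr_powRB1 _ n%:R (p / 2))// -(@mulr_powRB1 _ n.+1%:R (p / 2))//.
rewrite -[X in _ <= X * _]natr1 mulrDl mul1r lerD2r ler_wpM2l//.
by apply: ge0_ler_powR; rewrite ?nnegrE ?ler_nat// subr_ge0 ler_pdivlMr// mul1r ltW.
Qed.

(** With s^2 of order 1 / n, smoothness lets one convolution step add at most a
    term of order n^(p / 2 - 1), the increment of n^(p / 2). *)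
Lemma moment_upper : exists2 A : R, 0 < A &
  forall n, moment nu b p n <= A * n%:R `^ (p / 2).
Proof.
(* With s^2 = th / (n + 1), th makes the term in s^2 at most half of the gap in
   [powR_succ_gap], and A makes the term in s^(2 - p) at most the other half. *)
pose q := p / 2; pose th := Num.min 1 (2 * C)^-1.
have th0 : 0 < th by rewrite lt_min ltr01 invr_gt0 mulr_gt0.
have th1 : th <= 1 by rewrite ge_min lexx.
have Cth : C * th <= 2^-1.
  apply: (@le_trans _ _ (C * (2 * C)^-1)).
    by rewrite ler_pM2l// ge_min lexx orbT.
  by rewrite invfM mulrCA divff ?gt_eqF// mulr1.
pose A := 2 * C * sigma * th `^ (1 - q) + 1.
have A0 : 0 < A.
  by rewrite ltr_wpDl// mulr_ge0 ?powR_ge0// mulr_ge0 ?sigma_ge0// mulr_ge0// ltW.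
exists A => //; elim=> [|n IH].
  by rewrite (moment0 nu0 pi_rep Z1b p1) mulr_ge0 ?powR_ge0// ltW.
pose N : R := n.+1%:R; have N0 : 0 < N by rewrite ltr0n.
have N1 : 1 <= N by rewrite ler1n.
pose s := Num.sqrt (th / N).
have s2 : s ^+ 2 = th / N by rewrite sqr_sqrtr// ltW// divr_gt0.
have s0 : 0 < s by rewrite sqrtr_gt0 divr_gt0.
have s1 : s <= 1.
  by rewrite -(@ler_pXn2r _ 2)// ?nnegrE ?(ltW s0)// s2 expr1n ler_pdivrMr// mul1r (le_trans th1).
have s01 : 0 < s <= 1 by rewrite s0.
apply: (le_trans (moment_upper_step n s01)).
have sp : s `^ (2 - p) = th `^ (1 - q) * N `^ (q - 1).
  have -> : 2 - p = 2 * (1 - q) by rewrite /q; field.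
  rewrite powRrM powR_mulrn ?(ltW s0)// s2 powRM ?invr_ge0 ?(ltW th0) ?(ltW N0)//.
  congr (_ * _); rewrite -powR_inv1 ?(ltW N0)// -powRrM.
  by congr (_ `^ _); ring.
have gap := powR_succ_gap n.
have nN : n%:R `^ q <= N `^ q.
  by apply: ge0_ler_powR; rewrite ?nnegrE ?ler_nat// divr_ge0// ltW.
have Nq : N `^ q = N * N `^ (q - 1) by rewrite mulr_powRB1// divr_gt0.
have h1 : C * s ^+ 2 * moment nu b p n <= 2^-1 * A * N `^ (q - 1).
  rewrite s2; apply: (@le_trans _ _ (C * (th / N) * (A * N `^ q))).
    apply: ler_wpM2l; first by rewrite mulr_ge0 ?(ltW C0)// divr_ge0 ?(ltW th0) ?(ltW N0).
    by apply: (le_trans IH); rewrite ler_pM2l.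
  have -> : C * (th / N) * (A * N `^ q) = C * th * (A * N `^ (q - 1)).
    by rewrite Nq; move: (N `^ (q - 1)) => X; field; rewrite gt_eqF.
  by rewrite -[leRHS]mulrA ler_wpM2r// mulr_ge0 ?powR_ge0// ltW.
have h2 : C * s `^ (2 - p) * sigma <= 2^-1 * A * N `^ (q - 1).
  rewrite sp; have -> : C * (th `^ (1 - q) * N `^ (q - 1)) * sigma =
    2^-1 * (2 * C * sigma * th `^ (1 - q)) * N `^ (q - 1) by field.
  by rewrite ler_wpM2r ?powR_ge0// ler_pM2l// lerDl.
have h3 : A * (n%:R `^ q + N `^ (q - 1)) <= A * N `^ q by rewrite ler_pM2l.
rewrite mulrDr in h3; rewrite mulrDl mul1r; move: h1 h2 h3 IH; rewrite -/q.
move: (C * s ^+ 2 * moment nu b p n) => x1; move: (C * s `^ (2 - p) * sigma) => x2.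
move: (moment nu b p n) => x3.
rewrite -[2^-1 * A * _]mulrA -/N; move: (A * N `^ (q - 1)) (A * N `^ q) (A * n%:R `^ q) => y1 y2 y3; lra.
Qed.

End growth.

(** * Moments and growth: elementary bounds *)

Lemma set_exp_word_length (G : topologicalGroupType) (S : set G) : generating S ->
  forall g, set_exp S (word_length S g) g.
Proof.
move=> genS g; rewrite /word_length; case: xgetP => [n _ []//|H]; exfalso.
have ex : exists n, `[< set_exp S n g >] by have [n] := genS g; exists n; apply/asboolP.
case: (ex_minnP ex) => n /asboolP gn nmin; apply: (H n); split=> // k gk.
by apply: nmin; exact/asboolP.
Qed.

(** Monotonicity over all nonnegative functions, as it will be applied to the
    word length. *)
Lemma ge0_integral_mono {d} {T : measurableType d} {R : realType}
    (m : {measure set T -> \bar R}) (f g : T -> \bar R) :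
  (forall x, 0 <= f x)%E -> (forall x, f x <= g x)%E ->
  (\int[m]_x f x <= \int[m]_x g x)%E.
Proof.
move=> f0 fg; have g0 x : (0 <= g x)%E by exact: le_trans (fg x).
rewrite !ge0_integralTE//; apply: le_ereal_sup => _ [h hf <-].
by exists h => // x; exact: le_trans (fg x).
Qed.

Section word_growth.
Context {R : realType} {G : topologicalGroupType} (mu : probability (borel G) R)
  (S : set G) (compactS : compact S) (genS : generating S)
  {E : normedModType R} (pi : G -> {linear E -> E}) (pi_rep : isometric_rep pi)
  (b : G -> E) (Z1b : Z1 pi b).
Notation rint f := (mu.-integrable [set: borel G] (EFin \o f)).

Lemma cocycle_bounded_on_compact : exists2 M : R, 0 < M & forall g, S g -> `|b g| <= M.
Proof.
have cb := cocycle_continuous Z1b.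
have /compact_near_coveringP cS := compactS.
have [|N _ NP] := cS nat \oo (fun n g => `|b g| <= n.+1%:R).
  move=> g _.
  have h : \forall y \near g, `|b y| <= (Num.truncn (`|b g| + 1)).+1%:R.
    have /cvgrPdist_lt/(_ 1 ltr01) := cb g; apply: filterS => y gy.
    apply: (@le_trans _ _ (`|b g| + 1)); last by rewrite ltW// truncnS_gt.
    by rewrite -lerBlDl (le_trans (lerB_dist _ _))// distrC ltW.
  exists ([set y | `|b y| <= (Num.truncn (`|b g| + 1)).+1%:R],
          [set m | (Num.truncn (`|b g| + 1) <= m)%N]) => /=.
    by split=> //; exact: nbhs_infty_ge.
  by move=> [y m] [/= yn nm]; rewrite (le_trans yn)// ler_nat.
by exists N.+1%:R => // g Sg; exact: (NP N (leqnn N)).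
Qed.

Lemma cocycle_word_length : exists2 M : R, 0 < M &
  forall g, `|b g| <= M * (word_length S g)%:R.
Proof.
have [M M0 MP] := cocycle_bounded_on_compact; exists M => // g.
have := set_exp_word_length genS g; move: (word_length S g) => n.
elim: n g => [|n IH] g /=.
  by move=> ->; rewrite (cocycle1 pi_rep Z1b) normr0 mulr0.
move=> [x Sx [y yn <-]]; have [_ sub _ _] := cocycle_length pi_rep Z1b.
apply: (le_trans (sub x y)); rewrite -natr1 mulrDr mulr1 addrC.
by apply: lerD; [exact: IH|exact: MP].
Qed.

Lemma cocycle_integrable (r : R) : 0 < r ->
  (\int[mu]_g ((word_length S g)%:R `^ r)%:E < +oo)%E -> rint (fun x => `|b x| `^ r).
Proof.
move=> r0 wr; have [M M0 MP] := cocycle_word_length.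
have mb := measurable_cocycle_power pi_rep Z1b r.
have e x : `|b x| `^ r = M `^ r * (M^-1 `^ r * `|b x| `^ r).
  by rewrite mulrA -powRM ?invr_ge0 ?(ltW M0)// divff ?gt_eqF// powR1 mul1r.
have -> : (fun x => `|b x| `^ r) = (fun x => M `^ r * (M^-1 `^ r * `|b x| `^ r)).
  by apply/funext => x; rewrite -e.
apply: (@rintZ _ (borel G) _ mu (M `^ r) (fun x => M^-1 `^ r * `|b x| `^ r)).
have f0 (x : borel G) : (0 <= (M^-1 `^ r * `|b x| `^ r)%:E)%E.
  by rewrite lee_fin mulr_ge0 ?powR_ge0.
apply/integrableP; split; first by apply/measurable_EFinP; exact: measurable_funM.
under eq_integral => x _ do rewrite /= ger0_norm ?mulr_ge0 ?powR_ge0//.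
apply: le_lt_trans wr; apply: ge0_integral_mono => // x.
rewrite lee_fin -powRM ?invr_ge0 ?(ltW M0)//; apply: ge0_ler_powR; rewrite ?nnegrE ?(ltW r0)//.
  by rewrite mulr_ge0// invr_ge0 ltW.
by rewrite ler_pdivrMl.
Qed.

End word_growth.

(** For large n the linear bound absorbs B. For the finitely many other n >= 1 it
    suffices that e n > 0: if e n = 0 then e vanishes at all multiples of n, by
    subadditivity, against the linear bound. *)
Lemma linear_lower_bound {R : realType} (e : nat -> R) (K a B : R) :
  0 < a -> 0 <= B -> (forall n, 0 <= e n) ->
  (forall m n, e (m + n)%N <= K * (e m + e n)) -> (forall n, a * n%:R - B <= e n) ->
  exists2 d : R, 0 < d & forall n, (1 <= n)%N -> d * n%:R <= e n.
Proof.
move=> a0 B0 e0 esub elow.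
have big : exists k : nat, B < a / 2 * k%:R.
  exists (Num.truncn (B / (a / 2))).+1; rewrite mulrC -ltr_pdivrMr ?divr_gt0//.
  exact: truncnS_gt.
have [k0 k0P] := big.
have epos n : (1 <= n)%N -> 0 < e n.
  move=> n1; rewrite lt_neqAle e0 andbT eq_sym; apply/eqP => en.
  have ek k : e (k.+1 * n)%N = 0.
    elim: k => [|k IH]; first by rewrite mul1n.
    apply/eqP; rewrite eq_le e0 andbT mulSn (le_trans (esub _ _))//.
    by rewrite en IH addr0 mulr0.
  have := elow (k0.+1 * n)%N; rewrite ek.
  have h : k0%:R <= (k0.+1 * n)%:R :> R by rewrite ler_nat (leq_trans (leqnSn k0))// leq_pmulr.
  have h1 : a / 2 * k0%:R <= a / 2 * (k0.+1 * n)%:R by rewrite ler_pM2l// divr_gt0.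
  have h2 : a / 2 * (k0.+1 * n)%:R <= a * (k0.+1 * n)%:R.
    by rewrite ler_wpM2r// ler_pdivrMr// ler_peMr ?ler1n// ltW.
  move: k0P h1 h2; move: (a / 2 * k0%:R) (a / 2 * (k0.+1 * n)%:R) (a * (k0.+1 * n)%:R) => x y z; lra.
have small N : exists2 d : R, 0 < d & forall n, (1 <= n)%N -> (n <= N)%N -> d * n%:R <= e n.
  elim: N => [|N [d d0 dP]]; first by exists 1 => // n; rewrite leqn0 => /[swap] /eqP->.
  exists (Num.min d (e N.+1 / N.+1%:R)).
    by rewrite lt_min d0 /= divr_gt0 ?ltr0n// epos.
  move=> n n1; rewrite leq_eqVlt => /predU1P[->|nN].
    by rewrite -ler_pdivlMr ?ltr0n// ge_min lexx orbT.
  apply: le_trans (dP n n1 nN); rewrite ler_wpM2r// ge_min lexx//.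
have [d d0 dP] := small k0.
exists (Num.min d (a / 2)); first by rewrite lt_min d0 divr_gt0.
move=> n n1; have [nk|kn] := leqP n k0.
  by apply: le_trans (dP n n1 nk); rewrite ler_wpM2r// ge_min lexx.
apply: le_trans (elow n).
apply: (@le_trans _ _ (a / 2 * n%:R)); first by rewrite ler_wpM2r// ge_min lexx orbT.
have h : a / 2 * k0%:R <= a / 2 * n%:R by rewrite ler_pM2l ?divr_gt0// ler_nat ltnW.
have -> : a * n%:R = a / 2 * n%:R + a / 2 * n%:R by rewrite -mulrDl -splitr.
move: k0P h; move: (a / 2 * k0%:R) (a / 2 * n%:R) => x y; lra.
Qed.

(** Truncation at height t. *)
Lemma powR2_le {R : realType} (p t x : R) : 2 < p -> 0 < t -> 0 <= x ->
  x `^ 2 <= t `^ 2 + t `^ (2 - p) * x `^ p.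
Proof.
move=> p2 t0 x0; have [xt|tx] := leP x t.
  apply: (@le_trans _ _ (t `^ 2)); last by rewrite lerDl mulr_ge0 ?powR_ge0.
  by apply: ge0_ler_powR; rewrite ?nnegrE// ltW.
have xgt0 : 0 < x by exact: lt_trans tx.
apply: (@le_trans _ _ (t `^ (2 - p) * x `^ p)); last by rewrite lerDr powR_ge0.
have -> : x `^ p = x `^ 2 * x `^ (p - 2).
  by rewrite -powRD ?(gt_eqF xgt0) ?implybT//; congr (_ `^ _); ring.
have -> : t `^ (2 - p) = (t `^ (p - 2))^-1 by rewrite -powRN opprB.
rewrite mulrCA ler_peMr ?powR_ge0// mulrC ler_pdivlMr ?powR_gt0// mul1r.
by apply: ge0_ler_powR; rewrite ?nnegrE ?(ltW t0) ?(ltW tx)// subr_ge0 ltW.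
Qed.

(** * The growth theorem *)

(** Truncation of h at height sqrt N. *)
Lemma second_moment_bound {d} {T : measurableType d} {R : realType}
    (m : {measure set T -> \bar R}) (p A N bet : R) (f h : T -> R) :
  m setT = 1%E -> 2 < p -> 0 < A -> 1 <= N -> 0 <= bet ->
  measurable_fun setT f -> (forall x, 0 <= f x <= h x + bet) -> (forall x, 0 <= h x) ->
  m.-integrable setT (EFin \o (fun x => h x `^ p)) ->
  \int[m]_x (h x `^ p) <= A * N `^ (p / 2) ->
  m.-integrable setT (EFin \o (fun x => f x `^ 2)) /\
  \int[m]_x (f x `^ 2) <= 2 `^ 2 * (1 + A + bet `^ 2) * N.
Proof.
move=> mT p2 A0 N1 bet0 mf fh h0 ih Ih.
have N0 : 0 < N by exact: lt_le_trans N1.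
have icst a : m.-integrable setT (EFin \o (fun=> a)).
  apply/integrableP; split; first exact: measurable_cst.
  by rewrite /= integral_cst//= mT mule1 ltry.
have Icst a : \int[m]_x a = a by rewrite Rintegral_cst// mT mulr1.
pose t := N `^ 2^-1; have t0 : 0 < t by rewrite powR_gt0.
have t2 : t `^ 2 = N by rewrite /t -powRrM mulVf// powRr1// ltW.
have tp : t `^ (2 - p) * N `^ (p / 2) = N.
  rewrite /t -powRrM -powRD; last by rewrite (gt_eqF N0) implybT.
  have -> : 2^-1 * (2 - p) + p / 2 = 1 by field.
  by rewrite powRr1// ltW.
pose g x := 2 `^ 2 * ((t `^ 2 + bet `^ 2) + t `^ (2 - p) * h x `^ p).
have i1 : m.-integrable setT (EFin \o (fun x => t `^ (2 - p) * h x `^ p)) by exact: rintZ.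
have i2 : m.-integrable setT (EFin \o (fun x => (t `^ 2 + bet `^ 2) + t `^ (2 - p) * h x `^ p)).
  by apply: rintD.
have ig : m.-integrable setT (EFin \o g) by exact: rintZ.
have fg x : f x `^ 2 <= g x.
  have /andP[f0 fx] := fh x.
  apply: (@le_trans _ _ ((h x + bet) `^ 2)).
    by apply: ge0_ler_powR; rewrite ?nnegrE// (le_trans f0).
  apply: (le_trans (powR_add_le _ (h0 x) bet0)) => //.
  rewrite /g ler_pM2l ?powR_gt0// addrAC lerD2r.
  exact: powR2_le.
have if2 : m.-integrable setT (EFin \o (fun x => f x `^ 2)).
  apply: (rint_dom (g := g)) => //; first exact: (measurableT_comp (measurable_powR _)).
  by move=> x; rewrite ger0_norm ?powR_ge0.
split=> //; apply: (le_trans (rI_le if2 ig fg)).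
rewrite /g rIZ// rID// Icst rIZ// t2 -mulrA ler_pM2l ?powR_gt0//.
have h1 : t `^ (2 - p) * \int[m]_x (h x `^ p) <= A * N.
  by rewrite -[in leRHS]tp mulrCA ler_wpM2l ?powR_ge0.
have h2 : bet `^ 2 <= bet `^ 2 * N by rewrite ler_peMr ?powR_ge0.
rewrite 2!mulrDl mul1r; move: h1 h2; move: (t `^ _ * _) (bet `^ 2) (bet `^ 2 * N) (A * N) => a1 a2 a3 a4; lra.
Qed.

Lemma Lr_norm_eq {R : realType} {G : topologicalGroupType} (E : normedModType R) (b : G -> E) (r : R) (m1 : set (borel G) -> \bar R)
    (m : {measure set (borel G) -> \bar R}) :
  (forall A, measurable A -> m1 A = m A) ->
  m.-integrable [set: borel G] (EFin \o (fun x => `|b x| `^ r)) ->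
  Lr_norm r m1 b = ((\int[m]_x (`|b x| `^ r)) `^ r^-1)%:E.
Proof.
move=> m1m ib; rewrite /Lr_norm (integral_set_function _ m1m) -poweR_EFin.
by rewrite fineK//; exact: (integrable_fin_num measurableT ib).
Qed.

Theorem theorem4 (R : realType) (G : topologicalGroupType)
    (hausdorffG : hausdorff_space G) (lcG : locally_compact [set: G])
    (S : set G) (compactS : compact S) (genS : generating S)
    (mG : {measure set (borel G) -> \bar R}) (haarG : is_haar mG)
    (p : R) (p_gt2 : 2 < p)
    (TG : propertyT R G) (nFLpG : ~ property_FLp p G)
    (mu : probability (borel G) R) (mu_adapted : cohomologically_adapted S mG mu)
    (E : completeNormedModType R) (LpE : Lp_space p E) (sepE : separable_space E)
    (pi : G -> {linear E -> E}) (pi_rep : isometric_rep pi)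
    (H1pi : H1_neq0 pi)
    (b : G -> E) (Z1b : Z1 pi b) (nB1b : ~ B1 pi b) :
  exists2 C : R, 0 < C & forall n : nat, (1 <= n)%N ->
    ((C^-1 * n%:R `^ p^-1)%:E <= Lr_norm p (conv_exp mu n) b)%E /\
    (Lr_norm 2 (conv_exp mu n) b <= (C * n%:R `^ 2^-1)%:E)%E.
Proof.
have [muV _ suppS [f fd _] wl] := mu_adapted.
have p0 : 0 < p by exact: lt_trans p_gt2.
have p1 : 1 < p by apply: lt_trans p_gt2; rewrite ltr1n.
have mut : translation_cont mu := density_translation hausdorffG haarG fd.
have [nug [nugE nugT nug0 nugS]] := convolution_powers mut.
pose nu n : {measure set (borel G) -> \bar R} := nug n.
have nuE n A : measurable A -> conv_exp mu n A = nu n A by exact: nugE.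
have nuT n : nu n setT = 1%E by exact: nugT.
have nu0 (F : borel G -> \bar R) : measurable_fun setT F ->
  (forall x, 0 <= F x)%E -> (\int[nu 0%N]_x F x = F 1%g)%E by exact: nug0.
have nuS n (F : borel G -> \bar R) : measurable_fun setT F -> (forall x, 0 <= F x)%E ->
  measurable_fun setT (fun x : borel G => \int[nu n]_y F (x * y)%g)%E /\
  (\int[nu n.+1]_x F x = \int[mu]_x \int[nu n]_y F (x * y)%g)%E by exact: nugS.
have [D [c [C [c0 C0 HD]]]] := Lp_space_duality p_gt2 LpE.
have integ (b' : G -> E) (r : R) : Z1 pi b' -> 1 <= r ->
    mu.-integrable [set: borel G] (EFin \o (fun x => `|b' x| `^ r)).
  move=> Zb' r1; apply: (cocycle_integrable compactS genS pi_rep Zb' _ (wl r r1)).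
  exact: lt_le_trans r1.
have integ1 (b' : G -> E) : Z1 pi b' -> mu.-integrable [set: borel G] (EFin \o (fun x => `|b' x|)).
  move=> Zb'; have := integ b' 1 Zb' (lexx _); congr integrable.
  by apply/funext => x /=; rewrite powRr1.
have ib := integ b p Z1b (ltW p1).
have [v harm] := harmonic_representative muV mut genS suppS TG sepE p_gt2 LpE c0 C0 HD
  pi_rep Z1b (integ1 b Z1b).
pose b' g := b g - (v - pi g v).
have Zb' : Z1 pi b' by exact: cocycle_sub_coboundary.
have ib' := integ b' p Zb' (ltW p1).
(* Otherwise b' vanishes, by [length_compact] on singletons, and b is the
   coboundary of v. *)
have s0 : 0 < \int[mu]_x (`|b' x| `^ p).
  rewrite lt_neqAle; apply/andP; split; last first.
    by apply: rI_ge0 => x; exact: powR_ge0.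
  apply/eqP => s0; apply: nB1b; exists v => g.
  apply/eqP; rewrite -subr_eq0 -normr_le0; apply/ler_addgt0Pr => e e0; rewrite add0r.
  have [eta eta0 etaP] := length_compact mut genS suppS p0 (@compact_set1 G g) e0.
  by apply: (etaP _ (cocycle_length pi_rep Zb') ib') => //; rewrite -s0.
have low := moment_lower muV nuT nu0 nuS p_gt2 c0 HD pi_rep Zb' (integ1 b' Zb') ib' harm.
have [A A0 up] := moment_upper muV nuT nu0 nuS p_gt2 c0 C0 HD pi_rep Zb' (integ1 b' Zb') ib' harm.
have im n := rint_moment nuT nu0 nuS pi_rep Z1b p1 ib n.
have im' n := rint_moment nuT nu0 nuS pi_rep Zb' p1 ib' n.
(* b and b' are at distance at most bet, so their moments are comparable. *)
pose bet := 2 * `|v|; have bet0 : 0 <= bet by rewrite mulr_ge0.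
have bd g : `|v - pi g v| <= bet.
  by rewrite (le_trans (ler_normB _ _))// (rep_norm pi_rep) /bet mulr_natl mulr2n.
have [dl dl0 dlP] : exists2 d : R, 0 < d & forall n, (1 <= n)%N -> d * n%:R <= moment nu b p n.
  have P2 : 0 < (2 : R) `^ p by rewrite powR_gt0.
  have a0 : 0 < (2 `^ p)^-1 * (c * \int[mu]_x (`|b' x| `^ p)).
    by rewrite mulr_gt0 ?invr_gt0// mulr_gt0.
  apply: (linear_lower_bound a0 (powR_ge0 bet p) (fun n => moment_ge0 nu b p n)
    (momentD nuT nu0 nuS pi_rep Z1b p1 ib)) => n.
  rewrite lerBlDr -mulrA ler_pdivrMl//; apply: (le_trans (low n)).
  have i2 : (nu n).-integrable [set: borel G] (EFin \o (fun x => `|b x| `^ p + bet `^ p)).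
    apply: rintD => //.
    exact: rint_unit_cst.
  have -> : moment nu b p n + bet `^ p = \int[nu n]_x (`|b x| `^ p + bet `^ p).
    rewrite rID//.
      by rewrite rI_unit_cst.
    exact: rint_unit_cst.
  rewrite -rIZ//.
  apply: rI_le => //.
    exact: rintZ.
  move=> x; apply: le_trans (powR_add_le (ltW p0) (normr_ge0 _) bet0).
  apply: ge0_ler_powR; rewrite ?nnegrE ?(ltW p0)//; first by rewrite addr_ge0.
  by rewrite (le_trans (ler_normB _ _))// lerD2l.
pose K2 := 2 `^ 2 * (1 + A + bet `^ 2).
have K20 : 0 < K2 by rewrite mulr_gt0 ?powR_gt0// ltr_wpDr ?powR_ge0// addr_gt0.
have L2 n : (1 <= n)%N ->
    (nu n).-integrable [set: borel G] (EFin \o (fun x => `|b x| `^ 2)) /\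
    \int[nu n]_x (`|b x| `^ 2) <= K2 * n%:R.
  move=> n1; apply: (@second_moment_bound _ (borel G) R (nu n) p A n%:R bet
    (fun x => `|b x|) (fun x => `|b' x|)) => //.
  - by rewrite ler1n.
  - by have [cbn _ _ _] := cocycle_length pi_rep Z1b; exact: continuous_real_borel.
  - move=> x; rewrite normr_ge0 /=.
    by rewrite -[b x](subrK (v - pi x v)) (le_trans (ler_normD _ _))// lerD2l.
  - exact: up.
have e0 : 0 < dl `^ p^-1 by rewrite powR_gt0.
exists (Num.max (dl `^ p^-1)^-1 (K2 `^ 2^-1)); first by rewrite lt_max invr_gt0 e0.
move=> n n1; have [i2 I2] := L2 n n1; split.
  rewrite (Lr_norm_eq (nuE n) (im n)) lee_fin.
  apply: (@le_trans _ _ ((dl * n%:R) `^ p^-1)).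
    rewrite powRM ?(ltW dl0)// ler_wpM2r ?powR_ge0//.
    rewrite -[leRHS]invrK lef_pV2 ?posrE ?invr_gt0//.
      by rewrite le_max lexx.
    by rewrite lt_max invr_gt0 e0.
  apply: ge0_ler_powR; rewrite ?nnegrE ?invr_ge0 ?(ltW p0)//.
  - by rewrite mulr_ge0// ltW.
  - exact: moment_ge0.
  - exact: dlP.
rewrite (Lr_norm_eq (nuE n) i2) lee_fin.
apply: (@le_trans _ _ ((K2 * n%:R) `^ 2^-1)).
  apply: ge0_ler_powR; rewrite ?nnegrE ?invr_ge0//.
  - by apply: rI_ge0 => x; exact: powR_ge0.
  - by rewrite mulr_ge0// ltW.
by rewrite powRM ?(ltW K20)// ler_wpM2r ?powR_ge0// le_max lexx orbT.
Qed.
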